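(* Let $X$ be a compact perfect Polish space. Then \[\{\mathbf{d}' : X \text{ has a } \mathbf{d}\text{-computable Polish presentation}\} = \{\mathbf{d}\oplus\mathbf{0}' : X \text{ has a } \mathbf{d}\text{-computable compact presentation}\}.\]
   Context: A Polish presentation of a Polish space $X$ is a metric $d$ on $\omega$ whose Cauchy completion is homeomorphic to $X$; let $a_i$ be the point corresponding to $i$. It is $\mathbf{d}$-computable if the reals $d(i,j)$ are uniformly $\mathbf{d}$-computable. For compact $X$, a code of a finite rational open cover is a finite $E\subseteq\omega\times\mathbb{Q}$ such that every $x\in X$ satisfies $d(x,a_i)<r$ for some $(i,r)\in E$. A compact presentation is a Polish presentation together with an enumeration of the set of all such codes; it is $\mathbf{d}$-computable if the metric is $\mathbf{d}$-computable and the set of codes is $\mathbf{d}$-c.e. $\mathbf{d}'$ is the Turing jump and $\oplus$ the join of Turing degrees. *)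

(* Defs.v *)
From HB Require Import structures.
From mathcomp Require Import all_boot all_order all_algebra.
From mathcomp Require Import generic_quotient zify ring lra.
From mathcomp Require Import all_classical all_reals all_analysis.

Set Implicit Arguments.
Unset Strict Implicit.
Unset Printing Implicit Defensive.

Import Order.TTheory GRing.Theory Num.Theory.
Import numFieldNormedType.Exports.

Local Open Scope classical_set_scope.
Local Open Scope ring_scope.
Local Open Scope quotient_scope.

(* The bijection (x, y) |-> 2 ^ x * (2 * y + 1) - 1.  It is the pairing that
   underlies [CodeSeq]: [CodeSeq.code (x :: s) = (npair x (CodeSeq.code s)).+1]. *)
Definition npair (x y : nat) : nat := (2 ^ x * y.*2.+1).-1%N.

Definition nunpair (n : nat) : nat * nat :=
  let s := CodeSeq.decode n.+1 in (head 0%N s, CodeSeq.code (behead s)).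

Lemma npairS x y : (npair x y).+1 = CodeSeq.code (x :: CodeSeq.decode y).
Proof.
by rewrite /npair prednK ?muln_gt0 ?expn_gt0 //= CodeSeq.decodeK.
Qed.

Lemma npairK x y : nunpair (npair x y) = (x, y).
Proof. by rewrite /nunpair npairS CodeSeq.codeK /= CodeSeq.decodeK. Qed.

Lemma nunpairK n : npair (nunpair n).1 (nunpair n).2 = n.
Proof.
apply: succn_inj; rewrite npairS /nunpair; move: (CodeSeq.decodeK n.+1).
by case: (CodeSeq.decode n.+1) => [|x s] //= <-; rewrite CodeSeq.codeK.
Qed.

(* Programs for the unary partial recursive functions relative to an oracle;
   functions of several arguments are handled through [npair]. *)
Inductive prog : Type :=
| PZero
| PSucc
| PFst
| PSnd
| POracle
| PPair of prog & prog
| PComp of prog & prog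
| PPrec of prog & prog
| PMu of prog.

(* [prog_eval A c x y]: with oracle [A], the program [c] halts on [x] with output
   [y]. *)
Fixpoint prog_eval (A : set nat) (c : prog) (x y : nat) {struct c} : Prop :=
  match c with
  | PZero => y = 0%N
  | PSucc => y = x.+1
  | PFst => y = (nunpair x).1
  | PSnd => y = (nunpair x).2
  | POracle => y = (x \in A)
  | PPair f g =>
      exists a b, [/\ prog_eval A f x a, prog_eval A g x b & y = npair a b]
  | PComp f g => exists2 z, prog_eval A g x z & prog_eval A f z y
  | PPrec f g =>
      let a := (nunpair x).1 in
      (fix rec (n : nat) (y : nat) : Prop :=
         match n with
         | 0%N => prog_eval A f a y
         | m.+1 => exists2 z, rec m z & prog_eval A g (npair a (npair m z)) y
         end) (nunpair x).2 y
  | PMu f =>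
      prog_eval A f (npair x y) 0%N /\
      forall m, (m < y)%N -> exists k, prog_eval A f (npair x m) k.+1
  end.

Fixpoint prog_code (c : prog) : nat :=
  match c with
  | PZero => 0
  | PSucc => 1
  | PFst => 2
  | PSnd => 3
  | POracle => 4
  | PPair f g => 4 * npair (prog_code f) (prog_code g) + 5
  | PComp f g => 4 * npair (prog_code f) (prog_code g) + 6
  | PPrec f g => 4 * npair (prog_code f) (prog_code g) + 7
  | PMu f => 4 * prog_code f + 8
  end%N.

Lemma prog_code_inj : injective prog_code.
Proof.
have npair_inj a b a' b' : npair a b = npair a' b' -> (a = a') * (b = b').
  by move=> /(congr1 nunpair); rewrite !npairK => -[-> ->].
elim=> [|||||f IHf g IHg|f IHf g IHg|f IHf g IHg|f IHf]
       [|||||f' g'|f' g'|f' g'|f'] //=; try by lia.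
- move=> e; have /npair_inj[/IHf -> /IHg ->] // :
    npair (prog_code f) (prog_code g) = npair (prog_code f') (prog_code g').
  by lia.
- move=> e; have /npair_inj[/IHf -> /IHg ->] // :
    npair (prog_code f) (prog_code g) = npair (prog_code f') (prog_code g').
  by lia.
- move=> e; have /npair_inj[/IHf -> /IHg ->] // :
    npair (prog_code f) (prog_code g) = npair (prog_code f') (prog_code g').
  by lia.
- by move=> e; congr PMu; apply: IHf; lia.
Qed.

Definition turing_le (A B : set nat) : Prop :=
  exists c, forall x, prog_eval B c x (x \in A).

Definition turing_equiv (A B : set nat) : Prop :=
  turing_le A B /\ turing_le B A.

Definition turing_degree (A : set nat) : set (set nat) :=
  [set B | turing_equiv A B].

Definition turing_jump (A : set nat) : set nat :=
  [set e | exists c, prog_code c = e /\ exists y, prog_eval A c e y].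

Definition turing_join (A B : set nat) : set nat :=
  [set n | if odd n then B n./2 else A n./2].

Definition ce_in (D S : set nat) : Prop :=
  exists c, forall x, S x <-> exists y, prog_eval D c x y.

Definition rat_decode (n : nat) : rat :=
  let: (a, m) := nunpair n in let: (b, c) := nunpair m in
  (a%:R - b%:R) / c.+1%:R.

Definition cover_decode (n : nat) : seq (nat * rat) :=
  [seq ((nunpair k).1, rat_decode (nunpair k).2) | k <- CodeSeq.decode n].

Record is_metric (R : realType) (T : Type) (rho : T -> T -> R) : Prop :=
  IsMetric {
    is_metric_xx : forall x, rho x x = 0;
    is_metric_eq : forall x y, rho x y = 0 -> x = y;
    is_metric_sym : forall x y, rho x y = rho y x;
    is_metric_triangle : forall y x z, rho x z <= rho x y + rho y z
  }.

Definition cauchy_seq (R : realType) (T : Type) (rho : T -> T -> R)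
    (u : nat -> T) : Prop :=
  forall e : R, 0 < e ->
  exists N, forall m n, (N <= m)%N -> (N <= n)%N -> rho (u m) (u n) < e.

Definition separable_space (X : topologicalType) : Prop :=
  exists2 A : set X, countable A & dense A.

Definition completely_metrizable (R : realType) (X : topologicalType) : Prop :=
  exists rho : X -> X -> R,
    [/\ is_metric rho,
        (forall (x : X) (U : set X),
           nbhs x U <-> exists2 e, 0 < e & [set y | rho x y < e] `<=` U) &
        (forall u : nat -> X, cauchy_seq rho u ->
           exists l : X, u @ \oo --> l)].

Definition polish_space (R : realType) (X : topologicalType) : Prop :=
  separable_space X /\ completely_metrizable R X.

Definition homeomorphic (X Y : topologicalType) : Prop :=
  exists (f : X -> Y) (g : Y -> X),
    [/\ cancel f g, cancel g f, continuous f & continuous g].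

Record omega_metric (R : realType) := OmegaMetric {
  odist :> nat -> nat -> R;
  odistP : is_metric odist
}.

(* The Cauchy completion: Cauchy sequences modulo d(u_n, v_n) --> 0. *)
Section completion.
Context (R : realType) (d : omega_metric R).

Record cseq := CSeq {
  cseq_fun :> nat -> nat;
  cseqP : cauchy_seq d cseq_fun
}.

HB.instance Definition _ := gen_eqMixin cseq.
HB.instance Definition _ := gen_choiceMixin cseq.

Let dxx x : d x x = 0. Proof. exact: is_metric_xx (odistP d) x. Qed.
Let dC x y : d x y = d y x. Proof. exact: is_metric_sym (odistP d) x y. Qed.
Let dT y x z : d x z <= d x y + d y z.
Proof. exact: is_metric_triangle (odistP d) y x z. Qed.
Let d0 x y : 0 <= d x y.
Proof. by have := dT y x x; rewrite dxx (dC y x) -mulr2n pmulrn_lge0. Qed.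

Definition cseq_dist (u v : cseq) : R := lim (d (u n) (v n) @[n --> \oo]).

Let dist_dist x y z t : `|d x y - d z t| <= d x z + d y t.
Proof.
rewrite ler_norml; apply/andP; split.
  have := dT x z t; have := dT y x t; rewrite (dC z x); lra.
have := dT z x y; have := dT t z y; rewrite (dC t y); lra.
Qed.

Lemma cseq_dist_cvg (u v : cseq) :
  d (u n) (v n) @[n --> \oo] --> cseq_dist u v.
Proof.
rewrite /cseq_dist; apply: cauchy_cvg; apply: cauchy_exP => e e0.
have e20 : 0 < e / 2 by rewrite divr_gt0.
have [N1 h1] := cseqP u e20; have [N2 h2] := cseqP v e20.
exists (d (u (maxn N1 N2)) (v (maxn N1 N2))); exists (maxn N1 N2) => // n /= hn.
rewrite /ball /= (le_lt_trans (dist_dist _ _ _ _)) // [e]splitr.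
by apply: ltrD; [apply: h1|apply: h2]; lia.
Qed.

Let cseq_distE (u v : cseq) (l : R) :
  d (u n) (v n) @[n --> \oo] --> l -> cseq_dist u v = l.
Proof. by move=> h; apply: cvg_lim. Qed.

Let cseq_dist_sym u v : cseq_dist u v = cseq_dist v u.
Proof.
by rewrite /cseq_dist; under eq_fun do rewrite dC.
Qed.

Let cseq_dist_triangle v u w :
  cseq_dist u w <= cseq_dist u v + cseq_dist v w.
Proof.
have h : d (u n) (v n) + d (v n) (w n) @[n --> \oo] -->
    cseq_dist u v + cseq_dist v w.
  exact: cvgD (@cseq_dist_cvg u v) (@cseq_dist_cvg v w).
rewrite -(cvg_lim (@Rhausdorff R) h).
apply: ler_lim; first by apply/cvg_ex; eexists; exact: (@cseq_dist_cvg u w).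
  by apply/cvg_ex; eexists; exact: h.
by apply: nearW => n; exact: dT.
Qed.

Let cseq_distxx u : cseq_dist u u = 0.
Proof.
apply: cseq_distE; rewrite (_ : (fun n => _) = fun=> 0); first exact: cvg_cst.
by apply/funext => n.
Qed.

Let cseq_dist_ge0 u v : 0 <= cseq_dist u v.
Proof.
by have := cseq_dist_triangle v u u;
  rewrite cseq_distxx (cseq_dist_sym v u) -mulr2n pmulrn_lge0.
Qed.

Definition cseq_equiv (u v : cseq) : bool :=
  `[< d (u n) (v n) @[n --> \oo] --> (0 : R) >].

Let cseq_equivE u v : cseq_equiv u v = (cseq_dist u v == 0).
Proof.
apply/asboolP/eqP => [/cseq_distE//|h].
by have := @cseq_dist_cvg u v; rewrite h.
Qed.

Let cseq_equiv_refl : reflexive cseq_equiv.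
Proof. by move=> u; rewrite cseq_equivE cseq_distxx. Qed.

Let cseq_equiv_sym : symmetric cseq_equiv.
Proof. by move=> u v; rewrite !cseq_equivE cseq_dist_sym. Qed.

Let cseq_equiv_trans : transitive cseq_equiv.
Proof.
move=> v u w; rewrite !cseq_equivE => /eqP uv /eqP vw.
by rewrite eq_le cseq_dist_ge0 andbT (le_trans (cseq_dist_triangle v _ _)) //
  uv vw addr0.
Qed.

Canonical cseq_equiv_equiv :=
  EquivRel cseq_equiv cseq_equiv_refl cseq_equiv_sym cseq_equiv_trans.

Definition completion : Type := {eq_quot cseq_equiv}.

HB.instance Definition _ := Choice.on completion.
HB.instance Definition _ := EqQuotient.on completion.

Definition completion_dist (x y : completion) : R :=
  cseq_dist (repr x) (repr y).

Lemma completion_distE (u v : cseq) :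
  completion_dist (\pi_completion u) (\pi_completion v) = cseq_dist u v.
Proof.
have h w : cseq_dist (repr (\pi_completion w)) w = 0.
  by apply/eqP; rewrite -cseq_equivE; apply/eqmodP; rewrite reprK.
have hu := h u; have hv := h v; rewrite /completion_dist.
set u' := repr _ in hu *; set v' := repr _ in hv *.
apply/eqP; rewrite eq_le; apply/andP; split.
  have := cseq_dist_triangle u u' v'; have := cseq_dist_triangle v u v'.
  by rewrite (cseq_dist_sym v v'); lra.
have := cseq_dist_triangle u' u v; have := cseq_dist_triangle v' u' v.
by rewrite (cseq_dist_sym u u'); lra.
Qed.

Let completion_distxx x : completion_dist x x = 0.
Proof. exact: cseq_distxx. Qed.

Let completion_dist_eq x y : completion_dist x y = 0 -> x = y.
Proof.
move=> /eqP; rewrite /completion_dist -cseq_equivE => /eqmodP.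
by rewrite !reprK.
Qed.

Let completion_dist_sym x y : completion_dist x y = completion_dist y x.
Proof. exact: cseq_dist_sym. Qed.

Let completion_dist_triangle y x z :
  completion_dist x z <= completion_dist x y + completion_dist y z.
Proof. exact: cseq_dist_triangle. Qed.

HB.instance Definition _ := @isMetric.Build R completion completion_dist
  completion_distxx completion_dist_eq completion_dist_sym
  completion_dist_triangle.

Let const_cauchy (i : nat) : cauchy_seq d (fun=> i).
Proof. by move=> e e0; exists 0%N => m n _ _; rewrite dxx. Qed.

Definition completion_point (i : nat) : completion :=
  \pi_completion (CSeq (const_cauchy i)).

Lemma mdist_completion_point i j :
  mdist (completion_point i) (completion_point j) = d i j.
Proof.
transitivity (completion_dist (completion_point i) (completion_point j)).
  by [].
rewrite completion_distE; apply: cseq_distE => /=; exact: cvg_cst.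
Qed.

End completion.

Definition computable_metric (R : realType) (D : set nat)
    (d : omega_metric R) : Prop :=
  exists c, forall i j n, exists2 y, prog_eval D c (npair i (npair j n)) y &
    `|ratr (rat_decode y) - d i j| <= 2 ^- n.

(* Codes for the finite E such that the balls B(a_i, r), (i, r) in E, cover
   the completion. *)
Definition cover_codes (R : realType) (d : omega_metric R) : set nat :=
  [set n | forall x : completion d, exists (i : nat) (r : rat),
     (i, r) \in cover_decode n /\ mdist x (completion_point d i) < ratr r].

Record polish_presentation (R : realType) (X : topologicalType) :=
  PolishPresentation {
    pp_metric :> omega_metric R;
    pp_homeo : homeomorphic (completion pp_metric) X
  }.

Record compact_presentation (R : realType) (X : topologicalType) :=
  CompactPresentation {
    cp_polish :> polish_presentation R X;
    cp_enum : nat -> nat;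
    cp_enumE : range cp_enum = cover_codes cp_polish
  }.

Definition computable_polish (R : realType) (X : topologicalType)
    (D : set nat) (P : polish_presentation R X) : Prop :=
  computable_metric D P.

Definition computable_compact (R : realType) (X : topologicalType)
    (D : set nat) (P : compact_presentation R X) : Prop :=
  computable_metric D P /\ ce_in D (cover_codes P).

(* Main.v *)
(** If [d] is a [D]-computable metric on [omega] with compact completion, then
    the covers of the completion are enumerable in the jump [D'], so [D'] itself
    computes a compact presentation, and [D' (+) 0' = D'].

    Conversely let [E] compute a compact presentation [d] of [X]. A set [D] is
    built by forcing with [D' = E (+) 0'], as in the Friedberg jump inversion,
    together with a [D]-computable metric whose completion is homeomorphic to [X].
    A condition is a finite string and a finite metric space [F], attached to a
    net of [X]. To decide whether the [e]-th program halts on [e] with oracle [D],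
    one asks [0'] whether some extension of the string makes it halt, where an
    extension may assert the distances in any finite metric space that is close
    to [F]: the question does not mention [X]. If the answer is positive, then,
    since [X] has no isolated points, the new points can be realized in [X] close
    to the old ones, and the metric of [X] can be changed slightly, without
    changing the topology, so that it takes the asserted values. The
    perturbations decrease so fast that the metrics converge to a metric uniformly
    equivalent to [d]. The set [E] is coded in the limits of the columns of [D]. *)

Require Import Defs.
From mathcomp Require Import all_boot all_order all_algebra.
From mathcomp Require Import generic_quotient zify ring lra.
From mathcomp Require Import all_classical all_reals all_analysis.
Set Implicit Arguments.
Unset Strict Implicit.
Unset Printing Implicit Defensive.
Import Order.TTheory GRing.Theory Num.Theory.
Import numFieldNormedType.Exports.
Local Open Scope classical_set_scope.
Local Opaque npair nunpair.

(** * Computable total functions *)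

(** Uniform closeness of metrics does not by itself preserve the topology. So a stage hands on only
    finitely many rounded distances, and each refinement starts again from [d] and from those
    integers. Two tests tie the integers to [d]: a distance is at most 2 units or the points are
    more than ten meshes apart, and points are within [2 ^- s] or their distance exceeds 200 units.
    In the limit the tests give uniform continuity in both directions.

    Negative answers of [0'] shape the constants. If no extension makes the program halt, no later
    stage may do so by accident. None can, provided that a later stage, seen as a finite metric over
    the present one, is itself an admissible extension; hence later motion has to stay below the
    tolerance built into the question.

    All other demands on a stage are enumerable in [E]: strict inequalities between distances and,
    thanks to the enumeration of covers, being a net. Each state carries a bound on the search for
    certificates; this makes the demands decidable, and the next stage is found by unbounded
    search. *)

Definition computable (A : set nat) (f : nat -> nat) : Prop :=
  exists c, forall x, prog_eval A c x (f x).

Definition pi1 (x : nat) : nat := (nunpair x).1.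
Definition pi2 (x : nat) : nat := (nunpair x).2.

Lemma pi1K x y : pi1 (npair x y) = x. Proof. by rewrite /pi1 npairK. Qed.
Lemma pi2K x y : pi2 (npair x y) = y. Proof. by rewrite /pi2 npairK. Qed.
Lemma npair_pi x : npair (pi1 x) (pi2 x) = x. Proof. exact: nunpairK. Qed.

Definition nrec (b : nat) (h : nat -> nat -> nat) (n : nat) : nat :=
  nat_rect (fun=> nat) b h n.

Lemma nrec_iter b (h : nat -> nat) n : nrec b (fun=> h) n = iter n h b.
Proof. by elim: n => //= n ->. Qed.

Lemma prog_eval_prec A f g a n b h : prog_eval A f a b ->
    (forall m, prog_eval A g (npair a (npair m (nrec b h m))) (nrec b h m.+1)) ->
  prog_eval A (PPrec f g) (npair a n) (nrec b h n).
Proof.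
move=> hf hg; rewrite /= npairK /=; elim: n => // n IHn.
by exists (nrec b h n).
Qed.

Lemma prog_eval_mu A c x (R : pred nat) : (exists y, R y) ->
    (forall y, prog_eval A c (npair x y) (~~ R y)) ->
  exists y, prog_eval A (PMu c) x y /\ R y.
Proof.
move=> exR hc; have [y Ry ymin] := ex_minnP exR; exists y; split => //=.
split=> [|m lt_m]; first by have := hc y; rewrite Ry.
exists 0; have := hc m; case: (boolP (R m)) => // /ymin; lia.
Qed.

Section ComputableTheory.
Variable A : set nat.
Implicit Types f g h n b : nat -> nat.

Lemma computable_ext f g : f =1 g -> computable A f -> computable A g.
Proof. by move=> /funext <-. Qed.

Lemma computable_comp f g :
  computable A f -> computable A g -> computable A (fun x => f (g x)).
Proof.
by move=> [c hc] [e he]; exists (PComp c e) => x /=; exists (g x).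
Qed.

Lemma computable_pair f g :
  computable A f -> computable A g -> computable A (fun x => npair (f x) (g x)).
Proof.
by move=> [c hc] [e he]; exists (PPair c e) => x /=; exists (f x), (g x).
Qed.

Lemma computable_comp2 (f : nat -> nat -> nat) g h :
    computable A (fun z => f (pi1 z) (pi2 z)) -> computable A g -> computable A h ->
  computable A (fun x => f (g x) (h x)).
Proof.
move=> hf hg hh; have := computable_comp hf (computable_pair hg hh).
by apply: computable_ext => x; rewrite pi1K pi2K.
Qed.

Lemma computable_id : computable A (fun x => x).
Proof.
exists (PPair PFst PSnd) => x /=; exists (pi1 x), (pi2 x).
by split=> //; rewrite npair_pi.
Qed.

Lemma computable_pi1 f : computable A f -> computable A (fun x => pi1 (f x)).
Proof. by apply: computable_comp; exists PFst. Qed.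

Lemma computable_pi2 f : computable A f -> computable A (fun x => pi2 (f x)).
Proof. by apply: computable_comp; exists PSnd. Qed.

Lemma computable_succ f : computable A f -> computable A (fun x => (f x).+1).
Proof. by apply: computable_comp; exists PSucc. Qed.

Lemma computable_oracle f : computable A f -> computable A (fun x => f x \in A).
Proof. by apply: (@computable_comp (fun x => x \in A)); exists POracle. Qed.

Lemma computable_cst k : computable A (fun=> k).
Proof.
by elim: k => [|k]; [exists PZero|apply: computable_succ].
Qed.

Lemma computable_nrec b (h : nat -> nat -> nat -> nat) n : computable A b ->
    computable A (fun z => h (pi1 z) (pi1 (pi2 z)) (pi2 (pi2 z))) ->
    computable A n ->
  computable A (fun x => nrec (b x) (h x) (n x)).
Proof.
move=> [cb hb] [ch hh] [cn hn].
have [ci hi] := computable_id.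
exists (PComp (PPrec cb ch) (PPair ci cn)) => x.
exists (npair x (n x)); first by exists x, (n x).
apply: prog_eval_prec => // m.
by have := hh (npair x (npair m (nrec (b x) (h x) m))); rewrite !(pi1K, pi2K).
Qed.

Lemma computable_iter b (h : nat -> nat -> nat) n : computable A b ->
    computable A (fun z => h (pi1 z) (pi2 z)) -> computable A n ->
  computable A (fun x => iter (n x) (h x) (b x)).
Proof.
move=> hb hh hn; apply: (@computable_ext (fun x => nrec (b x) (fun=> h x) (n x))).
  by move=> x; rewrite nrec_iter.
apply: computable_nrec => //.
apply: (computable_comp2 (f := h)) => //; first exact: computable_pi1 computable_id.
exact: computable_pi2 (computable_pi2 computable_id).
Qed.

Lemma computable_pred f : computable A f -> computable A (fun x => (f x).-1).
Proof.
move=> hf; apply: (@computable_ext (fun x => nrec 0 (fun m _ => m) (f x))).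
  by move=> x; case: (f x).
apply: computable_nrec => //; first exact: computable_cst.
exact: computable_pi1 (computable_pi2 computable_id).
Qed.

Lemma computable_add f g :
  computable A f -> computable A g -> computable A (fun x => f x + g x).
Proof.
move=> hf hg; apply: (@computable_ext (fun x => iter (g x) succn (f x))).
  by move=> x; rewrite iter_succn addnC.
by apply: computable_iter => //; apply/computable_succ/computable_pi2/computable_id.
Qed.

Lemma computable_sub f g :
  computable A f -> computable A g -> computable A (fun x => f x - g x).
Proof.
move=> hf hg; apply: (@computable_ext (fun x => iter (g x) predn (f x))).
  by move=> x; rewrite iter_predn.
by apply: computable_iter => //; apply/computable_pred/computable_pi2/computable_id.
Qed.

Lemma computable_mul f g :
  computable A f -> computable A g -> computable A (fun x => f x * g x).
Proof.
move=> hf hg; apply: (@computable_ext (fun x => iter (g x) (addn (f x)) 0)).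
  by move=> x; rewrite iter_addn_0.
apply: computable_iter => //; first exact: computable_cst.
apply: computable_add; last exact: computable_pi2 computable_id.
exact: (computable_comp hf (computable_pi1 computable_id)).
Qed.

Lemma computable_exp k f : computable A f -> computable A (fun x => k ^ f x).
Proof.
move=> hf; apply: (@computable_ext (fun x => iter (f x) (muln k) 1)).
  by move=> x; elim: (f x) => [|m] /=; rewrite ?expn0 // expnS => ->.
apply: computable_iter => //; first exact: computable_cst.
by apply: computable_mul; [exact: computable_cst|apply/computable_pi2/computable_id].
Qed.

Lemma computable_neg (p : nat -> bool) :
  computable A p -> computable A (fun x => ~~ p x).
Proof.
move=> hp; apply: (@computable_ext (fun x => 1 - p x)).
  by move=> x; case: (p x).
by apply: computable_sub => //; exact: computable_cst.
Qed.

Lemma computable_and (p q : nat -> bool) :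
  computable A p -> computable A q -> computable A (fun x => p x && q x).
Proof.
move=> hp hq; apply: (@computable_ext (fun x => p x * q x)).
  by move=> x; case: (p x); case: (q x).
exact: computable_mul.
Qed.

Lemma computable_or (p q : nat -> bool) :
  computable A p -> computable A q -> computable A (fun x => p x || q x).
Proof.
move=> hp hq; apply: (@computable_ext (fun x => ~~ (~~ p x && ~~ q x))).
  by move=> x; rewrite -negb_or negbK.
exact/computable_neg/computable_and/computable_neg/hq/computable_neg.
Qed.

Lemma computable_imp (p q : nat -> bool) :
  computable A p -> computable A q -> computable A (fun x => p x ==> q x).
Proof.
move=> hp hq; apply: (@computable_ext (fun x => ~~ p x || q x)).
  by move=> x; rewrite implybE.
exact/computable_or/hq/computable_neg.
Qed.

Lemma computable_leq f g :
  computable A f -> computable A g -> computable A (fun x => f x <= g x).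
Proof.
move=> hf hg; apply: (@computable_ext (fun x => 1 - (f x - g x))).
  by move=> x; case: leqP; lia.
by apply/computable_sub/computable_sub => //; exact: computable_cst.
Qed.

Lemma computable_eqn f g :
  computable A f -> computable A g -> computable A (fun x => f x == g x).
Proof.
move=> hf hg; apply: (@computable_ext (fun x => (f x <= g x) && (g x <= f x))).
  by move=> x; rewrite -eqn_leq.
exact/computable_and/computable_leq/hf/hg/computable_leq.
Qed.

Lemma computable_eqb (p q : nat -> bool) :
  computable A p -> computable A q -> computable A (fun x => p x == q x).
Proof.
move=> hp hq; apply: (@computable_ext (fun x => nat_of_bool (p x) == q x)).
  by move=> x; case: (p x); case: (q x).
exact: computable_eqn.
Qed.

Lemma computable_if (p : nat -> bool) f g :
    computable A p -> computable A f -> computable A g ->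
  computable A (fun x => if p x then f x else g x).
Proof.
move=> hp hf hg.
apply: (@computable_ext (fun x => p x * f x + ~~ p x * g x)).
  by move=> x; case: (p x); rewrite /= ?mul1n ?mul0n ?addn0.
apply: computable_add; apply: computable_mul => //; exact: computable_neg.
Qed.

Lemma computable_ifb (p q r : nat -> bool) :
    computable A p -> computable A q -> computable A r ->
  computable A (fun x => if p x then q x else r x).
Proof.
move=> hp hq hr.
apply: (@computable_ext (fun x => if p x then q x : nat else r x)).
  by move=> x; case: (p x).
exact: computable_if.
Qed.

Lemma computable_div4 f : computable A f -> computable A (fun x => f x %/ 4).
Proof.
move=> hf; apply: (@computable_comp (fun k => k %/ 4) f) => // {f hf}.
apply: (@computable_ext (fun k => nrec 0 (fun m r => if r.+1 * 4 <= m.+1 then r.+1 else r) k)).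
  elim=> // k IHk; set F := fun m r : nat => _ in IHk *.
  have -> : nrec 0 F k.+1 = F k (nrec 0 F k) by [].
  rewrite IHk /F; case: ifP => h; lia.
apply: computable_nrec; [exact: computable_cst| |exact: computable_id].
have h1 := computable_pi1 (computable_pi2 computable_id).
have h2 := computable_pi2 (computable_pi2 computable_id).
apply: computable_if => //; last exact: computable_succ.
apply: computable_leq; last exact: computable_succ.
by apply: computable_mul; [exact: computable_succ|exact: computable_cst].
Qed.

End ComputableTheory.

(** * Bounded quantifiers, streams and search *)

Definition ball_lt (n : nat) (p : pred nat) : bool := all p (iota 0 n).
Definition bex_lt (n : nat) (p : pred nat) : bool := has p (iota 0 n).

Lemma ball_ltP n (p : pred nat) : reflect (forall i, i < n -> p i) (ball_lt n p).
Proof.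
apply: (iffP allP) => h i; last by rewrite mem_iota add0n => /h.
by move=> lt_in; apply: h; rewrite mem_iota.
Qed.

Lemma bex_ltP n (p : pred nat) : reflect (exists2 i, i < n & p i) (bex_lt n p).
Proof.
apply: (iffP hasP) => -[i].
  by rewrite mem_iota add0n => lt_in hi; exists i.
by move=> lt_in hi; exists i => //; rewrite mem_iota.
Qed.

Lemma computable_ball A (p : nat -> nat -> bool) n :
    computable A (fun z => p (pi1 z) (pi2 z)) -> computable A n ->
  computable A (fun x => ball_lt (n x) (p x)).
Proof.
move=> hp hn.
apply: (@computable_ext _ (fun x => nrec 1 (fun i r => r * p x i) (n x))).
  move=> x; elim: (n x) => // m /= ->.
  by rewrite /ball_lt -addn1 iotaD all_cat /= andbT add0n; case: all; case: (p x m).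
apply: computable_nrec => //; first exact: computable_cst.
apply: computable_mul; first by apply/computable_pi2/computable_pi2/computable_id.
apply: (computable_comp2 (f := p)) => //.
  by apply/computable_pi1/computable_id.
by apply/computable_pi1/computable_pi2/computable_id.
Qed.

Lemma computable_bex A (p : nat -> nat -> bool) n :
    computable A (fun z => p (pi1 z) (pi2 z)) -> computable A n ->
  computable A (fun x => bex_lt (n x) (p x)).
Proof.
move=> hp hn; apply: (@computable_ext _ (fun x => ~~ ball_lt (n x) (fun i => ~~ p x i))).
  move=> x; congr (nat_of_bool _); apply/idP/idP => [|/bex_ltP[i lt_in hi]].
    by apply: contraR => /bex_ltP h; apply/ball_ltP => i lt_in;
      apply/negP => hi; apply: h; exists i.
  by apply/ball_ltP => h; have := h i lt_in; rewrite hi.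
by apply/computable_neg/computable_ball => //; apply: computable_neg.
Qed.

(* A number is read as a stream through iterated pairing, so that every number
   is a stream and every finite sequence is the beginning of a stream. *)
Definition sget (x k : nat) : nat := pi1 (iter k pi2 x).

Definition mkstream (p : nat -> nat) (n : nat) : nat :=
  nrec 0 (fun m r => npair (p (n - m.+1)) r) n.

Lemma sget_npair0 a r : sget (npair a r) 0 = a. Proof. exact: pi1K. Qed.

Lemma sget_npairS a r k : sget (npair a r) k.+1 = sget r k.
Proof. by rewrite /sget iterSr pi2K. Qed.

Lemma sget_mkstream p n k : k < n -> sget (mkstream p n) k = p k.
Proof.
suff h m : m <= n -> k < m ->
    sget (nrec 0 (fun m r => npair (p (n - m.+1)) r) m) k = p (n - m + k).
  by move=> lt_kn; rewrite /mkstream h // subnn.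
elim: m k => // m IHm [|k] le_mn lt_km /=; first by rewrite sget_npair0 addn0.
by rewrite sget_npairS IHm ?(ltnW le_mn) //; congr p; lia.
Qed.

Lemma computable_sget A f g :
  computable A f -> computable A g -> computable A (fun x => sget (f x) (g x)).
Proof.
move=> hf hg; apply/computable_pi1/(@computable_iter A f (fun=> pi2)) => //.
exact/computable_pi2/computable_pi2/computable_id.
Qed.

Lemma computable_mkstream A (p : nat -> nat -> nat) n :
    computable A (fun z => p (pi1 z) (pi2 z)) -> computable A n ->
  computable A (fun x => mkstream (p x) (n x)).
Proof.
move=> hp hn; apply: computable_nrec => //; first exact: computable_cst.
apply: computable_pair; last by apply/computable_pi2/computable_pi2/computable_id.
apply: (computable_comp2 (f := p)) => //; first by apply/computable_pi1/computable_id.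
apply: computable_sub.
  exact: (computable_comp hn (computable_pi1 (computable_id _))).
by apply/computable_succ/computable_pi1/computable_pi2/computable_id.
Qed.

Ltac computability_step :=
  match goal with
  | |- computable _ (fun x => x) => apply: computable_id
  | |- computable _ (fun _ => ?c) => exact: computable_cst
  | |- computable _ (fun x => pi1 _) => apply: computable_pi1
  | |- computable _ (fun x => pi2 _) => apply: computable_pi2
  | |- computable _ (fun x => npair _ _) => apply: computable_pair
  | |- computable _ (fun x => sget _ _) => apply: computable_sget
  | |- computable _ (fun x => nat_of_bool (_ && _)) => apply: computable_and
  | |- computable _ (fun x => nat_of_bool (_ || _)) => apply: computable_or
  | |- computable _ (fun x => nat_of_bool (_ ==> _)) => apply: computable_imp
  | |- computable _ (fun x => nat_of_bool (~~ _)) => apply: computable_neg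
  | |- computable _ (fun x => nat_of_bool (leq _ _)) => apply: computable_leq
  | |- computable _ (fun x => nat_of_bool (_ == _)) =>
      (apply: computable_eqb) || (apply: computable_eqn)
  | |- computable _ (fun x => nat_of_bool (_ \in _)) => apply: computable_oracle
  | |- computable _ (fun x => nat_of_bool (if _ then _ else _)) => apply: computable_ifb
  | |- computable _ (fun x => if _ then _ else _) => apply: computable_if
  | |- computable _ (fun x => (_ + _)%N) => apply: computable_add
  | |- computable _ (fun x => (_ - _)%N) => apply: computable_sub
  | |- computable _ (fun x => (_ * _)%N) => apply: computable_mul
  | |- computable _ (fun x => expn _ _) => apply: computable_exp
  | |- computable _ (fun x => (_ %/ 4)%N) => apply: computable_div4
  | |- computable _ (fun x => S _) => apply: computable_succ
  | |- computable _ (fun x => predn _) => apply: computable_pred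
  | |- computable ?A (fun x => nat_of_bool (ball_lt (@?n x) (@?p x))) =>
      apply: (@computable_ball A p n); cbv beta
  | |- computable ?A (fun x => nat_of_bool (bex_lt (@?n x) (@?p x))) =>
      apply: (@computable_bex A p n); cbv beta
  | |- computable ?A (fun x => mkstream (@?p x) (@?n x)) =>
      apply: (@computable_mkstream A p n); cbv beta
  | |- computable ?A (fun x => nrec (@?b x) (@?h x) (@?n x)) =>
      apply: (@computable_nrec A b h n); cbv beta
  | |- computable ?A (fun x => iter (@?n x) (@?h x) (@?b x)) =>
      apply: (@computable_iter A b h n); cbv beta
  end.
Ltac computability_eta :=
  match goal with
  | |- computable _ (fun _ => _) => fail 1
  | |- computable ?A ?f => change (computable A (fun x => f x))
  end.
Ltac computability :=
  cbv beta; repeat (assumption || computability_eta || computability_step).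

Lemma computable_choice A (R : nat -> nat -> bool) :
    computable A (fun z => R (pi1 z) (pi2 z)) -> (forall x, exists y, R x y) ->
  exists2 h, computable A h & forall x, R x (h x).
Proof.
move=> /computable_neg [c hc] exR.
have /choice[h hh] : forall x, exists y, prog_eval A (PMu c) x y /\ R x y.
  move=> x; apply: prog_eval_mu => // y.
  by have := hc (npair x y); rewrite pi1K pi2K.
by exists h => [|x]; [exists (PMu c) => x; have [] := hh x|have [] := hh x].
Qed.

(* The search for the next state need only succeed along the invariant [I]. *)
Lemma computable_choice_seq A (R : nat -> nat -> nat -> bool)
    (I : nat -> nat -> Prop) x0 :
    computable A (fun z => R (pi1 (pi1 z)) (pi2 (pi1 z)) (pi2 z)) ->
    I 0 x0 -> (forall s x, I s x -> exists y, R s x y) ->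
    (forall s x y, I s x -> R s x y -> I s.+1 y) ->
  exists S : nat -> nat,
    [/\ computable A S, forall s, I s (S s) & forall s, R s (S s) (S s.+1)].
Proof.
move=> cR I0 exR IS.
(* [PPrec] hands its step program the parameter, the counter and the previous value. The parameter
   is the dummy [0], so the search program reads its data from [npair 0 (npair s x)]. *)
have [c hc] : computable A (fun z =>
    ~~ R (pi1 (pi2 (pi1 z))) (pi2 (pi2 (pi1 z))) (pi2 z)).
  apply: computable_neg.
  apply: (computable_comp2 (f := fun a b => R (pi1 a) (pi2 a) b)) => //; computability.
(* Off the invariant the search may diverge and [nxt] is arbitrary; the recursion never gets
   there. *)
have /choice[nxt hnxt] : forall sx, exists y, I sx.1 sx.2 ->
    prog_eval A (PMu c) (npair 0 (npair sx.1 sx.2)) y /\ R sx.1 sx.2 y.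
  move=> [s x] /=; have [Isx|nI] := pselect (I s x); last by exists 0.
  have [y [h1 h2]] := @prog_eval_mu A c (npair 0 (npair s x)) (R s x) (exR _ _ Isx)
    (fun y => ltac:(have := hc (npair (npair 0 (npair s x)) y);
       rewrite !(pi1K, pi2K) => {}h; exact: h)).
  by exists y.
pose S := nrec x0 (fun s x => nxt (s, x)).
have IS' s : I s (S s).
  elim: s => //= s IHs; have [_] := hnxt (s, S s) IHs; exact: IS.
exists S; split=> [|//|s]; last by have [] := hnxt (s, S s) (IS' s).
have [c0 hc0] := computable_cst A x0; have [ci hi] := computable_id A.
exists (PComp (PPrec c0 (PMu c)) (PPair PZero ci)) => s.
exists (npair 0 s); first by exists 0, s.
apply: prog_eval_prec => // m.
by have [] := hnxt (m, S m) (IS' m).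
Qed.

(** * Turing reducibility and joins *)

Fixpoint prog_subst (o c : prog) : prog :=
  match c with
  | POracle => o
  | PPair f g => PPair (prog_subst o f) (prog_subst o g)
  | PComp f g => PComp (prog_subst o f) (prog_subst o g)
  | PPrec f g => PPrec (prog_subst o f) (prog_subst o g)
  | PMu f => PMu (prog_subst o f)
  | c => c
  end.

Lemma prog_eval_subst A B o c x y : (forall x, prog_eval A o x (x \in B)) ->
  prog_eval B c x y -> prog_eval A (prog_subst o c) x y.
Proof.
move=> ho; elim: c x y => [|||||f IHf g IHg|f IHf g IHg|f IHf g IHg|f IHf] x y //=.
- by move=> ->.
- by move=> [a [b [/IHf hf /IHg hg ->]]]; exists a, b.
- by move=> [z /IHg hg /IHf hf]; exists z.
- elim: (nunpair x).2 y => [|m IHm] y; first exact: IHf.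
  by move=> [z /IHm hz /IHg]; exists z.
- move=> [/IHf hf hm]; split=> // m /hm [k /IHf hk]; by exists k.
Qed.

Lemma computable_oracle_le A B f : turing_le B A -> computable B f -> computable A f.
Proof.
move=> -[ob hob] [c hc]; exists (prog_subst ob c) => x.
exact: prog_eval_subst (hc x).
Qed.

Lemma turing_le_refl A : turing_le A A. Proof. by exists POracle. Qed.

Lemma turing_le_trans B A C : turing_le A B -> turing_le B C -> turing_le A C.
Proof. by move=> hAB hBC; exact: computable_oracle_le hBC hAB. Qed.

Lemma turing_degree_eq A B : turing_equiv A B -> turing_degree A = turing_degree B.
Proof.
move=> [AB BA]; apply/seteqP; split=> C [] h1 h2; split;
  by [apply: turing_le_trans h1|apply: turing_le_trans h2 _].
Qed.

Lemma computable_odd A f : computable A f -> computable A (fun x => odd (f x)).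
Proof.
move=> hf; apply: (@computable_ext _ (fun x => iter (f x) (fun r => 1 - r) 0)).
  by move=> x; elim: (f x) => //= n ->; case: odd.
by computability.
Qed.

Lemma computable_half A f : computable A f -> computable A (fun x => (f x)./2).
Proof.
move=> hf; apply: (@computable_ext _ (fun x =>
    nrec 0 (fun m r => r + odd m) (f x))).
  by move=> x; elim: (f x) => //= n ->; rewrite uphalf_half addnC.
computability; apply: computable_odd; computability.
Qed.

Lemma in_turing_join A B x :
  (x \in turing_join A B) = if odd x then x./2 \in B else x./2 \in A.
Proof.
by apply/idP/idP; rewrite /turing_join; case: ifP => o; rewrite !inE /= o.
Qed.

Lemma turing_le_join A B C :
  turing_le A C -> turing_le B C -> turing_le (turing_join A B) C.
Proof.
move=> hA hB; have ch := computable_half (computable_id C).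
apply: (@computable_ext _ (fun x =>
    if odd x then (x./2 \in B : nat) else (x./2 \in A))).
  by move=> x; rewrite in_turing_join; case: ifP.
apply: computable_if; first exact/computable_odd/computable_id.
  exact: (@computable_comp _ (fun x => x \in B)).
exact: (@computable_comp _ (fun x => x \in A)).
Qed.

Lemma turing_le_joinl A B : turing_le A (turing_join A B).
Proof.
apply: (@computable_ext _ (fun x => 2 * x \in turing_join A B)).
  by move=> x; rewrite in_turing_join mul2n odd_double doubleK.
by apply: computable_oracle; computability.
Qed.

Lemma turing_le_joinr A B : turing_le B (turing_join A B).
Proof.
apply: (@computable_ext _ (fun x => (2 * x).+1 \in turing_join A B)).
  by move=> x; rewrite in_turing_join /= mul2n odd_double /= uphalf_double.
by apply: computable_oracle; computability.
Qed.

(** * A fuel-bounded universal evaluator *)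

Lemma leq_npairl a b : a <= npair a b.
Proof.
Local Transparent npair.
rewrite /npair -ltnS prednK ?muln_gt0 ?expn_gt0 //.
by rewrite (leq_trans (ltn_expl a (isT : 1 < 2))) // leq_pmulr.
Local Opaque npair.
Qed.

Lemma leq_npairr a b : b <= npair a b.
Proof.
Local Transparent npair.
rewrite /npair -ltnS prednK ?muln_gt0 ?expn_gt0 //.
by rewrite (@leq_trans b.*2.+1) ?ltnS -?addnn ?leq_addr // leq_pmull // expn_gt0.
Local Opaque npair.
Qed.

(** The codes below 5 are the atoms; beyond, [n - 5] modulo 4 selects the constructor, and the parts
    are smaller because pairing dominates its components. As every number is a code, stage [s] can
    treat program [s] without first checking that [s] is one. *)
Lemma prog_code_surj n : exists c, prog_code c = n.
Proof.
elim/ltn_ind: n => n IHn.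
have [|le5n] := ltnP n 5.
  case: n IHn => [|[|[|[|[|n]]]]] _ //; by
    [exists PZero|exists PSucc|exists PFst|exists PSnd|exists POracle].
pose q := (n - 5) %/ 4; have lt_qn : q < n by rewrite /q; lia.
have [cq hq] := IHn q lt_qn.
have [c1 h1] : exists c, prog_code c = pi1 q.
  by apply: IHn; rewrite (leq_ltn_trans _ lt_qn) // -{2}(npair_pi q) leq_npairl.
have [c2 h2] : exists c, prog_code c = pi2 q.
  by apply: IHn; rewrite (leq_ltn_trans _ lt_qn) // -{2}(npair_pi q) leq_npairr.
have : [|| n == 4 * q + 5, n == 4 * q + 6, n == 4 * q + 7 | n == 4 * q + 8].
  by rewrite /q; lia.
case/or4P => /eqP ->; [exists (PPair c1 c2)|exists (PComp c1 c2)
  |exists (PPrec c1 c2)|exists (PMu cq)]; by rewrite /= ?h1 ?h2 ?npair_pi ?hq.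
Qed.

Definition prog_of (n : nat) : prog := projT1 (cid (prog_code_surj n)).

Lemma prog_ofK n : prog_code (prog_of n) = n.
Proof. by rewrite /prog_of; case: cid. Qed.

(* Value [0] stands for "no result within the fuel" and [y.+1] for the result
   [y]; the fuel bounds the arguments, the unbounded searches and the part of
   the oracle that is read. *)
Definition ev_pair (F G : nat -> nat) x :=
  if (F x != 0) && (G x != 0) then (npair (F x).-1 (G x).-1).+1 else 0.
Definition ev_comp (F G : nat -> nat) x := if G x != 0 then F (G x).-1 else 0.
Definition ev_prec (F G : nat -> nat) x :=
  nrec (F (pi1 x)) (fun m z =>
    if z != 0 then G (npair (pi1 x) (npair m z.-1)) else 0) (pi2 x).
(** The accumulator is [0] while the search runs, [1] once an undefined value has blocked it, and
    [y.+2] once the zero [y] is found. The final predecessor turns both [0] and [1] into no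
    result. *)
Definition ev_mu (B : nat) (F : nat -> nat) x :=
  (nrec 0 (fun y r => if r != 0 then r else
     if F (npair x y) == 0 then 1 else if F (npair x y) == 1 then y.+2 else 0) B).-1.

Fixpoint fev (w B : nat) (c : prog) (x : nat) : nat :=
  if x < B then
    match c with
    | PZero => 1
    | PSucc => x.+2
    | PFst => (pi1 x).+1
    | PSnd => (pi2 x).+1
    | POracle => (sget w x != 0).+1
    | PPair f g => ev_pair (fev w B f) (fev w B g) x
    | PComp f g => ev_comp (fev w B f) (fev w B g) x
    | PPrec f g => ev_prec (fev w B f) (fev w B g) x
    | PMu f => ev_mu B (fev w B f) x
    end
  else 0.

Definition agree (D : set nat) (w B : nat) : Prop :=
  forall k, k < B -> (k \in D) = (sget w k != 0).

Lemma fev_sound D w B c x y : agree D w B ->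
  fev w B c x = y.+1 -> prog_eval D c x y.
Proof.
move=> Dw; elim: c x y => [|||||f IHf g IHg|f IHf g IHg|f IHf g IHg|f IHf] x y /=;
  case: ltnP => // lt_xB.
- by case.
- by case.
- by case.
- by case.
- by rewrite -Dw // => -[].
- rewrite /ev_pair; case ef: fev => [|a]; case eg: fev => [|b] //= -[<-].
  by exists a, b; split; [apply: IHf|apply: IHg|].
- rewrite /ev_comp; case eg: fev => [|b] //= ef.
  by exists b; [apply: IHg|apply: IHf].
- rewrite /ev_prec -/(pi2 x) -/(pi1 x); elim: (pi2 x) y => [|m IHm] y /=.
    exact: IHf.
  case e: (nrec _ _ m) (IHm) => [|z] //= hz eg.
  by exists z; [apply: hz|apply: IHg].
- rewrite /ev_mu; set h := fun y r : nat => _.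
  suff H n : nrec 0 h n = 0 /\ (forall m, m < n -> exists k, fev w B f (npair x m) = k.+2)
      \/ nrec 0 h n = 1 \/
      exists2 y, nrec 0 h n = y.+2 & fev w B f (npair x y) = 1 /\
        (forall m, m < y -> exists k, fev w B f (npair x m) = k.+2).
    move=> e; have [[e0 _]|[e0|[z e0 [h1 h2]]]] := H B; move: e; rewrite e0 //=.
    move=> -[<-]; split; first exact: IHf.
    by move=> m /h2[k /IHf]; exists k.
  elim: n => [|n [[e h0]|[e|[z e hz]]]]; rewrite ?[nrec _ _ n.+1]/= ?[nrec _ _ _.+1]/(h n (nrec 0 h n)) ?e.
  + by left.
  + rewrite /h /=; case: eqP => [_|h1]; first by right; left.
    case: eqP => [h2|h2]; first by right; right; exists n.
    left; split=> // m; rewrite ltnS leq_eqVlt => /orP[/eqP ->|/h0//].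
    by case: fev h1 h2 => [|[|k]] //; exists k.
  + by right; left.
  + by right; right; exists z.
Qed.

Definition eventually_nat (P : nat -> Prop) := exists B0, forall B, B0 <= B -> P B.

Lemma eventually_natI P Q : eventually_nat P -> eventually_nat Q ->
  eventually_nat (fun B => P B /\ Q B).
Proof.
by move=> [B1 h1] [B2 h2]; exists (maxn B1 B2) => B; rewrite geq_max => /andP[/h1 ? /h2].
Qed.

Lemma eventually_nat_forall n (P : nat -> nat -> Prop) :
    (forall m, m < n -> eventually_nat (P m)) ->
  eventually_nat (fun B => forall m, m < n -> P m B).
Proof.
elim: n => [|n IHn] h; first by exists 0.
have [B0 hB] := eventually_natI (IHn (fun m lt_mn => h m (ltnW lt_mn))) (h n (ltnSn n)).
exists B0 => B /hB[h1 h2] m; rewrite ltnS leq_eqVlt => /orP[/eqP -> //|]; exact: h1.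
Qed.

(** Success is claimed for all large fuels rather than for one, so that finitely many
    subcomputations get a common fuel without any monotonicity statement for [fev]. *)
Lemma fev_complete D c x y : prog_eval D c x y ->
  eventually_nat (fun B => forall w, agree D w B -> fev w B c x = y.+1).
Proof.
have withx z P : eventually_nat P -> eventually_nat (fun B => z < B /\ P B).
  by apply: eventually_natI; exists z.+1.
elim: c x y => [|||||f IHf g IHg|f IHf g IHg|f IHf g IHg|f IHf] x y /=.
- by move=> ->; exists x.+1 => B -> w.
- by move=> ->; exists x.+1 => B -> w.
- by move=> ->; exists x.+1 => B -> w.
- by move=> ->; exists x.+1 => B -> w.
- by move=> ->; exists x.+1 => B ltB w Dw; rewrite ltB Dw.
- move=> [a [b [/IHf hf /IHg hg ->]]].
  have [B0 h] := withx x _ (eventually_natI hf hg).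
  exists B0 => B /h[lt_xB [h1 h2]] w Dw.
  by rewrite lt_xB /ev_pair h1 // h2.
- move=> [z /IHg hg /IHf hf].
  have [B0 h] := withx x _ (eventually_natI hf hg).
  exists B0 => B /h[lt_xB [h1 h2]] w Dw.
  by rewrite lt_xB /ev_comp h2 //= h1.
- rewrite -/(pi2 x) -/(pi1 x) => H.
  suff [B0 h] : eventually_nat (fun B => forall w, agree D w B ->
      ev_prec (fev w B f) (fev w B g) x = y.+1).
    by exists (maxn B0 x.+1) => B; rewrite geq_max => /andP[hB ->]; apply: h.
  rewrite /ev_prec; elim: (pi2 x) y H => [|m IHm] y /=; first exact: IHf.
  move=> [z /IHm hz /IHg hg].
  have [B0 h] := eventually_natI hz hg; exists B0 => B /h[h1 h2] w Dw.
  by rewrite h1 //= h2.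
- move=> [/IHf hy hm].
  have {hm} : eventually_nat (fun B => forall m, m < y ->
      exists k, forall w, agree D w B -> fev w B f (npair x m) = k.+2).
    apply: eventually_nat_forall => m /hm[k /IHf[B0 h]].
    by exists B0 => B /h hB; exists k.
  move=> /eventually_natI/(_ hy)/(withx (maxn x y))[B0 h]; exists B0 => B /h[].
  rewrite gtn_max => /andP[lt_xB lt_yB] [h1 h2] w Dw; rewrite lt_xB /ev_mu.
  set u := fun y r : nat => _.
  have h0 n : n <= y -> nrec 0 u n = 0.
    elim: n => // n IHn lt_ny; rewrite [nrec _ _ _]/(u n (nrec 0 u n)) IHn ?(ltnW lt_ny) //.
    by have [k hk] := h1 n lt_ny; rewrite /u /= hk.
  suff -> : nrec 0 u B = y.+2 by [].
  rewrite -(subnKC lt_yB); elim: (B - y.+1) => [|n IHn]; last first.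
    by rewrite addnS [nrec _ _ _]/(u _ (nrec 0 u (y.+1 + n))) IHn.
  by rewrite addn0 [nrec _ _ _]/(u y (nrec 0 u y)) h0 // /u /= h2.
Qed.

(** [fev] recurses on syntax trees. Here the same clauses are driven by the code, and [look]
    supplies the values of the programs with smaller codes, so that evaluation becomes a
    course-of-values recursion on numbers. *)
Definition ev_code (w B : nat) (look : nat -> nat -> nat) (c x : nat) : nat :=
  if x < B then
    if c == 0 then 1 else if c == 1 then x.+2 else if c == 2 then (pi1 x).+1 else
    if c == 3 then (pi2 x).+1 else if c == 4 then (sget w x != 0).+1 else
    if c - 5 == 4 * ((c - 5) %/ 4)
    then ev_pair (look (pi1 ((c - 5) %/ 4))) (look (pi2 ((c - 5) %/ 4))) x else
    if c - 5 == 4 * ((c - 5) %/ 4) + 1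
    then ev_comp (look (pi1 ((c - 5) %/ 4))) (look (pi2 ((c - 5) %/ 4))) x else
    if c - 5 == 4 * ((c - 5) %/ 4) + 2
    then ev_prec (look (pi1 ((c - 5) %/ 4))) (look (pi2 ((c - 5) %/ 4))) x else
    ev_mu B (look ((c - 5) %/ 4)) x
  else 0.

Lemma ev_codeE w B look c x :
    (forall e, prog_code e < prog_code c -> look (prog_code e) = fev w B e) ->
  ev_code w B look (prog_code c) x = fev w B c x.
Proof.
case: c => [|||||f g|f g|f g|f] hlook; rewrite /ev_code //=; case: ltnP => // lt_xB;
  do 5 (case: eqP => [|_]; first by lia).
- set q := npair _ _; have -> : (4 * q + 5 - 5) %/ 4 = q by lia.
  case: eqP => [_|]; last by lia.
  by rewrite pi1K pi2K !hlook //=; have := leq_npairl (prog_code f) (prog_code g);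
    have := leq_npairr (prog_code f) (prog_code g); lia.
- set q := npair _ _; have -> : (4 * q + 6 - 5) %/ 4 = q by lia.
  case: eqP => [|_]; first by lia.
  case: eqP => [_|]; last by lia.
  by rewrite pi1K pi2K !hlook //=; have := leq_npairl (prog_code f) (prog_code g);
    have := leq_npairr (prog_code f) (prog_code g); lia.
- set q := npair _ _; have -> : (4 * q + 7 - 5) %/ 4 = q by lia.
  do 2 (case: eqP => [|_]; first by lia).
  case: eqP => [_|]; last by lia.
  by rewrite pi1K pi2K !hlook //=; have := leq_npairl (prog_code f) (prog_code g);
    have := leq_npairr (prog_code f) (prog_code g); lia.
- set q := prog_code f; have -> : (4 * q + 8 - 5) %/ 4 = q by lia.
  do 3 (case: eqP => [|_]; first by lia).
  by rewrite !hlook //=; lia.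
Qed.

(** [H] lists the rows for the codes below [c] with the newest in front, so the row of [e] is at
    position [c - e.+1]. *)
Definition ev_look (B H c e x : nat) : nat :=
  if x < B then sget (sget H (c - e.+1)) x else 0.

Definition ev_table (w B n : nat) : nat :=
  nrec 0 (fun c H => npair (mkstream (ev_code w B (ev_look B H c) c) B) H) n.

Definition universal (w B e x : nat) : nat :=
  if x < B then sget (sget (ev_table w B e.+1) 0) x else 0.

Lemma ev_tableE w B n c : prog_code c < n ->
  ev_look B (ev_table w B n) n (prog_code c) = fev w B c.
Proof.
elim: n c => // n IHn c; rewrite ltnS leq_eqVlt => le_cn; apply/funext => x.
rewrite /ev_look; case: ltnP => [lt_xB|]; last first.
  by case: c le_cn => /= *; case: ltnP => //; lia.
have -> : ev_table w B n.+1 = npair (mkstream (ev_code w B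
  (ev_look B (ev_table w B n) n) n) B) (ev_table w B n) by [].
rewrite subSS.
case/orP: le_cn => [/eqP e|lt_cn].
  have -> : n - prog_code c = 0 by lia.
  rewrite sget_npair0 sget_mkstream // -e ev_codeE // => d lt_d.
  by rewrite e IHn // -e.
have -> : n - prog_code c = (n - (prog_code c).+1).+1 by lia.
by rewrite sget_npairS -(IHn _ lt_cn) /ev_look lt_xB.
Qed.

Lemma universalE w B c x : universal w B (prog_code c) x = fev w B c x.
Proof.
by rewrite -(@ev_tableE w B (prog_code c).+1) // /ev_look subnn.
Qed.

Lemma computable_universal A f g h k :
    computable A f -> computable A g -> computable A h -> computable A k ->
  computable A (fun x => universal (f x) (g x) (h x) (k x)).
Proof.
move=> hf hg hh hk.
suff H : computable A (fun z => universal (pi1 z) (pi1 (pi2 z))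
    (pi1 (pi2 (pi2 z))) (pi2 (pi2 (pi2 z)))).
  have := computable_comp H (computable_pair hf (computable_pair hg (computable_pair hh hk))).
  by apply: computable_ext => x; rewrite !(pi1K, pi2K).
rewrite /universal /ev_table /ev_code /ev_pair /ev_comp /ev_prec /ev_mu /ev_look.
by computability.
Qed.

Definition restr (A : set nat) (B : nat) : nat := mkstream (fun k => k \in A) B.

Lemma agree_restr A B : agree A (restr A B) B.
Proof. by move=> k ltkB; rewrite sget_mkstream //; case: (k \in A). Qed.

Lemma universalP A c x :
  (exists y, prog_eval A c x y) <->
  exists t, universal (restr A t) t (prog_code c) x != 0.
Proof.
split=> [[y /fev_complete[B0 h]]|[t]].
  by exists B0; rewrite universalE (h _ (leqnn _)) //; exact: agree_restr.
rewrite universalE; case e: fev => [|y] // _; exists y.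
exact: fev_sound (@agree_restr A t) e.
Qed.

Lemma computable_restr A f : computable A f -> computable A (fun x => restr A (f x)).
Proof. by move=> hf; rewrite /restr; computability. Qed.

(** * Enumerability and the jump *)

Lemma ce_in_normal D S : ce_in D S -> exists R : nat -> nat -> bool,
  computable D (fun z => R (pi1 z) (pi2 z)) /\ forall x, S x <-> exists t, R x t.
Proof.
move=> [c hc]; exists (fun x t => universal (restr D t) t (prog_code c) x != 0).
split=> [|x]; last by rewrite hc universalP.
computability; apply: computable_universal; computability.
by apply: computable_restr; computability.
Qed.

(** Both results are values of the one function [fev] at a common large fuel. *)
Lemma prog_eval_inj D c x y z : prog_eval D c x y -> prog_eval D c x z -> y = z.
Proof.
move=> /fev_complete hy /fev_complete hz.
have [B h] := eventually_natI hy hz; have [h1 h2] := h B (leqnn _).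
by apply: succn_inj; rewrite -(h1 _ (@agree_restr D B)) (h2 _ (@agree_restr D B)).
Qed.

Lemma prog_eval_search D (R : nat -> nat -> bool) :
  computable D (fun z => R (pi1 z) (pi2 z)) ->
  exists c, forall x, (exists t, prog_eval D (PMu c) x t) <-> exists t, R x t.
Proof.
move=> /computable_neg[c hc]; exists c => x.
have {}hc y : prog_eval D c (npair x y) (~~ R x y).
  by have := hc (npair x y); rewrite pi1K pi2K.
split=> [[t [ht _]]|exR]; last first.
  by have [y []] := @prog_eval_mu D c x (R x) exR hc; exists y.
by exists t; have := prog_eval_inj ht (hc t); case: (R x t).
Qed.

Lemma ce_in_exists D (R : nat -> nat -> bool) :
  computable D (fun z => R (pi1 z) (pi2 z)) -> ce_in D [set x | exists t, R x t].
Proof. by move=> /prog_eval_search[c hc]; exists (PMu c) => x /=; rewrite hc. Qed.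

Fixpoint prog_cst (n : nat) : prog :=
  if n is m.+1 then PComp PSucc (prog_cst m) else PZero.

Lemma prog_eval_cst D n x y : prog_eval D (prog_cst n) x y <-> y = n.
Proof.
split=> [|->]; last by elim: n => //= n; exists n.
by elim: n y => //= n IHn y [z /IHn -> ->].
Qed.

(** From [x] one computes the code of a program that ignores its input and searches for [t] with
    [R x t]. Ignoring the input makes the diagonal in the definition of the jump harmless. *)
Lemma computable_jump D (R : nat -> nat -> bool) :
    computable D (fun z => R (pi1 z) (pi2 z)) ->
  computable (turing_jump D) (fun x => `[< exists t, R x t >]).
Proof.
move=> /prog_eval_search[c hc].
have hcst A : computable A (fun x => prog_code (prog_cst x)).
  apply: (@computable_ext _ (fun x => iter x (fun z => 4 * npair 1 z + 6) 0)).
    by elim=> //= n ->.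
  by computability.
apply: (@computable_ext _ (fun x =>
    prog_code (PComp (PMu c) (prog_cst x)) \in turing_jump D)); last first.
  apply: (@computable_oracle _ (fun x =>
    4 * npair (prog_code (PMu c)) (prog_code (prog_cst x)) + 6)).
  by have hcst' := hcst (turing_jump D); computability.
move=> x; congr nat_of_bool; apply/idP/asboolP; rewrite in_setE.
  move=> [d [/prog_code_inj ->]] [y [z /prog_eval_cst -> hy]].
  by apply/hc; exists y.
move=> /hc[y hy]; exists (PComp (PMu c) (prog_cst x)); split=> //.
by exists y, x => //; apply/prog_eval_cst.
Qed.

Lemma turing_jumpE D e :
  turing_jump D e <-> exists t, universal (restr D t) t e e != 0.
Proof.
rewrite -{2}(prog_ofK e) -universalP; split=> [[c [<- hc]]|h].
  suff -> : prog_of (prog_code c) = c by [].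
  by apply: prog_code_inj; rewrite prog_ofK.
by exists (prog_of e); rewrite prog_ofK.
Qed.

Lemma turing_le_jump D : turing_le D (turing_jump D).
Proof.
have := @computable_jump D (fun x _ => x \in D) ltac:(by computability).
apply: computable_ext => x; congr nat_of_bool; apply/asboolP/idP => [[]//|h].
by exists 0.
Qed.

Lemma turing_le0 D : turing_le set0 D.
Proof. by exists PZero => x; rewrite /= in_set0. Qed.

Lemma turing_jump_mono A D : turing_le A D -> turing_le (turing_jump A) (turing_jump D).
Proof.
move=> leAD.
have := @computable_jump D (fun e t => universal (restr A t) t e e != 0).
have cA : computable D (restr A).
  by apply: computable_oracle_le leAD _; apply: computable_restr; computability.
move=> /(_ ltac:(computability; apply: computable_universal; computability;
  apply: (computable_comp cA); computability)).
apply: computable_ext => e; congr nat_of_bool.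
by apply/asboolP/idP; rewrite in_setE turing_jumpE.
Qed.

(** * Perturbing metrics on finite sets *)

Section MetricPerturbation.
Variable R : realType.
Local Open Scope ring_scope.

Lemma is_metric_ge0 (T : Type) (rho : T -> T -> R) : is_metric rho ->
  forall x y, 0 <= rho x y.
Proof.
move=> h x y; have := is_metric_triangle h y x x.
by rewrite (is_metric_xx h) (is_metric_sym h y x); lra.
Qed.

Lemma exists_min_seq (a : R) (s : seq R) :
  exists2 v, v \in a :: s & forall u, u \in a :: s -> v <= u.
Proof.
elim: s a => [|b s IHs] a.
  by exists a; rewrite ?mem_head // => u; rewrite inE => /eqP ->.
have [v v_in v_min] := IHs b.
have [le_av|lt_va] := leP a v.
  exists a; rewrite ?mem_head // => u; rewrite inE => /orP[/eqP -> //|/v_min].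
  exact: le_trans.
exists v; first by rewrite inE v_in orbT.
by move=> u; rewrite inE => /orP[/eqP ->|/v_min//]; exact: ltW.
Qed.

Lemma exists_min_lt (n : nat) (F : nat -> R) : (0 < n)%N ->
  exists2 i, (i < n)%N & forall j, (j < n)%N -> F i <= F j.
Proof.
case: n => // n _.
have [v] := exists_min_seq (F 0%N) [seq F i | i <- iota 1 n].
rewrite -[_ :: _]/[seq F i | i <- iota 0 n.+1] => /mapP[i].
rewrite mem_iota => lt_in -> h; exists i => // j lt_jn.
by apply: h; apply: map_f; rewrite mem_iota.
Qed.

Lemma exists_max_lt (n : nat) (F : nat -> R) : (0 < n)%N ->
  exists2 i, (i < n)%N & forall j, (j < n)%N -> F j <= F i.
Proof.
move=> /(exists_min_lt (fun i => - F i))[i lt_in h]; exists i => // j /h.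
by rewrite lerN2.
Qed.

Lemma exists_bound_lt (n m : nat) (F : nat -> nat -> R) :
  exists2 C : R, 0 < C & forall i j, (i < n)%N -> (j < m)%N -> F i j <= C.
Proof.
have [->|n_gt0] := posnP n; first by exists 1.
have [->|m_gt0] := posnP m; first by exists 1.
have /choice[u hu] : forall i, exists v, forall j, (j < m)%N -> F i j <= v.
  by move=> i; have [j _ h] := exists_max_lt (F i) m_gt0; exists (F i j).
have [i _ h] := exists_max_lt u n_gt0.
exists (Num.max 1 (u i)); first by rewrite lt_max ltr01.
move=> i' j lt_i' lt_j; rewrite le_max; apply/orP; right.
exact: le_trans (hu i' j lt_j) (h i' lt_i').
Qed.

Definition fin_metric (n : nat) (M : nat -> nat -> R) : Prop :=
  [/\ forall i, (i < n)%N -> M i i = 0,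
      forall i j, (i < n)%N -> (j < n)%N -> i != j -> 0 < M i j,
      forall i j, (i < n)%N -> (j < n)%N -> M i j = M j i &
      forall i j k, (i < n)%N -> (j < n)%N -> (k < n)%N -> M i k <= M i j + M j k].

Lemma fin_metric_ge0 n M : fin_metric n M ->
  forall i j, (i < n)%N -> (j < n)%N -> 0 <= M i j.
Proof.
move=> [h0 hp _ _] i j hi hj; have [->|ne] := eqVneq i j; first by rewrite h0.
exact/ltW/hp.
Qed.

Lemma fin_metric_min n M : fin_metric n M ->
  exists2 mu : R, 0 < mu & forall i j, (i < n)%N -> (j < n)%N -> i != j -> mu <= M i j.
Proof.
move=> [_ hp _ _].
have [C C0 hC] := exists_bound_lt n n (fun i j => (M i j)^-1).
exists C^-1 => [|i j hi hj ne]; first by rewrite invr_gt0.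
by rewrite -[leRHS]invrK lef_pV2 ?hC // posrE ?invr_gt0 ?hp.
Qed.

(* [phi l] is a Lipschitz extension of [M _ l] that penalizes the net points
   farther away than [eps]; the sup metric of these functions is close to [M],
   and adding a small multiple of [d] makes it separate points. *)
Lemma extend_fin_metric (T : Type) (d : T -> T -> R) (n : nat) (p : nat -> T)
    (M : nat -> nat -> R) (eps r Delta : R) : is_metric d -> fin_metric n M ->
    (0 < n)%N -> 0 < eps -> 0 < r -> (forall x y, d x y <= Delta) ->
    (forall i j, (i < n)%N -> (j < n)%N ->
       M i j <= 2 * r \/ 10 * eps < d (p i) (p j)) ->
  exists rho : T -> T -> R, [/\ is_metric rho,
    exists2 K : R, 0 < K & forall x y, rho x y <= K * d x y,
    exists2 kap : R, 0 < kap & forall x y, kap * d x y <= rho x y &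
    forall x y i j, (i < n)%N -> (j < n)%N -> d x (p i) < eps -> d y (p j) < eps ->
      `|rho x y - M i j| <= 3 * r].
Proof.
move=> dm Mm n_gt0 eps_gt0 r_gt0 dD close; have d0 := is_metric_ge0 dm.
have M0 := fin_metric_ge0 Mm; have [Mxx _ Msym Mtri] := Mm.
have [C C_gt0 hC] := exists_bound_lt n n M.
(* A point within [eps] of [p i] is more than [9 * eps] from a [p j] with
   [10 * eps < d (p i) (p j)], so [pen] is at least [8 * eps] there. With this [K] the penalty
   reaches [C], a bound for all of [M], and far net points cannot lower the minimum. *)
pose K := C / (8 * eps); have K_ge0 : 0 <= K by rewrite divr_ge0 ?mulr_ge0 // ltW.
have KE : K * (8 * eps) = C by rewrite divfK // mulf_neq0 // gt_eqF.
pose pen x i := Num.max 0 (d x (p i) - eps).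
have pen0 x i : 0 <= pen x i by rewrite le_max lexx.
have pen_lip x y i : pen x i <= pen y i + d x y.
  rewrite ge_max addr_ge0 ?d0 //= /pen.
  have := is_metric_triangle dm y x (p i).
  by case: (leP 0 (d y (p i) - eps)); lra.
pose F l x i := M i l + K * pen x i.
have /choice[phi' hphi'] : forall lx, exists v,
    (exists2 i, (i < n)%N & v = F lx.1 lx.2 i) /\ forall i, (i < n)%N -> v <= F lx.1 lx.2 i.
  by move=> [l x] /=; have [i lt_in h] := exists_min_lt (F l x) n_gt0;
    exists (F l x i); split=> //; exists i.
pose phi l x := phi' (l, x).
have phi_att l x : exists2 i, (i < n)%N & phi l x = F l x i by have [] := hphi' (l, x).
have phi_le l x i : (i < n)%N -> phi l x <= F l x i by have [_] := hphi' (l, x); apply.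
have phi_lip l x y : phi l x - phi l y <= K * d x y.
  have [i lt_in ->] := phi_att l y; have := phi_le l x i lt_in.
  have := ler_wpM2l K_ge0 (pen_lip x y i); rewrite mulrDr /F; lra.
have phi_near l x i : (i < n)%N -> (l < n)%N -> d x (p i) < eps ->
    M i l - 2 * r <= phi l x <= M i l.
  move=> lt_in lt_ln dx; apply/andP; split; last first.
    have := phi_le l x i lt_in; rewrite /F /pen.
    by rewrite max_l ?mulr0 ?addr0 //; lra.
  have [j lt_jn ->] := phi_att l x; rewrite /F.
  have [Mle|far] := close i j lt_in lt_jn.
    have := Mtri i j l lt_in lt_jn lt_ln; have := mulr_ge0 K_ge0 (pen0 x j); lra.
  have : 8 * eps <= pen x j.
    have := is_metric_triangle dm x (p i) (p j); rewrite (is_metric_sym dm (p i) x).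
    by rewrite le_max => ?; apply/orP; right; lra.
  move=> /(ler_wpM2l K_ge0); rewrite KE.
  have := hC i l lt_in lt_ln; have := M0 j l lt_jn lt_ln; lra.
have /choice[rho0' hrho0'] : forall xy, exists v,
    (exists2 l, (l < n)%N & v = `|phi l xy.1 - phi l xy.2|) /\
    forall l, (l < n)%N -> `|phi l xy.1 - phi l xy.2| <= v.
  move=> [x y] /=; have [l lt_ln h] := exists_max_lt (fun l => `|phi l x - phi l y|) n_gt0.
  by exists (`|phi l x - phi l y|); split=> //; exists l.
pose rho0 x y := rho0' (x, y).
have rho0_att x y : exists2 l, (l < n)%N & rho0 x y = `|phi l x - phi l y|.
  by have [] := hrho0' (x, y).
have rho0_ge x y l : (l < n)%N -> `|phi l x - phi l y| <= rho0 x y.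
  by have [_] := hrho0' (x, y); apply.
have rho0_ge0 x y : 0 <= rho0 x y by have [l _ ->] := rho0_att x y; exact: normr_ge0.
have rho0xx x : rho0 x x = 0 by have [l _ ->] := rho0_att x x; rewrite subrr normr0.
have rho0_le x y : rho0 x y <= rho0 y x.
  by have [l hl ->] := rho0_att x y; rewrite distrC rho0_ge.
have rho0_sym x y : rho0 x y = rho0 y x by apply/eqP; rewrite eq_le !rho0_le.
have rho0_tri y x z : rho0 x z <= rho0 x y + rho0 y z.
  have [l hl ->] := rho0_att x z.
  by rewrite (le_trans (ler_distD (phi l y) _ _)) // lerD ?rho0_ge.
have rho0_lip x y : rho0 x y <= K * d x y.
  have [l hl ->] := rho0_att x y; rewrite ler_norml.
  have := phi_lip l x y; have := phi_lip l y x; rewrite (is_metric_sym dm y x); lra.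
have D_ge0 : 0 <= Delta by rewrite -(is_metric_xx dm (p 0%N)) dD.
(* This keeps [eta * d] below [r]; the final error is [2 * r] from [close] plus this [r]. *)
pose eta := r / (Delta + 1).
have eta_gt0 : 0 < eta by rewrite divr_gt0 // ltr_wpDl.
have eta_le x y : 0 <= eta * d x y <= r.
  rewrite mulr_ge0 ?d0 ?(ltW eta_gt0) //= mulrAC ler_pdivrMr ?ltr_wpDl //.
  by rewrite ler_wpM2l ?(ltW r_gt0) // (le_trans (dD x y)) // lerDl.
exists (fun x y => rho0 x y + eta * d x y); split.
- split=> [x|x y|x y|y x z].
  + by rewrite rho0xx (is_metric_xx dm) mulr0 addr0.
  + move=> h; apply: (is_metric_eq dm); have /andP[h1 _] := eta_le x y.
    have /eqP : eta * d x y = 0 by have := rho0_ge0 x y; lra.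
    by rewrite mulf_eq0 gt_eqF //= => /eqP.
  + by rewrite rho0_sym (is_metric_sym dm).
  + have := ler_wpM2l (ltW eta_gt0) (is_metric_triangle dm y x z).
    have := rho0_tri y x z; rewrite mulrDr; lra.
- exists (K + eta) => [|x y]; first by rewrite ltr_wpDl.
  by rewrite mulrDl lerD2r.
- by exists eta => // x y; rewrite lerDr.
- move=> x y i j lt_in lt_jn dx dy; have /andP[e0 er] := eta_le x y.
  suff : `|rho0 x y - M i j| <= 2 * r by rewrite !ler_norml; lra.
  rewrite ler_norml; apply/andP; split.
    (* The function with index [j] suffices for the lower bound, since near [p j] it is at most
       [M j j = 0]. *)
    have := rho0_ge x y j lt_jn; rewrite ler_norml => /andP[_].
    have /andP[h1 _] := phi_near j x i lt_in lt_jn dx.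
    have /andP[_] := phi_near j y j lt_jn lt_jn dy; rewrite Mxx //; lra.
  have [l lt_ln ->] := rho0_att x y; rewrite lerBlDr ler_norml.
  have := phi_near l x i lt_in lt_ln dx; have := phi_near l y j lt_jn lt_ln dy.
  have := Mtri i j l lt_in lt_jn lt_ln; have := Mtri j i l lt_jn lt_in lt_ln.
  rewrite (Msym j i) //; lra.
Qed.

(* First enlarge [rho] by up to [b], so that it dominates [M] on the points
   [q i], then let these points serve as shortcuts of length [M]. *)
Lemma glue_fin_metric (T : Type) (rho : T -> T -> R) (m : nat) (q : nat -> T)
    (M : nat -> nat -> R) (b : R) : is_metric rho -> fin_metric m M -> 0 < b ->
    (forall i j, (i < m)%N -> (j < m)%N -> q i = q j -> i = j) ->
    (forall i j, (i < m)%N -> (j < m)%N -> `|M i j - rho (q i) (q j)| <= b) ->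
  exists rho' : T -> T -> R, [/\ is_metric rho',
    forall i j, (i < m)%N -> (j < m)%N -> rho' (q i) (q j) = M i j,
    forall x y, `|rho' x y - rho x y| <= b,
    exists2 K : R, 0 < K & forall x y, rho' x y <= K * rho x y &
    exists2 mu : R, 0 < mu & forall x y, Num.min (rho x y) mu <= rho' x y].
Proof.
move=> rm Mm b_gt0 q_inj Mrho; have r0 := is_metric_ge0 rm.
have M0 := fin_metric_ge0 Mm; have [Mxx Mpos Msym Mtri] := Mm.
have [mu mu_gt0 hmu] := fin_metric_min Mm.
have [K' K'_gt0 hK'] : exists2 K' : R, 0 < K' & forall i j, (i < m)%N -> (j < m)%N ->
    i != j -> b <= K' * rho (q i) (q j).
  have rq : fin_metric m (fun i j => rho (q i) (q j)).
    split=> [i _|i j hi hj|i j _ _|i j k _ _ _].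
    - exact: is_metric_xx rm _.
    - by rewrite lt_def r0 andbT; apply: contra_neq => /(is_metric_eq rm)/q_inj; apply.
    - exact: is_metric_sym rm _ _.
    - exact: is_metric_triangle rm _ _ _.
  have [nu nu_gt0 hnu] := fin_metric_min rq.
  exists (b / nu) => [|i j hi hj ne]; first exact: divr_gt0.
  by rewrite mulrAC ler_pdivlMr // ler_wpM2l ?hnu // ltW.
(* A truncated linear function is subadditive, so [up] is a metric. By the choice of [K'] it adds
   the full [b] between distinct [q i], yet it is Lipschitz in [rho], which keeps the topology. *)
pose up x y := rho x y + Num.min b (K' * rho x y).
have kr0 x y : 0 <= K' * rho x y by rewrite mulr_ge0 // ltW.
have up_ge x y : rho x y <= up x y.
  by rewrite lerDl le_min kr0 (ltW b_gt0).
have up_ge0 x y : 0 <= up x y := le_trans (r0 x y) (up_ge x y).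
have up_le x y : up x y <= rho x y + b by rewrite lerD2l ge_min lexx.
have upxx x : up x x = 0.
  by rewrite /up (is_metric_xx rm) mulr0 add0r min_r // ltW.
have up_sym x y : up x y = up y x by rewrite /up (is_metric_sym rm).
have up_tri y x z : up x z <= up x y + up y z.
  have h := is_metric_triangle rm y x z.
  have := ler_wpM2l (ltW K'_gt0) h; rewrite mulrDr /up.
  have := kr0 x y; have := kr0 y z; have := kr0 x z.
  by case: (leP b (K' * rho x y)); case: (leP b (K' * rho y z));
    case: (leP b (K' * rho x z)); lra.
have up_M i j : (i < m)%N -> (j < m)%N -> M i j <= up (q i) (q j).
  move=> hi hj; have [->|ne] := eqVneq i j; first by rewrite Mxx.
  have := Mrho i j hi hj; rewrite ler_norml /up min_l ?hK' //; lra.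
(* One shortcut per path is enough: since [M] is at most [up] on the [q i], two shortcuts and the
   stretch between them are dominated by a single one. *)
pose c x y (ij : nat * nat) := up x (q ij.1) + M ij.1 ij.2 + up (q ij.2) y.
pose I := [seq (i, j) | i <- iota 0 m, j <- iota 0 m].
have /choice[g hg] : forall xy : T * T, exists v : R,
    v \in up xy.1 xy.2 :: map (c xy.1 xy.2) I /\
    forall u, u \in up xy.1 xy.2 :: map (c xy.1 xy.2) I -> v <= u.
  by move=> xy; have [v ? ?] := exists_min_seq (up xy.1 xy.2) (map (c xy.1 xy.2) I);
    exists v.
pose rho' x y := g (x, y).
have rho'_up x y : rho' x y <= up x y by apply: (hg (x, y)).2; rewrite mem_head.
have rho'_c x y i j : (i < m)%N -> (j < m)%N ->
    rho' x y <= up x (q i) + M i j + up (q j) y.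
  move=> hi hj; apply: (hg (x, y)).2; rewrite inE; apply/orP; right.
  apply/mapP; exists (i, j) => //; apply/allpairsP; exists (i, j).
  by rewrite !mem_iota.
have rho'P x y : rho' x y = up x y \/ exists i j, [/\ (i < m)%N, (j < m)%N &
    rho' x y = up x (q i) + M i j + up (q j) y].
  have [+ _] := hg (x, y); rewrite inE => /orP[/eqP|/mapP[[i j]]]; first by left.
  move=> /allpairsP[[i' j']]; rewrite !mem_iota /= => -[hi hj [-> ->]] e.
  by right; exists i', j'.
have rho'_ge0 x y : 0 <= rho' x y.
  have [->//|[i [j [hi hj ->]]]] := rho'P x y.
  have := up_ge0 x (q i); have := up_ge0 (q j) y; have := M0 i j hi hj; lra.
exists rho'; split.
- have sym x y : rho' x y <= rho' y x.
    have [->|[i [j [hi hj ->]]]] := rho'P y x; first by rewrite up_sym.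
    have := rho'_c x y j i hj hi.
    by rewrite (up_sym x (q j)) (up_sym (q i) y) (Msym j i) //; lra.
  split=> [x|x y|x y|y x z].
  + by apply/eqP; rewrite eq_le rho'_ge0 -(upxx x) rho'_up.
  + have [->|[i [j [hi hj ->]]]] := rho'P x y.
      by move=> h; apply: (is_metric_eq rm); have := up_ge x y; have := r0 x y; lra.
    move=> h; have hx : up x (q i) = 0.
      by have := up_ge0 x (q i); have := up_ge0 (q j) y; have := M0 i j hi hj; lra.
    have hy : up (q j) y = 0.
      by have := up_ge0 x (q i); have := up_ge0 (q j) y; have := M0 i j hi hj; lra.
    have hM : M i j = 0 by lra.
    have eij : i = j by apply/eqP; apply: contra_eqT hM => ne; rewrite gt_eqF // Mpos.
    have -> : x = q i.
      by apply: (is_metric_eq rm); have := up_ge x (q i); have := r0 x (q i); lra.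
    by rewrite eij; apply: (is_metric_eq rm); have := up_ge (q j) y;
      have := r0 (q j) y; lra.
  + by apply/eqP; rewrite eq_le !sym.
  + have [->|[i [j [hi hj ->]]]] := rho'P x y; have [->|[k [l [hk hl ->]]]] := rho'P y z.
    * exact: le_trans (rho'_up x z) (up_tri y x z).
    * have := rho'_c x z k l hk hl; have := up_tri y x (q k); lra.
    * have := rho'_c x z i j hi hj; have := up_tri y (q j) z; lra.
    * have := rho'_c x z i l hi hl; have := up_tri y (q j) (q k).
      have := up_M j k hj hk; have := Mtri i j l hi hj hl; have := Mtri j k l hj hk hl; lra.
- move=> i j hi hj; apply/eqP; rewrite eq_le; apply/andP; split.
    by have := rho'_c (q i) (q j) i j hi hj; rewrite !upxx add0r addr0.
  have [->|[k [l [hk hl ->]]]] := rho'P (q i) (q j); first exact: up_M.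
  have := up_M i k hi hk; have := up_M l j hl hj.
  have := Mtri i k j hi hk hj; have := Mtri k l j hk hl hj; lra.
- move=> x y; rewrite ler_norml; have := rho'_up x y; have := up_le x y => h1 h2.
  apply/andP; split; last by lra.
  have [->|[i [j [hi hj ->]]]] := rho'P x y; first by have := up_ge x y; lra.
  have := up_ge x (q i); have := up_ge (q j) y.
  have := is_metric_triangle rm (q i) x y; have := is_metric_triangle rm (q j) (q i) y.
  have := Mrho i j hi hj; rewrite ler_norml; lra.
- exists (1 + K') => [|x y]; first by rewrite ltr_wpDl.
  by rewrite (le_trans (rho'_up x y)) // mulrDl mul1r lerD2l ge_min lexx orbT.
(* A path that jumps between distinct [q i] and [q j] costs at least [mu], a lower bound for [M] off
   the diagonal; every other path is at least [rho] long. *)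
- exists mu => // x y; rewrite ge_min.
  have [->|[i [j [hi hj ->]]]] := rho'P x y; first by rewrite up_ge.
  have := up_ge x (q i); have := up_ge (q j) y.
  have [<-|ne] := eqVneq i j.
    rewrite Mxx // => h1 h2; apply/orP; left.
    have := is_metric_triangle rm (q i) x y; lra.
  have := up_ge0 x (q i); have := up_ge0 (q j) y; have := hmu i j hi hj ne.
  by move=> ? ? ? ? ?; apply/orP; right; lra.
Qed.

End MetricPerturbation.

(** * Integer approximations of a metric and their refinement *)

Definition nat_metric (n : nat) (N : nat -> nat -> nat) : Prop :=
  [/\ forall i, i < n -> N i i = 0,
      forall i j, i < n -> j < n -> i != j -> 0 < N i j,
      forall i j, i < n -> j < n -> N i j = N j i &
      forall i j k, i < n -> j < n -> k < n -> N i k <= N i j + N j k].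

Section Refinement.
Variable R : realType.
Local Open Scope ring_scope.

Lemma exp2V_gt0 k : 0 < (2 ^+ k)^-1 :> R.
Proof. by rewrite invr_gt0 exprn_gt0. Qed.

Lemma exp2V_le k k' : (k <= k')%N -> (2 ^+ k')^-1 <= (2 ^+ k)^-1 :> R.
Proof. by move=> h; rewrite lef_pV2 ?posrE ?exprn_gt0 // ler_weXn2l // ler1n. Qed.

Lemma exp2V_small (e : R) : 0 < e -> exists k0, forall k, (k0 <= k)%N -> (2 ^+ k)^-1 < e.
Proof.
move=> e_gt0; exists (Num.bound e^-1) => k le_k.
rewrite -[ltRHS]invrK ltf_pV2 ?posrE ?invr_gt0 ?exprn_gt0 //.
have /archi_boundP/lt_trans -> // : 0 <= e^-1 by rewrite invr_ge0 ltW.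
by rewrite -natrX ltr_nat (leq_ltn_trans le_k) // ltn_expl.
Qed.

Definition nceil (x : R) : nat := `|Num.ceil x|%N.

Lemma nceilP (x : R) : 0 <= x -> x <= (nceil x)%:R < x + 1.
Proof.
move=> x_ge0; have c0 : (0 <= Num.ceil x)%R.
  by rewrite -(ler_int R) (le_trans x_ge0) // ceil_ge.
rewrite /nceil natr_absz ger0_norm ?ler0z //.
rewrite ceil_ge /=; have := ceilB1_lt x; rewrite intrB; lra.
Qed.

Lemma fin_metric_scale n N k :
  nat_metric n N -> fin_metric n (fun i j => (N i j)%:R / 2 ^+ k : R).
Proof.
move=> [h1 h2 h3 h4]; have e0 := exp2V_gt0 k; split.
- by move=> i /h1 ->; rewrite mul0r.
- by move=> i j hi hj ne; rewrite mulr_gt0 // ltr0n h2.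
- by move=> i j hi hj; rewrite h3.
- by move=> i j l hi hj hl; rewrite -mulrDl ler_wpM2r ?(ltW e0) // -natrD ler_nat h4.
Qed.

(** Rounding up is subadditive and keeps positive values positive, so it preserves the triangle
    inequality and the separation of points; rounding down can destroy both. *)
Lemma nat_metric_nceil n (rho : nat -> nat -> R) (f : nat -> nat) (r : R) :
    is_metric rho -> 0 < r ->
    (forall i j, (i < n)%N -> (j < n)%N -> f i = f j -> i = j) ->
  nat_metric n (fun i j => nceil (rho (f i) (f j) / r)).
Proof.
move=> rm r_gt0 f_inj; have r0 := is_metric_ge0 rm.
have r'0 : 0 < r^-1 by rewrite invr_gt0.
have hN i j := nceilP (mulr_ge0 (r0 (f i) (f j)) (ltW r'0)).
split.
- move=> i _; have := hN i i; rewrite (is_metric_xx rm) mul0r add0r.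
  by move=> _; rewrite /nceil ceil0.
- move=> i j hi hj ne; rewrite lt0n; apply: contra_neq ne => e; apply: f_inj => //.
  have := hN i j; rewrite e => /andP[h _]; apply: (is_metric_eq rm).
  apply/eqP; rewrite eq_le r0 andbT.
  by move: h; rewrite pmulr_lle0.
- by move=> i j _ _; rewrite (is_metric_sym rm).
- move=> i j k _ _ _; rewrite -ltnS -(ltr_nat R) -natr1 natrD.
  have /andP[_ h1] := hN i k; have /andP[h2 _] := hN i j.
  have /andP[h3 _] := hN j k; rewrite (lt_le_trans h1) // lerD2r.
  rewrite (le_trans _ (lerD h2 h3)) // -mulrDl ler_wpM2r ?(ltW r'0) //.
  exact: is_metric_triangle rm _ _ _.
Qed.

Variable d : nat -> nat -> R.
Hypothesis dm : is_metric d.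

Definition totally_bounded := forall e : R, 0 < e ->
  exists n, forall x, exists2 i, (i < n)%N & d x i < e.

Definition no_isolated_point := forall x (e : R) (s : seq nat), 0 < e ->
  exists2 y, y \notin s & d x y < e.

Hypothesis dtb : totally_bounded.
Hypothesis dperf : no_isolated_point.

Lemma totally_bounded_bounded : exists Delta, forall x y, d x y <= Delta.
Proof.
have [n hn] := dtb ltr01; have [C _ hC] := exists_bound_lt n n d.
exists (C + 2) => x y; have [i hi dx] := hn x; have [j hj dy] := hn y.
have := is_metric_triangle dm i x y; have := is_metric_triangle dm j i y.
have := hC i j hi hj; rewrite (is_metric_sym dm j y); lra.
Qed.

(** A prescribed metric on [m] points separates them, so they must be realized by distinct points,
    even when several project to the same old point. This is where the absence of isolated points
    enters. *)
Lemma extend_injection n m (f g : nat -> nat) (e : R) : 0 < e -> (n <= m)%N ->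
    (forall i j, (i < n)%N -> (j < n)%N -> f i = f j -> i = j) ->
    (forall i, (i < n)%N -> g i = i) ->
  exists f1 : nat -> nat, [/\ forall i, (i < n)%N -> f1 i = f i,
    forall i j, (i < m)%N -> (j < m)%N -> f1 i = f1 j -> i = j &
    forall i, (i < m)%N -> d (f1 i) (f (g i)) < e].
Proof.
move=> e_gt0 le_nm f_inj g_id; elim: m le_nm => [|m IHm] le_nm.
  by exists f; split=> // i j; move: le_nm; rewrite leqn0 => /eqP n0 hi; rewrite n0 in f_inj; lia.
move: le_nm; rewrite leq_eqVlt => /orP[/eqP <-|].
  by exists f; split=> // i hi; rewrite g_id // (is_metric_xx dm).
rewrite ltnS => /[dup] le_nm /IHm[f1 [h1 h2 h3]].
have [y yf dy] := dperf (f (g m)) [seq f1 i | i <- iota 0 m] e_gt0.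
have yf1 i : (i < m)%N -> f1 i != y.
  by move=> hi; apply: contraNneq yf => <-; rewrite map_f // mem_iota.
exists (fun i => if i == m then y else f1 i); split=> [i hi|i j|i].
- by rewrite ltn_eqF ?h1 // (leq_trans hi).
- rewrite !ltnS leq_eqVlt => /orP[/eqP ->|hi]; rewrite leq_eqVlt => /orP[/eqP ->|hj] //.
  + by rewrite eqxx (ltn_eqF hj) => /esym/eqP; rewrite (negbTE (yf1 _ hj)).
  + by rewrite eqxx (ltn_eqF hi) => /eqP; rewrite (negbTE (yf1 _ hi)).
  + by rewrite (ltn_eqF hi) (ltn_eqF hj); apply: h2.
- rewrite ltnS leq_eqVlt => /orP[/eqP ->|hi]; first by rewrite eqxx (is_metric_sym dm).
  by rewrite (ltn_eqF hi) h3.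
Qed.

(* The next approximation [N'] realizes an arbitrary finite metric [Np] that is
   close to the current one, on points of the space close to the current ones. *)
Lemma refine_approximation (n m s k l kp : nat) (f g : nat -> nat)
    (N Np : nat -> nat -> nat) (a r0 : R) :
    (0 < n)%N -> nat_metric n N ->
    (forall i j, (i < n)%N -> (j < n)%N -> f i = f j -> i = j) ->
    (forall x, exists2 i, (i < n)%N & d x (f i) < (2 ^+ l)^-1) ->
    (forall i j, (i < n)%N -> (j < n)%N ->
       (N i j <= 2)%N \/ 10 / 2 ^+ l < d (f i) (f j)) ->
    (n <= m)%N -> (forall i, (i < n)%N -> g i = i) ->
    (forall i, (i < m)%N -> (g i < n)%N) -> nat_metric m Np -> 0 <= a ->
    (forall i j, (i < m)%N -> (j < m)%N ->
       `|(Np i j)%:R / 2 ^+ kp - (N (g i) (g j))%:R / 2 ^+ k| <= a) -> 0 < r0 ->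
  exists (n' k' l' : nat) (f' g' : nat -> nat) (N' : nat -> nat -> nat),
  [/\ [/\ (m <= n')%N, (s <= n')%N, (k + 4 <= k')%N, (l < l')%N & (2 ^+ k')^-1 <= r0],
      [/\ nat_metric n' N', forall i, (i < n)%N -> f' i = f i,
          forall i j, (i < n')%N -> (j < n')%N -> f' i = f' j -> i = j,
          forall i, (i < n)%N -> g' i = i & forall i, (i < n')%N -> (g' i < n)%N],
      [/\ forall i, (i < n')%N -> d (f' i) (f (g' i)) < (2 ^+ l)^-1,
          forall i j, (i < n')%N -> (j < n')%N ->
            `|(N' i j)%:R / 2 ^+ k' - (N (g' i) (g' j))%:R / 2 ^+ k| <= a + 7 / 2 ^+ k &
          forall i j, (i < m)%N -> (j < m)%N ->
            `|(N' i j)%:R / 2 ^+ k' - (Np i j)%:R / 2 ^+ kp| <= (2 ^+ k')^-1 :> R] &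
      [/\ forall x, exists2 i, (i < n')%N & d x (f' i) < (2 ^+ l')^-1 / 2,
          forall i j, (i < n')%N -> (j < n')%N ->
            (N' i j <= 2)%N \/ 10 / 2 ^+ l' < d (f' i) (f' j) &
          forall i j, (i < n')%N -> (j < n')%N ->
            d (f' i) (f' j) < (2 ^+ s)^-1 \/ (200 < N' i j)%N]].
Proof.
move=> n_gt0 Nm f_inj f_net f_close le_nm g_id g_lt Npm a_ge0 gN r0_gt0.
have [Delta hDelta] := totally_bounded_bounded.
set r := (2 ^+ k)^-1; have r_gt0 : 0 < r := exp2V_gt0 k.
set eps := (2 ^+ l)^-1; have eps_gt0 : 0 < eps := exp2V_gt0 l.
have [|rho [rm [K1 K1_gt0 hK1] [kap kap_gt0 hkap] hrho]] := extend_fin_metric (p := f)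
    dm (fin_metric_scale k Nm) n_gt0 eps_gt0 r_gt0 hDelta.
  move=> i j hi hj; have [h|h] := f_close i j hi hj; [left|by right].
  by rewrite ler_wpM2r ?(ltW r_gt0) // ler_nat.
have [f1 [f1_f f1_inj f1_near]] := extend_injection eps_gt0 le_nm f_inj g_id.
(* [a] is the error of [Np] and [3 * r] that of [rho], both against [N]. The announced [7] is this
   [3], once more the [3] between [rho] and [N], and [1] for rounding. *)
pose b := a + 3 * r; have b_gt0 : 0 < b by rewrite /b; lra.
have [|rho' [rm' rho'_Np rho'_rho [K2 K2_gt0 hK2] [mu mu_gt0 hmu]]] := glue_fin_metric
    rm (fin_metric_scale kp Npm) b_gt0 f1_inj.
  move=> i j hi hj; have := gN i j hi hj.
  have := hrho _ _ _ _ (g_lt i hi) (g_lt j hj) (f1_near i hi) (f1_near j hj).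
  by rewrite /b !ler_norml -/r; lra.
have K_gt0 : 0 < K2 * K1 by rewrite mulr_gt0.
have rho'_le x y : rho' x y <= K2 * K1 * d x y.
  by rewrite (le_trans (hK2 x y)) // -mulrA ler_wpM2l // ltW.
have [k1 hk1] := exp2V_small r0_gt0.
(* Once [r'] is below this bound, points at [d]-distance at least [2 ^- s] are more than 200 units
   apart: [kap] bounds [rho] from below, and [mu] takes care of the shortcuts. *)
have sep_gt0 : 0 < Num.min (kap / 2 ^+ s.+1) mu / 200.
  by rewrite divr_gt0 // lt_min mu_gt0 mulr_gt0 ?exp2V_gt0.
have [k2 hk2] := exp2V_small sep_gt0.
have [k' [le_k4 /hk1 r'_r0 /hk2 r'_sep]] :
    exists k', [/\ (k + 4 <= k')%N, (k1 <= k')%N & (k2 <= k')%N].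
  by exists (maxn (k + 4) (maxn k1 k2)); rewrite !leq_max !leqnn !orbT.
have r'_r : (2 ^+ k')^-1 <= r by rewrite exp2V_le // (leq_trans (leq_addr 4 k)).
set r' := (2 ^+ k')^-1 in r'_r0 r'_sep r'_r; have r'_gt0 : 0 < r' := exp2V_gt0 k'.
(* More than 2 units after rounding up means [rho'] above [2 * r'], and the Lipschitz constant
   [K2 * K1] then puts [d] above [10 / 2 ^ l'] for a mesh this fine. *)
have net_gt0 : 0 < r' / (10 * (K2 * K1)) by rewrite divr_gt0 ?mulr_gt0.
have [l1 hl1] := exp2V_small net_gt0.
have [l' [lt_ll' /hl1 hl']] : exists l', (l < l')%N /\ (l1 <= l')%N.
  by exists (maxn l.+1 l1); rewrite !leq_max !leqnn orbT.
have eps'_small : 10 * (K2 * K1) / 2 ^+ l' < r'.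
  by move: hl'; rewrite ltr_pdivlMr ?mulr_gt0 // mulrC.
(* Half the mesh, so that the balls of radius [2 ^- l'] around the net cover with the positive
   margin required by [cover_codes_of_margin]. *)
have [n2 hn2] := dtb (divr_gt0 (exp2V_gt0 l') (ltr0n R 2)).
pose P0 := [seq f1 i | i <- iota 0 m].
(* The points carrying [Np] come first and keep their indices; the remaining numbers below
   [maxn n2 s] make the list a net and at least [s] long. *)
pose P := P0 ++ [seq x <- iota 0 (maxn n2 s) | x \notin P0].
have sP0 : size P0 = m by rewrite size_map size_iota.
have uP : uniq P.
  rewrite cat_uniq filter_uniq ?iota_uniq // andbT; apply/andP; split; last first.
    by apply/hasPn => x; rewrite mem_filter => /andP[].
  rewrite map_inj_in_uniq ?iota_uniq // => i j; rewrite !mem_iota => hi hj.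
  exact: f1_inj.
have inP x : (x < maxn n2 s)%N -> x \in P.
  move=> hx; rewrite mem_cat mem_filter mem_iota /= add0n hx andbT.
  by case: (x \in P0).
pose f' i := nth 0%N P i.
have f'_f1 i : (i < m)%N -> f' i = f1 i.
  move=> hi; rewrite /f' nth_cat sP0 hi (nth_map 0%N) ?size_iota //.
  by rewrite nth_iota.
have f'_inj i j : (i < size P)%N -> (j < size P)%N -> f' i = f' j -> i = j.
  by move=> hi hj /eqP; rewrite nth_uniq // => /eqP.
have le_mP : (m <= size P)%N by rewrite size_cat sP0 leq_addr.
have le_sP : (s <= size P)%N.
  rewrite -{1}(size_iota 0 s) uniq_leq_size ?iota_uniq // => x.
  by rewrite mem_iota add0n => /= hx; apply: inP; rewrite leq_max hx orbT.
have /choice[g1 hg1] : forall x, exists i, (i < n)%N /\ d x (f i) < eps.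
  by move=> x; have [i ? ?] := f_net x; exists i.
pose g' i := if (i < m)%N then g i else g1 (f' i).
have g'_lt i : (i < size P)%N -> (g' i < n)%N.
  by move=> _; rewrite /g'; case: ifP => [/g_lt|_] //; have [] := hg1 (f' i).
have g'_near i : d (f' i) (f (g' i)) < eps.
  rewrite /g'; case: ifP => [hi|_]; last by have [] := hg1 (f' i).
  by rewrite f'_f1 ?f1_near.
have rN x y := nceilP (divr_ge0 (is_metric_ge0 rm' x y) (ltW r'_gt0)).
pose N' i j := nceil (rho' (f' i) (f' j) / r').
have hN' i j : rho' (f' i) (f' j) <= (N' i j)%:R / 2 ^+ k' < rho' (f' i) (f' j) + r'.
  have := rN (f' i) (f' j); rewrite -/(N' i j) -/r'.
  set A := rho' _ _ => /andP[h1 h2]; rewrite -ler_pdivrMr // h1 /=.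
  have <- : (A / r' + 1) * r' = A + r' by rewrite mulrDl mul1r divfK // gt_eqF.
  by rewrite ltr_pM2r.
exists (size P), k', l', f', g', N'; split.
- by split=> //; exact: ltW.
- split=> //; first exact: nat_metric_nceil.
  + by move=> i hi; rewrite f'_f1 ?f1_f // (leq_trans hi).
  + by move=> i hi; rewrite /g' (leq_trans hi) // g_id.
- split=> // i j hi hj.
    have /andP[] := hN' i j; have := rho'_rho (f' i) (f' j).
    have := hrho _ _ _ _ (g'_lt i hi) (g'_lt j hj) (g'_near i) (g'_near j).
    by rewrite !ler_norml /b -/r; lra.
  have /andP[] := hN' i j; rewrite !f'_f1 // rho'_Np // ler_norml -/r'; lra.
- split=> [x|i j hi hj|i j hi hj].
  + have [y hy dy] := hn2 x; exists (index y P).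
      by rewrite index_mem inP // leq_max hy.
    by rewrite /f' nth_index // inP // leq_max hy.
  + have [|h] := leqP (N' i j) 2; [by left|right].
    have : 2 * r' < rho' (f' i) (f' j).
      have /andP[_] := hN' i j; have : 3 * r' <= (N' i j)%:R / 2 ^+ k'.
        by rewrite ler_wpM2r ?(ltW r'_gt0) // (ler_nat _ 3).
      lra.
    move=> /lt_le_trans/(_ (rho'_le _ _)) h1.
    rewrite -(ltr_pM2l K_gt0); apply: lt_trans h1.
    rewrite mulrA (mulrC _ 10) (lt_trans eps'_small) //.
    by rewrite -[ltLHS]mul1r ltr_pM2r // ltr1n.
  + have [h|h] := ltP (d (f' i) (f' j)) (2 ^+ s)^-1; [by left|right].
    rewrite -(ltr_nat R) -(ltr_pM2r r'_gt0); have /andP[+ _] := hN' i j.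
    apply: lt_le_trans; apply: lt_le_trans (hmu _ _).
    have h2 : kap / 2 ^+ s.+1 <= rho (f' i) (f' j).
      apply: le_trans (hkap _ _); rewrite ler_wpM2l ?(ltW kap_gt0) //.
      by apply: le_trans h; apply: exp2V_le.
    have : 200 * r' < Num.min (kap / 2 ^+ s.+1) mu by rewrite mulrC -ltr_pdivlMr.
    by rewrite !lt_min => /andP[h3 ->]; rewrite andbT (lt_le_trans h3).
Qed.

End Refinement.

(** * Completions *)

Section CompletionTopology.
Variable R : realType.
Local Open Scope ring_scope.
Local Open Scope quotient_scope.

(** Otherwise choose a point outside each [U l]; a cluster point of this sequence lies in some
    [U l0], which then meets the tail of the sequence. *)
Lemma compact_increasing (X : topologicalType) (U : nat -> set X) :
    compact [set: X] -> (forall l, open (U l)) ->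
    (forall l l', (l <= l')%N -> U l `<=` U l') -> (forall x, exists l, U l x) ->
  exists l, forall x, U l x.
Proof.
move=> cX oU incU covU; apply: contrapT => nU.
have /choice[u hu] : forall l, exists x, ~ U l x.
  by move=> l; apply/existsNP => h; apply: nU; exists l.
have [p [_ pu]] := cX (u @ \oo) _ (filterT).
have [l0 pU] := covU p.
have [x []] := pu (u @` [set l | (l0 <= l)%N]) (U l0) (ltac:(by exists l0 => // l hl; exists l))
  (open_nbhs_nbhs (conj (oU l0) pU)).
by move=> [l /= le_l <-] /(incU _ _ le_l); exact: hu.
Qed.

Lemma mdist_continuous (S T : metricType R) (F : S -> T) :
    (forall x (e : R), 0 < e -> exists2 del : R, 0 < del &
       forall y, mdist x y < del -> mdist (F x) (F y) < e) ->
  continuous F.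
Proof.
move=> h x; apply/metricType_numDomainType.cvgrPdist_lt => e /(h x)[del del_gt0 hdel].
by apply/metricType_numDomainType.nbhs_mdistP; exists del.
Qed.

Section OneMetric.
Variable d : omega_metric R.
Let dm : is_metric d := odistP d.

Lemma mdist_pi (u v : cseq d) :
  d (u n) (v n) @[n --> \oo] --> mdist (\pi_(completion d) u) (\pi_(completion d) v).
Proof.
rewrite [mdist _ _](_ : _ = cseq_dist u v); first exact: cseq_dist_cvg.
exact: completion_distE.
Qed.

Lemma mdist_pi_le (u v : cseq d) (e : R) N :
    (forall n, (N <= n)%N -> d (u n) (v n) <= e) ->
  mdist (\pi_(completion d) u) (\pi_(completion d) v) <= e.
Proof.
move=> h; have hc := @mdist_pi u v; rewrite -(cvg_lim (@Rhausdorff R) hc).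
apply: limr_le; first by apply/cvg_ex; eexists; exact: hc.
by exists N => // n /= /h.
Qed.

Lemma mdist_pi_lt (u v : cseq d) (e : R) :
    mdist (\pi_(completion d) u) (\pi_(completion d) v) < e ->
  exists N, forall n, (N <= n)%N -> d (u n) (v n) < e.
Proof.
move=> lt_e; have /cvgr_lt/(_ _ lt_e)[N _ h] := @mdist_pi u v.
by exists N => n hn; apply: h.
Qed.

Lemma completion_pi (x : completion d) : exists u, x = \pi_(completion d) u.
Proof. by exists (repr x); rewrite reprK. Qed.

Lemma mdist_eq0 (x y : completion d) : (forall e : R, 0 < e -> mdist x y <= e) -> x = y.
Proof.
move=> h; apply: mdist_positivity; apply/eqP; rewrite eq_le mdist_ge0 andbT.
by apply/ler_addgt0Pl => e /h; rewrite addr0.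
Qed.

Lemma completion_point_dense (x : completion d) (e : R) : 0 < e ->
  exists i, mdist x (completion_point d i) < e.
Proof.
move=> e_gt0; have [u ->] := completion_pi x.
have e2 : 0 < e / 2 by rewrite divr_gt0.
have [N hN] := cseqP u e2; exists (u N); apply: (@le_lt_trans _ _ (e / 2)); last lra.
by apply: (@mdist_pi_le _ _ _ N) => n hn /=; apply/ltW/hN.
Qed.

Lemma open_mdist (p : completion d) (e : R) : open [set x | mdist x p < e].
Proof.
rewrite openE => x /= hx; apply/metricType_numDomainType.nbhs_mdistP.
exists (e - mdist x p) => /= [|y /= hy]; first by rewrite subr_gt0.
have := metric_triangle y x p; rewrite (metric_sym y x); lra.
Qed.

Hypothesis compact_d : compact [set: completion d].

Lemma compact_totally_bounded : totally_bounded d.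
Proof.
move=> e e_gt0.
pose U l := [set x : completion d | exists2 i, (i < l)%N & mdist x (completion_point d i) < e].
have [|||l hl] := @compact_increasing _ U compact_d.
- move=> l; rewrite (_ : U l = \bigcup_(i in [set i | (i < l)%N])
     [set x | mdist x (completion_point d i) < e]).
    by apply: bigcup_open => i _; exact: open_mdist.
  by apply/seteqP; split=> [x [i ? ?]|x [i ? ?]]; exists i.
- by move=> l l' le_l x [i hi ?]; exists i => //; exact: leq_trans le_l.
- by move=> x; have [i hi] := completion_point_dense x e_gt0; exists i.+1, i.
- exists l => x; have [i hi] := hl (completion_point d x).
  by rewrite mdist_completion_point; exists i.
Qed.

(** A Lebesgue number argument. It reduces covering the completion to a uniform condition on the
    dense points; the factor 4 leaves room for the errors of a test with approximate distances. *)
Lemma cover_codes_margin n : cover_codes d n ->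
  exists l, forall i, exists j q, (j, q) \in cover_decode n /\ d i j + 4 / 2 ^+ l < ratr q.
Proof.
move=> cov.
pose U l := [set x : completion d | exists j q, (j, q) \in cover_decode n /\
  mdist x (completion_point d j) + 4 / 2 ^+ l < ratr q].
have [|||l hl] := @compact_increasing _ U compact_d.
- move=> l; rewrite (_ : U l = \bigcup_(jq in [set jq | jq \in cover_decode n])
     [set x | mdist x (completion_point d jq.1) < ratr jq.2 - 4 / 2 ^+ l]).
    by apply: bigcup_open => i _; exact: open_mdist.
  apply/seteqP; split=> [x [j [q [h1 h2]]]|x [[j q] /= h1 h2]].
    by exists (j, q) => //=; lra.
  by exists j, q; split=> //; lra.
- move=> l l' le_l x [j [q [h1 h2]]]; exists j, q; split=> //.
  by have := exp2V_le R le_l; lra.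
- move=> x; have [j [q [h1 h2]]] := cov x.
  have h3 : 0 < (ratr q - mdist x (completion_point d j)) / 4 by rewrite divr_gt0 // subr_gt0.
  have [l hl] := exp2V_small h3; exists l, j, q; split=> //.
  have := hl l (leqnn _); lra.
- exists l => i; have [j [q [h1 h2]]] := hl (completion_point d i).
  by rewrite mdist_completion_point in h2; exists j, q.
Qed.

Lemma cover_codes_of_margin n (e : R) : 0 < e ->
    (forall i, exists j q, (j, q) \in cover_decode n /\ d i j + e <= ratr q) ->
  cover_codes d n.
Proof.
move=> e_gt0 h x; have [i hi] := completion_point_dense x e_gt0.
have [j [q [h1 h2]]] := h i; exists j, q; split=> //.
have := metric_triangle x (completion_point d i) (completion_point d j).
by rewrite mdist_completion_point; lra.
Qed.

(** An enumeration by a total function needs a default value. Balls of radius 2 around a net of mesh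
    1 cover with margin 1. *)
Lemma cover_codes_exists : exists n, cover_codes d n.
Proof.
have [n hn] := compact_totally_bounded ltr01.
have two : rat_decode (npair 2 (npair 0 0)) = 2%:R.
  by rewrite /rat_decode !npairK subr0 divr1.
exists (CodeSeq.code [seq npair i (npair 2 (npair 0 0)) | i <- iota 0 n]).
apply: (@cover_codes_of_margin _ 1) => // i; have [j hj dij] := hn i.
exists j, 2; split.
  rewrite /cover_decode CodeSeq.codeK -map_comp; apply/mapP; exists j.
    by rewrite mem_iota.
  by rewrite /= npairK /= two.
by rewrite ratr_nat; lra.
Qed.

(** Shrink [e] below the distances from [k] to the other members of [s]. Perfectness gives a point
    of the completion in that ball different from [k]; a dense point closer to it than both [k] and
    the boundary of the ball is a new index. *)
Lemma perfect_no_isolated_point (X : topologicalType) :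
  homeomorphic (completion d) X -> perfect_set [set: X] -> no_isolated_point d.
Proof.
move=> [f [g [fK gK _ gC]]] [_ limX] k e s e_gt0; have d0 := is_metric_ge0 dm.
have [e' e'_gt0 [le_e' he']] : exists2 e' : R, 0 < e' & e' <= e /\
    forall j, j \in s -> j != k -> e' <= d k j.
  elim: s => [|j s [e' e'_gt0 [h1 h2]]]; first by exists e.
  have [jk|jk] := eqVneq j k.
    by exists e' => //; split=> // i; rewrite inE => /orP[/eqP ->|/h2//]; rewrite jk eqxx.
  have dkj : 0 < d k j.
    by rewrite lt_def d0 andbT; apply: contra_neq jk => /(is_metric_eq dm) ->.
  exists (Num.min e' (d k j)); first by rewrite lt_min e'_gt0.
  split=> [|i]; first by rewrite ge_min h1.
  by rewrite inE ge_min => /orP[/eqP ->|/h2 h /h ->]; rewrite ?lexx ?orbT.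
have : limit_point [set: X] (f (completion_point d k)) by rewrite limX.
move=> /(_ (g @^-1` [set y | mdist (completion_point d k) y < e'])).
have hnb : nbhs (f (completion_point d k))
    (g @^-1` [set y | mdist (completion_point d k) y < e']).
  apply: gC; rewrite fK; apply/metricType_numDomainType.nbhs_mdistP.
  by exists e'.
move=> /(_ hnb)[y [yx _ /= hy]].
have gy : completion_point d k != g y.
  by apply: contra_neq yx => ->; rewrite gK.
move: (gy); rewrite -(mdist_gt0 (completion_point d k)) => hgt.
have [|i hi] := @completion_point_dense (g y) (Num.min (mdist (completion_point d k) (g y))
   (e' - mdist (completion_point d k) (g y))).
  by rewrite lt_min hgt subr_gt0.
move: hi; rewrite lt_min => /andP[hi1 hi2].
have t1 := metric_triangle (completion_point d k) (g y) (completion_point d i).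
have t2 := metric_triangle (completion_point d k) (completion_point d i) (g y).
move: t1 t2; rewrite (metric_sym (completion_point d i) (g y)) mdist_completion_point => t1 t2.
have dki : 0 < d k i by move: hi1 t2; lra.
have dke : d k i < e' by move: hi2 t1; lra.
exists i; last by lra.
apply/negP => /he' h; have : e' <= d k i.
  by apply: h; apply: contraTneq dki => ->; rewrite (is_metric_xx dm) ltxx.
lra.
Qed.

End OneMetric.

Lemma homeomorphic_compact (X Y : topologicalType) :
  homeomorphic X Y -> compact [set: Y] -> compact [set: X].
Proof.
move=> [f [g [fK gK _ gC]]] cY.
have -> : [set: X] = g @` [set: Y].
  by apply/seteqP; split=> // x _; exists (f x).
by apply: continuous_compact => //; apply: continuous_subspaceT.
Qed.

Lemma homeomorphic_trans (X Y Z : topologicalType) :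
  homeomorphic X Y -> homeomorphic Y Z -> homeomorphic X Z.
Proof.
move=> [f [g [fK gK fC gC]]] [h [k [hK kK hC kC]]].
exists (h \o f), (g \o k); split.
- by move=> x /=; rewrite hK fK.
- by move=> x /=; rewrite gK kK.
- by move=> x; apply: continuous_comp; [exact: fC|exact: hC].
- by move=> x; apply: continuous_comp; [exact: kC|exact: gC].
Qed.

Section UniformEquivalence.
Variables (d1 d2 : omega_metric R) (f : nat -> nat).
Hypothesis f_unif : forall e : R, 0 < e -> exists2 del : R, 0 < del &
  forall i j, d1 i j < del -> d2 (f i) (f j) < e.
Hypothesis f_unifV : forall e : R, 0 < e -> exists2 del : R, 0 < del &
  forall i j, d2 (f i) (f j) < del -> d1 i j < e.
Hypothesis f_dense : forall x (e : R), 0 < e -> exists i, d2 (f i) x < e.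

Lemma cauchy_seq_map (u : cseq d1) : cauchy_seq d2 (f \o u).
Proof.
move=> e /f_unif[del /(cseqP u)[N hN] hdel]; exists N => m n hm hn.
exact/hdel/hN.
Qed.

Let fmap (u : cseq d1) := CSeq (cauchy_seq_map u).
Let F (x : completion d1) : completion d2 := \pi_(completion d2) (fmap (repr x)).

Let fmap_unif (e : R) : 0 < e -> exists2 del : R, 0 < del & forall u v : cseq d1,
  mdist (\pi_(completion d1) u) (\pi_(completion d1) v) < del ->
  mdist (\pi_(completion d2) (fmap u)) (\pi_(completion d2) (fmap v)) <= e.
Proof.
move=> /f_unif[del del_gt0 h]; exists del => // u v /mdist_pi_lt[N hN].
by apply: (@mdist_pi_le _ _ _ _ N) => n /hN/h/ltW.
Qed.

Let fmap_unifV (e : R) : 0 < e -> exists2 del : R, 0 < del & forall u v : cseq d1,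
  mdist (\pi_(completion d2) (fmap u)) (\pi_(completion d2) (fmap v)) < del ->
  mdist (\pi_(completion d1) u) (\pi_(completion d1) v) <= e.
Proof.
move=> /f_unifV[del del_gt0 h]; exists del => // u v /mdist_pi_lt[N hN].
by apply: (@mdist_pi_le _ _ _ _ N) => n /hN/h/ltW.
Qed.

Let FE u : F (\pi_(completion d1) u) = \pi_(completion d2) (fmap u).
Proof.
apply: mdist_eq0 => e /fmap_unif[del del_gt0]; apply.
by rewrite reprK mdistxx.
Qed.

(** The induced map is well defined, injective and uniformly continuous both ways by the two moduli.
    For surjectivity, the [n]-th term of a Cauchy sequence is replaced by a value of [f] within
    [2 ^- n]; the preimages are Cauchy by [f_unifV]. *)
Lemma uniform_equivalence_homeomorphic : homeomorphic (completion d1) (completion d2).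
Proof.
have Fu e : 0 < e -> exists2 del : R, 0 < del & forall x y,
    mdist x y < del -> mdist (F x) (F y) <= e.
  move=> /fmap_unif[del del_gt0 h]; exists del => // x y.
  have [u ->] := completion_pi x; have [v ->] := completion_pi y.
  by rewrite !FE; exact: h.
have FuV e : 0 < e -> exists2 del : R, 0 < del & forall x y,
    mdist (F x) (F y) < del -> mdist x y <= e.
  move=> /fmap_unifV[del del_gt0 h]; exists del => // x y.
  have [u ->] := completion_pi x; have [v ->] := completion_pi y.
  by rewrite !FE; exact: h.
have Finj : injective F.
  move=> x y exy; apply: mdist_eq0 => e /FuV[del del_gt0]; apply.
  by rewrite exy mdistxx.
have d2m := odistP d2.
have Fsurj y : exists x, F x = y.
  have [v ->] := completion_pi y.
  have /choice[u hu] : forall n, exists i, d2 (f i) (v n) < (2 ^+ n)^-1.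
    by move=> n; apply: f_dense; exact: exp2V_gt0.
  have cu : cauchy_seq d1 u.
    move=> e /f_unifV[del del_gt0 hdel].
    have del3 : 0 < del / 3 by rewrite divr_gt0.
    have [N1 hN1] := exp2V_small del3; have [N2 hN2] := cseqP v del3.
    exists (maxn N1 N2) => m n; rewrite !geq_max => /andP[m1 m2] /andP[n1 n2].
    apply: hdel; have := hN1 m m1; have := hN1 n n1; have := hN2 m n m2 n2.
    have := hu m; have := hu n; have := is_metric_triangle d2m (v m) (f (u m)) (f (u n)).
    have := is_metric_triangle d2m (v n) (v m) (f (u n)).
    by rewrite (is_metric_sym d2m (v n) (f (u n))); lra.
  exists (\pi_(completion d1) (CSeq cu)); rewrite FE; apply: mdist_eq0 => e.
  move=> /exp2V_small[N hN]; apply: (@mdist_pi_le _ _ _ _ N) => n hn /=.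
  by rewrite ltW // (lt_trans (hu n)) // hN.
have /choice[G hG] := Fsurj.
exists F, G; split=> //.
- by move=> x; apply: Finj; rewrite hG.
- apply: mdist_continuous => x e e_gt0.
  have [|del del_gt0 h] := Fu (e / 2); first by rewrite divr_gt0.
  by exists del => // y /h; lra.
- apply: mdist_continuous => x e e_gt0.
  have [|del del_gt0 h] := FuV (e / 2); first by rewrite divr_gt0.
  exists del => // y hy.
  by have := h (G x) (G y); rewrite !hG => /(_ hy); lra.
Qed.

End UniformEquivalence.
End CompletionTopology.

(** * Deciding rational inequalities and reading codes of covers *)

Definition rat_num x := pi1 x.
Definition rat_sub x := pi1 (pi2 x).
Definition rat_den x := (pi2 (pi2 x)).+1.

(** The inequality [x + a / 2 ^ l < y] between decoded rationals, cleared of denominators and with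
    the subtracted parts moved across to stay within natural numbers. *)
Definition rat_add_lt (x a l y : nat) : bool :=
  rat_num x * rat_den y * 2 ^ l + a * rat_den x * rat_den y + rat_sub y * rat_den x * 2 ^ l
  < rat_num y * rat_den x * 2 ^ l + rat_sub x * rat_den y * 2 ^ l.

Lemma computable_rat_add_lt A f g h k :
    computable A f -> computable A g -> computable A h -> computable A k ->
  computable A (fun x => rat_add_lt (f x) (g x) (h x) (k x)).
Proof.
by move=> *; rewrite /rat_add_lt /rat_num /rat_sub /rat_den; computability.
Qed.

Section RatCompare.
Variable R : realType.
Local Open Scope ring_scope.

Lemma ratr_rat_decode x : ratr (rat_decode x) =
  ((rat_num x)%:R - (rat_sub x)%:R) / (rat_den x)%:R :> R.
Proof.
rewrite /rat_decode /rat_num /rat_sub /rat_den /pi1 /pi2.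
case: (nunpair x) => a m /=; case: (nunpair m) => b c /=.
by rewrite rmorphM fmorphV rmorphB /= !ratr_nat.
Qed.

Lemma rat_add_ltP x a l y :
  rat_add_lt x a l y = (ratr (rat_decode x) + a%:R / 2 ^+ l < ratr (rat_decode y) :> R).
Proof.
rewrite !ratr_rat_decode /rat_add_lt.
have dx : 0 < (rat_den x)%:R :> R by rewrite ltr0n.
have dy : 0 < (rat_den y)%:R :> R by rewrite ltr0n.
have dl : 0 < 2 ^+ l :> R by rewrite exprn_gt0.
rewrite -(ltr_nat R) !natrD !natrM natrX.
move: (rat_num x)%:R (rat_sub x)%:R (rat_den x)%:R (rat_num y)%:R (rat_sub y)%:R
  (rat_den y)%:R (2 ^+ l) a%:R dx dy dl => a1 b1 c1 a2 b2 c2 t a' c1_gt0 c2_gt0 t_gt0.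
have p_gt0 : 0 < c1 * c2 * t by rewrite !mulr_gt0.
rewrite -[in RHS](ltr_pM2r p_gt0).
have -> : ((a1 - b1) / c1 + a' / t) * (c1 * c2 * t) = (a1 - b1) * c2 * t + a' * c1 * c2.
  by field; rewrite !gt_eqF.
have -> : (a2 - b2) / c2 * (c1 * c2 * t) = (a2 - b2) * c1 * t.
  by field; rewrite gt_eqF.
by apply/idP/idP; rewrite !mulrBl; lra.
Qed.

Definition dyadic (a l : nat) : nat := npair a (npair 0 (2 ^ l).-1).

Lemma ratr_dyadic a l : ratr (rat_decode (dyadic a l)) = a%:R / 2 ^+ l :> R.
Proof.
rewrite ratr_rat_decode /dyadic /rat_num /rat_sub /rat_den !(pi1K, pi2K).
by rewrite prednK ?expn_gt0 // subr0 natrX.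
Qed.

End RatCompare.

Lemma computable_dyadic A f g :
  computable A f -> computable A g -> computable A (fun x => dyadic (f x) (g x)).
Proof. by move=> *; rewrite /dyadic; computability. Qed.

Definition code_tail (t : nat) : nat := pi2 t.-1.
Definition code_nth (n k : nat) : nat := iter k code_tail n.

Lemma decodeS n : CodeSeq.decode n.+1 = pi1 n :: CodeSeq.decode (pi2 n).
Proof. by rewrite -{1}(npair_pi n) npairS CodeSeq.codeK. Qed.

(** Codes of successive tails strictly decrease until they reach [0]. So the code bounds the length
    of its list, and a bounded search inspects all entries. *)
Lemma code_nth_bound n k : code_nth n k != 0 -> k < n.
Proof.
have h : code_nth n k != 0 -> code_nth n k + k <= n.
  elim: k => [|k IHk]; first by rewrite addn0.
  rewrite /code_nth iterS -/(code_nth n k); move: IHk; case: (code_nth n k) => [|t] IHk.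
    by rewrite /code_tail /=; have := leq_npairr (pi1 0) (pi2 0); rewrite npair_pi; case: (pi2 0).
  move=> _; have := IHk isT; rewrite /code_tail /=.
  by have := leq_npairr (pi1 t) (pi2 t); rewrite npair_pi; lia.
by move=> /[dup] /h; case: (code_nth n k) => // t; lia.
Qed.

Definition code_has (P : nat -> bool) (n : nat) : bool :=
  bex_lt n (fun k => (code_nth n k != 0) && P (pi1 (code_nth n k).-1)).

Lemma code_hasP (P : nat -> bool) n :
  reflect (exists2 x, x \in CodeSeq.decode n & P x) (code_has P n).
Proof.
apply: (iffP (bex_ltP _ _)).
  move=> [k _ /andP[h hP]]; exists (pi1 (code_nth n k).-1) => //.
  elim: k n h {hP} => [|k IHk] [|n] h; [by []| |by have := code_nth_bound h|].
    by rewrite decodeS; exact: mem_head.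
  have e : code_nth n.+1 k.+1 = code_nth (pi2 n) k by rewrite /code_nth iterSr.
  by rewrite e in h *; rewrite decodeS inE IHk ?orbT.
move=> [x]; elim/ltn_ind: n => -[|n] IHn; first by [].
rewrite decodeS inE => /orP[/eqP -> hP|hx hP]; first by exists 0.
have [|k hk /andP[h1 h2]] := IHn (pi2 n) _ hx hP.
  by rewrite ltnS; have := leq_npairr (pi1 n) (pi2 n); rewrite npair_pi.
have e : code_nth n.+1 k.+1 = code_nth (pi2 n) k by rewrite /code_nth iterSr.
by exists k.+1; rewrite ?e ?h1 ?h2 // code_nth_bound // e.
Qed.

Lemma computable_code_has A (P : nat -> nat -> bool) f :
    computable A (fun z => P (pi1 z) (pi2 z)) -> computable A f ->
  computable A (fun x => code_has (P x) (f x)).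
Proof.
move=> hP hf; rewrite /code_has /code_nth /code_tail.
have hf' : computable A (fun z => f (pi1 z)) by apply: computable_comp hf _; computability.
have hn : computable A (fun z => iter (pi2 z) (fun t => pi2 t.-1) (f (pi1 z))).
  by computability.
apply: (@computable_bex A (fun x k => (iter k (fun t => pi2 t.-1) (f x) != 0) &&
   P x (pi1 (iter k (fun t => pi2 t.-1) (f x)).-1))) => //.
apply: computable_and; first by apply/computable_neg/computable_eqn => //; computability.
by apply: (computable_comp2 (f := P)) => //; computability.
Qed.

(** * The jump computes a compact presentation *)

Section JumpPresentation.
Variable R : realType.
Local Open Scope ring_scope.

Lemma computable_metric_approx (D : set nat) (d : omega_metric R) :
    computable_metric D d ->
  exists2 q, computable D q & forall i j n,
    `|ratr (rat_decode (q (npair i (npair j n)))) - d i j| <= (2 ^+ n)^-1.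
Proof.
move=> [c hc].
have /choice[q hq] : forall x, exists y, prog_eval D c x y /\
    forall i j n, x = npair i (npair j n) ->
      `|ratr (rat_decode y) - d i j| <= (2 ^+ n)^-1.
  move=> x; have [y h1 h2] := hc (pi1 x) (pi1 (pi2 x)) (pi2 (pi2 x)).
  rewrite !npair_pi in h1; exists y; split=> // i j n e.
  by move: h2; rewrite e !(pi1K, pi2K).
exists q => [|i j n]; first by exists c => x; have [] := hq x.
by have [_] := hq (npair i (npair j n)); apply.
Qed.

Lemma computable_metric_mono (D E : set nat) (d : omega_metric R) :
  turing_le D E -> computable_metric D d -> computable_metric E d.
Proof.
move=> leDE /computable_metric_approx[q cq hq].
have [c hc] := computable_oracle_le leDE cq.
by exists c => i j n; exists (q (npair i (npair j n))).
Qed.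

(** With a margin, covering reads [exists l, forall i, Q n l i] with [Q] decidable in [D]: the inner
    quantifier is one question to the jump, the outer one an enumeration. The slack 2 in [Q] exceeds
    the approximation error 1, and both fit into the margin 4. *)
Lemma cover_codes_ce_jump (D : set nat) (d : omega_metric R) :
    compact [set: completion d] -> computable_metric D d ->
  ce_in (turing_jump D) (cover_codes d).
Proof.
move=> cd /computable_metric_approx[q cq hq].
pose Q n l i := code_has (fun h =>
  rat_add_lt (q (npair i (npair (pi1 h) l))) 2 l (pi2 h)) n.
have QP n l i : reflect (exists j r, (j, rat_decode r) \in cover_decode n /\
    ratr (rat_decode (q (npair i (npair j l)))) + 2 / 2 ^+ l < ratr (rat_decode r) :> R)
    (Q n l i).
  apply: (iffP (code_hasP _ _)).
    move=> [h hin]; rewrite (rat_add_ltP R) => hlt; exists (pi1 h), (pi2 h).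
    by split=> //; apply/mapP; exists h.
  move=> [j [r [/mapP[h hin [ej er]] hlt]]]; exists h => //.
  by rewrite (rat_add_ltP R) -[pi1 h]ej -[rat_decode (pi2 h)]er.
have cQ : computable D (fun z => Q (pi1 (pi1 z)) (pi2 (pi1 z)) (pi2 z)).
  rewrite /Q; apply: (@computable_code_has D (fun z h =>
    rat_add_lt (q (npair (pi2 z) (npair (pi1 h) (pi2 (pi1 z))))) 2 (pi2 (pi1 z)) (pi2 h))
    (fun z => pi1 (pi1 z))); last by computability.
  by apply: computable_rat_add_lt; [apply: (computable_comp cq)|..]; computability.
have := @computable_jump D (fun x i => ~~ Q (pi1 x) (pi2 x) i)
  ltac:(by apply: computable_neg; exact: cQ).
move=> /computable_neg cJ.
have := @ce_in_exists (turing_jump D) (fun n l => ~~ `[< exists i, ~~ Q n l i >]) cJ.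
suff -> : [set n | exists l, ~~ `[< exists i, ~~ Q n l i >]] = cover_codes d by [].
apply/seteqP; split=> n /=.
  move=> [l /asboolPn h]; apply: (@cover_codes_of_margin _ _ _ (2 ^+ l)^-1).
    exact: exp2V_gt0.
  move=> i; have /QP[j [r [h1 h2]]] : Q n l i by apply/negPn/negP => nQ; apply: h; exists i.
  exists j, (rat_decode r); split=> //.
  by have := hq i j l; rewrite ler_norml; lra.
move=> /(cover_codes_margin cd)[l hl]; exists l; apply/asboolPn => -[i] /negP; apply.
have [j [r [h1 h2]]] := hl i; have /mapP[h hin [ej er]] := h1.
apply/QP; exists j, (nunpair h).2; rewrite -er; split=> //.
by have := hq i j l; rewrite ler_norml; have := exp2V_gt0 R l; lra.
Qed.

Lemma compact_presentation_of_polish (X : topologicalType) (P : polish_presentation R X) :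
  compact [set: X] -> exists Q : compact_presentation R X, cp_polish Q = P.
Proof.
move=> cX; have cd := homeomorphic_compact (pp_homeo P) cX.
have [n0 hn0] := cover_codes_exists cd.
pose en n := if n \in cover_codes P then n else n0.
have enE : range en = cover_codes P.
  apply/seteqP; split=> [_ [n _ <-]|n hn].
    by rewrite /en; case: ifP => // /set_mem.
  by exists n => //; rewrite /en mem_set.
by exists (CompactPresentation enE).
Qed.

Lemma computable_compact_jump (X : topologicalType) (D : set nat)
    (P : polish_presentation R X) : compact [set: X] -> computable_polish D P ->
  exists Q : compact_presentation R X, computable_compact (turing_jump D) Q.
Proof.
move=> cX cP; have cd := homeomorphic_compact (pp_homeo P) cX.
have [Q QP] := compact_presentation_of_polish P cX; exists Q.
split; rewrite QP; last exact: cover_codes_ce_jump.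
exact: computable_metric_mono (turing_le_jump D) cP.
Qed.

End JumpPresentation.

(** * Forcing conditions *)

(* A state is a forcing condition: a finite binary string [st_bit], of length
   [st_len], deciding an initial segment of the oracle under construction; a
   finite metric [st_N / 2 ^ st_k] on [st_n] points, attached to the points
   [st_f] of the given space, which form a net of mesh [2 ^ - st_l]; the map
   [st_g] to the points of the previous state; a fuel [st_T] certifying the
   enumerable conditions; and an initial segment [st_e] of the set to be coded. *)
Definition st_len x := sget x 0.
Definition st_bits x := sget x 1.
Definition st_bit x k : bool := sget (st_bits x) k != 0.
Definition st_n x := sget x 2.
Definition st_k x := sget x 3.
Definition st_l x := sget x 4.
Definition st_f x i := sget (sget x 5) i.
Definition st_N x i j := sget (sget (sget x 6) i) j.
Definition st_g x i := sget (sget x 7) i.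
Definition st_T x := sget x 8.
Definition st_e x c : bool := sget (sget x 9) c != 0.

Definition mkstate (L : nat) (w : nat -> bool) (n k l : nat) (f : nat -> nat)
    (N : nat -> nat -> nat) (g : nat -> nat) (T m : nat) (e : nat -> bool) : nat :=
  npair L (npair (mkstream w L) (npair n (npair k (npair l (npair (mkstream f n)
    (npair (mkstream (fun i => mkstream (N i) n) n) (npair (mkstream g n)
    (npair T (npair (mkstream e m) 0))))))))).

Section Mkstate.
Variables (L : nat) (w : nat -> bool) (n k l : nat) (f : nat -> nat).
Variables (N : nat -> nat -> nat) (g : nat -> nat) (T m : nat) (e : nat -> bool).
Let x := mkstate L w n k l f N g T m e.

Lemma st_lenE : st_len x = L. Proof. exact: sget_npair0. Qed.
Lemma st_nE : st_n x = n.
Proof. by rewrite /st_n /x /mkstate !(sget_npairS, sget_npair0). Qed.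
Lemma st_kE : st_k x = k.
Proof. by rewrite /st_k /x /mkstate !(sget_npairS, sget_npair0). Qed.
Lemma st_lE : st_l x = l.
Proof. by rewrite /st_l /x /mkstate !(sget_npairS, sget_npair0). Qed.
Lemma st_TE : st_T x = T.
Proof. by rewrite /st_T /x /mkstate !(sget_npairS, sget_npair0). Qed.
Lemma st_bitE i : i < L -> st_bit x i = w i.
Proof.
move=> hi; rewrite /st_bit /st_bits /x /mkstate !(sget_npairS, sget_npair0).
by rewrite sget_mkstream //; case: (w i).
Qed.
Lemma st_fE i : i < n -> st_f x i = f i.
Proof.
by move=> hi; rewrite /st_f /x /mkstate !(sget_npairS, sget_npair0) sget_mkstream.
Qed.
Lemma st_gE i : i < n -> st_g x i = g i.
Proof.
by move=> hi; rewrite /st_g /x /mkstate !(sget_npairS, sget_npair0) sget_mkstream.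
Qed.
Lemma st_NE i j : i < n -> j < n -> st_N x i j = N i j.
Proof.
move=> hi hj; rewrite /st_N /x /mkstate !(sget_npairS, sget_npair0).
by rewrite !sget_mkstream.
Qed.
Lemma st_eE c : c < m -> st_e x c = e c.
Proof.
move=> hc; rewrite /st_e /x /mkstate !(sget_npairS, sget_npair0).
by rewrite sget_mkstream //; case: (e c).
Qed.
End Mkstate.

(* Positions of the oracle in column [0] are metric assertions: the position
   [npair 0 (i, j, p, a, t)] states that the distance of [i] and [j] is within
   [2 / 2 ^ p] of [a / 2 ^ p], with [t] a padding. The column [c.+1] is
   eventually constant, with limit the value of the coded set at [c]. *)
Definition pos_i k := pi1 (pi2 k).
Definition pos_j k := pi1 (pi2 (pi2 k)).
Definition pos_p k := pi1 (pi2 (pi2 (pi2 k))).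
Definition pos_a k := pi1 (pi2 (pi2 (pi2 (pi2 k)))).

(** Columns [1] to [s] are locked: new bits there copy the part of the coded set recorded in
    [st_e x]. Higher columns are still free, and column [0] is left to [bits_ok]. *)
Definition ext_string (s x y : nat) : bool :=
  (st_len x <= st_len y) && ball_lt (st_len y) (fun k =>
    if k < st_len x then st_bit y k == st_bit x k
    else (0 < pi1 k) && (pi1 k <= s) ==> (st_bit y k == st_e x (pi1 k).-1)).

Definition is_fin_metric (y : nat) : bool :=
  ball_lt (st_n y) (fun i => ball_lt (st_n y) (fun j =>
    [&& st_N y i i == 0, (i != j) ==> (0 < st_N y i j), st_N y i j == st_N y j i &
        ball_lt (st_n y) (fun k => st_N y i k <= st_N y i j + st_N y j k)])).

Definition linked (a x y : nat) : bool :=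
  [&& st_n x <= st_n y, st_k x <= st_k y & ball_lt (st_n y) (fun i =>
    [&& st_g y i < st_n x, (i < st_n x) ==> (st_g y i == i) &
        ball_lt (st_n y) (fun j =>
          (st_N y i j <= (st_N x (st_g y i) (st_g y j) + a) * 2 ^ (st_k y - st_k x)) &&
          (st_N x (st_g y i) (st_g y j) * 2 ^ (st_k y - st_k x) <=
           st_N y i j + a * 2 ^ (st_k y - st_k x)))])].

(** [b] is a safety margin in units of [2 ^- st_k y]. States use 200, above the total later drift of
    160, so that assertions survive in the limit. Witnesses use 0, since their realization can pick
    a unit small against the slack of their strict inequalities. *)
Definition bits_ok (b y : nat) : bool :=
  ball_lt (st_len y) (fun k => st_bit y k && (pi1 k == 0) ==>
    [&& pos_i k < st_n y, pos_j k < st_n y,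
        pos_a k * 2 ^ st_k y + b * 2 ^ pos_p k <
        st_N y (pos_i k) (pos_j k) * 2 ^ pos_p k + 2 * 2 ^ st_k y &
        st_N y (pos_i k) (pos_j k) * 2 ^ pos_p k + b * 2 ^ pos_p k <
        pos_a k * 2 ^ st_k y + 2 * 2 ^ st_k y]).

Definition st_halts (s y : nat) : bool := universal (st_bits y) (st_len y) s s != 0.

(** The coded set enters only through the finite record [st_e x], and the space only through the
    integers in [x]. Existence of a witness is therefore an unrelativized enumerable question, which
    the jump of the empty set answers. *)
Definition forces_witness (s x y : nat) : bool :=
  [&& ext_string s x y, is_fin_metric y, linked 32 x y, bits_ok 0 y & st_halts s y].

Definition forces (s x : nat) : bool := `[< exists y, forces_witness s x y >].

Definition cover_code (y : nat) : nat :=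
  nrec 0 (fun i r => (npair (npair (st_f y i) (dyadic 1 (st_l y))) r).+1) (st_n y).

(* In units of [2 ^ - st_k x], a refinement alone moves the distances by at most
   7 and the realization of a witness by at most [32 + 7]. As the unit shrinks by
   a factor 16 at each step, all later distances stay within 160 of the present
   ones, and within [16 + 160 / 16 <= 32] if the state does not force: then each
   later state obeys the bound imposed on witnesses. *)
Section Step.
Variables (rlt rgt rcov : nat -> bool) (E : set nat).

Definition dlt T i j l := bex_lt T (fun t => rlt (npair (npair i (npair j l)) t)).
Definition dgt T i j l := bex_lt T (fun t => rgt (npair (npair i (npair j l)) t)).
Definition covT T y := bex_lt T (fun t => rcov (npair (cover_code y) t)).

(** The clause with [dgt] makes the limit distance small where [d] is small, and the clause with 200
    does the converse. The clause on positions guarantees that every distance is eventually asserted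
    at every precision; the last one records more of the coded set. *)
Definition refines (s x y : nat) : bool :=
  [&& st_k x + 4 <= st_k y, st_l x < st_l y, s <= st_n y, s <= st_len y &
  [&& ball_lt (st_n x) (fun i => st_f y i == st_f x i),
      ball_lt (st_n y) (fun i => ball_lt (st_n y) (fun j =>
        (st_f y i == st_f y j) ==> (i == j))),
      ball_lt (st_n y) (fun i => dlt (st_T y) (st_f y i) (st_f x (st_g y i)) (st_l x)),
      covT (st_T y) y &
  [&& ball_lt (st_n y) (fun i => ball_lt (st_n y) (fun j =>
        (st_N y i j <= 2) || dgt (st_T y) (st_f y i) (st_f y j) (st_l y))),
      ball_lt (st_n y) (fun i => ball_lt (st_n y) (fun j =>
        dlt (st_T y) (st_f y i) (st_f y j) s || (200 < st_N y i j))),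
      ball_lt s (fun i => ball_lt s (fun j => ball_lt s (fun p =>
        bex_lt (st_len y) (fun v =>
          (npair 0 (npair i (npair j (npair p v))) < st_len y) &&
          st_bit y (npair 0 (npair i (npair j (npair p v)))))))) &
      ball_lt s.+1 (fun c => st_e y c == (c \in E))]]].

Definition step (s x y : nat) : bool :=
  [&& ext_string s x y, is_fin_metric y,
      (if forces s x then linked 80 x y && st_halts s y else linked 16 x y),
      bits_ok 200 y & refines s x y].
End Step.

Ltac state_computability :=
  rewrite /ext_string /is_fin_metric /linked /bits_ok /st_halts /cover_code /dyadic
    /st_bit /st_e /st_len /st_bits /st_n /st_k /st_l /st_f /st_N /st_g /st_T
    /pos_i /pos_j /pos_p /pos_a; computability.

Lemma computable_forces A f g : turing_le (turing_jump set0) A ->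
    computable A f -> computable A g -> computable A (fun x => forces (f x) (g x)).
Proof.
move=> leA hf hg.
have := @computable_jump set0 (fun z y => forces_witness (pi1 z) (pi2 z) y).
move=> H; have {}H : computable A (fun z => forces (pi1 z) (pi2 z)).
  apply: (computable_oracle_le leA); apply: H.
  rewrite /forces_witness; state_computability.
  by apply: computable_universal; computability.
exact: (computable_comp2 (f := fun a b => forces a b) H hf hg).
Qed.

Lemma computable_step A E (rlt rgt rcov : nat -> bool) :
    turing_le E A -> turing_le (turing_jump set0) A ->
    computable E rlt -> computable E rgt -> computable E rcov ->
  computable A (fun z => step rlt rgt rcov E (pi1 (pi1 z)) (pi2 (pi1 z)) (pi2 z)).
Proof.
move=> leE leJ /(computable_oracle_le leE) clt /(computable_oracle_le leE) cgt.
move=> /(computable_oracle_le leE) ccov.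
have cE f : computable A f -> computable A (fun x => f x \in E).
  by move=> hf; apply: (computable_comp leE hf).
rewrite /step /refines /dlt /dgt /covT.
apply: computable_and; first by state_computability.
apply: computable_and; first by state_computability.
apply: computable_and.
  apply: computable_ifb; first by apply: computable_forces => //; computability.
    apply: computable_and; first by state_computability.
    by rewrite /st_halts /st_bits /st_len; computability; apply: computable_universal;
      computability.
  by state_computability.
apply: computable_and; first by state_computability.
by state_computability; first [apply: (computable_comp clt)
  | apply: (computable_comp cgt) | apply: (computable_comp ccov) | apply: cE];
  computability.
Qed.

(** * Every condition has a next one *)

Lemma is_fin_metricP y : reflect (nat_metric (st_n y) (st_N y)) (is_fin_metric y).
Proof.
apply: (iffP (ball_ltP _ _)) => [h|[h1 h2 h3 h4] i hi].
  have {}h i j : i < st_n y -> j < st_n y -> [/\ st_N y i i = 0,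
      i != j -> 0 < st_N y i j, st_N y i j = st_N y j i &
      forall k, k < st_n y -> st_N y i k <= st_N y i j + st_N y j k].
    move=> hi hj; have /ball_ltP/(_ j hj)/and4P[/eqP ? /implyP ? /eqP ? /ball_ltP ?] := h i hi.
    by split.
  split=> [i hi|i j hi hj|i j hi hj|i j k hi hj hk].
  - by have [] := h i i hi hi.
  - by have [] := h i j hi hj.
  - by have [] := h i j hi hj.
  - by have [_ _ _ ->] := h i j hi hj.
apply/ball_ltP => j hj; apply/and4P; split.
- by rewrite h1.
- by apply/implyP; exact: h2.
- by rewrite h3.
- by apply/ball_ltP => k hk; exact: h4.
Qed.

Section Conditions.
Variable R : realType.
Local Open Scope ring_scope.

Definition st_M x i j : R := (st_N x i j)%:R / 2 ^+ st_k x.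

Lemma leq_scale2 (a b k l : nat) : (k <= l)%N ->
  (a <= b * 2 ^ (l - k))%N = (a%:R / 2 ^+ l <= b%:R / 2 ^+ k :> R).
Proof.
move=> le_kl; rewrite -(ler_nat R) natrM natrX ler_pdivrMr ?exprn_gt0 // mulrAC -mulrA.
by rewrite -expfB_cond ?le_kl // pnatr_eq0.
Qed.

Lemma geq_scale2 (a b k l : nat) : (k <= l)%N ->
  (b * 2 ^ (l - k) <= a)%N = (b%:R / 2 ^+ k <= a%:R / 2 ^+ l :> R).
Proof.
move=> le_kl; rewrite -(ler_nat R) natrM natrX ler_pdivlMr ?exprn_gt0 // mulrAC -mulrA.
by rewrite -expfB_cond ?le_kl // pnatr_eq0.
Qed.

Lemma linkedP a x y : linked a x y <->
  [/\ (st_n x <= st_n y)%N, (st_k x <= st_k y)%N,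
      forall i, (i < st_n y)%N -> (st_g y i < st_n x)%N,
      forall i, (i < st_n x)%N -> st_g y i = i &
      forall i j, (i < st_n y)%N -> (j < st_n y)%N ->
        `|st_M y i j - st_M x (st_g y i) (st_g y j)| <= a%:R / 2 ^+ st_k x].
Proof.
have e (N1 N2 : nat) : (st_k x <= st_k y)%N ->
    (N1 <= (N2 + a) * 2 ^ (st_k y - st_k x))%N &&
    (N2 * 2 ^ (st_k y - st_k x) <= N1 + a * 2 ^ (st_k y - st_k x))%N =
    (`|N1%:R / 2 ^+ st_k y - N2%:R / 2 ^+ st_k x| <= a%:R / 2 ^+ st_k x :> R).
  move=> le_k; rewrite leq_scale2 // geq_scale2 // !natrD natrM natrX.
  have -> : 2 ^+ (st_k y - st_k x) = 2 ^+ st_k y / 2 ^+ st_k x :> R.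
    by rewrite expfB_cond ?le_k // pnatr_eq0.
  have kx : 0 < 2 ^+ st_k x :> R by rewrite exprn_gt0.
  have ky : 0 < 2 ^+ st_k y :> R by rewrite exprn_gt0.
  move: (2 ^+ st_k x) (2 ^+ st_k y) kx ky => u v u_gt0 v_gt0.
  have -> : (N1%:R + a%:R * (v / u)) / v = N1%:R / v + a%:R / u.
    by field; rewrite !gt_eqF.
  by rewrite mulrDl ler_norml; apply/idP/idP; lra.
split=> [/and3P[h1 h2 /ball_ltP h]|[h1 h2 h3 h4 h5]].
  split=> // [i hi|i hi|i j hi hj].
  - by have /and3P[] := h i hi.
  - by have /and3P[_ /implyP/(_ hi)/eqP] := h i (leq_trans hi h1).
  - by have /and3P[_ _ /ball_ltP/(_ j hj)] := h i hi; rewrite e.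
apply/and3P; split=> //; apply/ball_ltP => i hi; apply/and3P; split.
- exact: h3.
- by apply/implyP => hi'; rewrite h4.
- by apply/ball_ltP => j hj; rewrite e //; exact: h5.
Qed.

Definition asserts (k : nat) (b del : R) : Prop :=
  `|(pos_a k)%:R / 2 ^+ pos_p k - del| + b < 2 / 2 ^+ pos_p k.

Lemma bits_okP b y : bits_ok b y <->
  forall k, (k < st_len y)%N -> st_bit y k -> pi1 k = 0%N ->
    [/\ (pos_i k < st_n y)%N, (pos_j k < st_n y)%N &
        asserts k (b%:R / 2 ^+ st_k y) (st_M y (pos_i k) (pos_j k))].
Proof.
have e (a N p k : nat) :
    (a * 2 ^ k + b * 2 ^ p < N * 2 ^ p + 2 * 2 ^ k)%N &&
    (N * 2 ^ p + b * 2 ^ p < a * 2 ^ k + 2 * 2 ^ k)%N =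
    (`|a%:R / 2 ^+ p - N%:R / 2 ^+ k| + b%:R / 2 ^+ k < 2 / 2 ^+ p :> R).
  rewrite -!(ltr_nat R) !natrD !natrM !natrX.
  have kp : 0 < 2 ^+ k :> R by rewrite exprn_gt0.
  have pp : 0 < 2 ^+ p :> R by rewrite exprn_gt0.
  move: (2 ^+ k) (2 ^+ p) kp pp => u v u_gt0 v_gt0.
  have uv := mulr_gt0 u_gt0 v_gt0.
  have -> : (`|a%:R / v - N%:R / u| + b%:R / u < 2 / v) =
      (`|a%:R * u - N%:R * v| + b%:R * v < 2 * u).
    have -> : a%:R * u - N%:R * v = (a%:R / v - N%:R / u) * (u * v).
      by field; rewrite !gt_eqF.
    rewrite normrM (gtr0_norm uv) -[in LHS](ltr_pM2r uv) mulrDl.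
    by congr (_ + _ < _); field; rewrite gt_eqF.
  by rewrite -[in RHS]ltrBrDr ltr_norml; apply/idP/idP; lra.
split=> [/ball_ltP h k hk hb hc|h].
  by have := h k hk; rewrite hb hc eqxx /= => /and3P[-> ->]; rewrite e.
apply/ball_ltP => k hk; apply/implyP => /andP[hb /eqP hc].
by have [h1 h2 h3] := h k hk hb hc; apply/and3P; split=> //; rewrite e.
Qed.

Lemma cover_code_decode y j q : (j, q) \in cover_decode (cover_code y) <->
  (exists2 i, (i < st_n y)%N & j = st_f y i) /\ q = rat_decode (dyadic 1 (st_l y)).
Proof.
rewrite /cover_code; elim: (st_n y) => [|n IHn]; first by split=> // -[[]].
have -> : cover_decode (nrec 0 (fun i r => (npair (npair (st_f y i)
      (dyadic 1 (st_l y))) r).+1) n.+1) = (st_f y n, rat_decode (dyadic 1 (st_l y))) ::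
    cover_decode (nrec 0 (fun i r => (npair (npair (st_f y i) (dyadic 1 (st_l y))) r).+1) n).
  set h := fun i r : nat => _; rewrite /cover_decode.
  by rewrite [nrec 0 h n.+1](_ : _ = h n (nrec 0 h n)) // decodeS pi1K pi2K /= npairK.
rewrite inE; split=> [/orP[/eqP[-> ->]|/IHn[[i hi ->] ->]]|[[i hi ej] eq]].
- by split=> //; exists n.
- by split=> //; exists i => //; exact: ltnW.
- apply/orP; move: hi; rewrite ltnS leq_eqVlt => /orP[/eqP ein|hi]; [left|right].
    by rewrite ej eq ein.
  by apply/IHn; split=> //; exists i.
Qed.

Lemma exists_pos_lower_bound n (F : nat -> R) : (forall i, (i < n)%N -> 0 < F i) ->
  exists2 e : R, 0 < e & forall i, (i < n)%N -> e <= F i.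
Proof.
have [->|n_gt0] := posnP n; first by exists 1.
by move=> h; have [i hi hmin] := exists_min_lt F n_gt0; exists (F i) => //; exact: h.
Qed.

Variables (d : omega_metric R) (rlt rgt rcov : nat -> bool) (E : set nat).
Hypothesis rltP : forall i j l,
  d i j < (2 ^+ l)^-1 <-> exists t, rlt (npair (npair i (npair j l)) t).
Hypothesis rgtP : forall i j l,
  10 / 2 ^+ l < d i j <-> exists t, rgt (npair (npair i (npair j l)) t).
Hypothesis rcovP : forall n, cover_codes d n <-> exists t, rcov (npair n t).

Lemma dlt_sound T i j l : dlt rlt T i j l -> d i j < (2 ^+ l)^-1.
Proof. by move=> /bex_ltP[t _ ht]; apply/rltP; exists t. Qed.

Lemma dlt_complete i j l : d i j < (2 ^+ l)^-1 -> eventually_nat (fun T => dlt rlt T i j l).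
Proof.
by move=> /rltP[t ht]; exists t.+1 => T hT; apply/bex_ltP; exists t.
Qed.

Lemma dgt_sound T i j l : dgt rgt T i j l -> 10 / 2 ^+ l < d i j.
Proof. by move=> /bex_ltP[t _ ht]; apply/rgtP; exists t. Qed.

Lemma dgt_complete i j l : 10 / 2 ^+ l < d i j -> eventually_nat (fun T => dgt rgt T i j l).
Proof.
by move=> /rgtP[t ht]; exists t.+1 => T hT; apply/bex_ltP; exists t.
Qed.

Lemma covT_sound T y : covT rcov T y ->
  forall x, exists2 i, (i < st_n y)%N & d x (st_f y i) < (2 ^+ st_l y)^-1.
Proof.
move=> /bex_ltP[t _ ht] x.
have /rcovP : exists t, rcov (npair (cover_code y) t) by exists t.
move=> /(_ (completion_point d x))[i [r [/cover_code_decode[[j hj ->] ->]]]].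
by rewrite mdist_completion_point ratr_dyadic mul1r => h; exists j.
Qed.

(** The invariant under which the search for the next state ends. It speaks of true distances, so it
    is kept apart from the decidable [step]. At stage [s] the record of [E] must be right below [s],
    which is what the locked columns copy. *)
Definition good_state (s x : nat) : Prop :=
  [/\ [/\ (0 < st_n x)%N, nat_metric (st_n x) (st_N x) & bits_ok 200 x],
      forall i j, (i < st_n x)%N -> (j < st_n x)%N -> st_f x i = st_f x j -> i = j,
      forall z, exists2 i, (i < st_n x)%N & d z (st_f x i) < (2 ^+ st_l x)^-1,
      forall i j, (i < st_n x)%N -> (j < st_n x)%N ->
        (st_N x i j <= 2)%N \/ 10 / 2 ^+ st_l x < d (st_f x i) (st_f x j) &
      forall c, (c < s)%N -> st_e x c = (c \in E)].

Lemma step_good s x y : good_state s x -> step rlt rgt rcov E s x y -> good_state s.+1 y.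
Proof.
move=> [[n_gt0 _ _] _ _ _ _] /and5P[_ /is_fin_metricP ym hl ybits].
move=> /and5P[_ _ _ _ /and5P[_ finj _ hcov /and4P[hclose _ _ he]]].
split.
- split=> //; apply: leq_trans n_gt0 _.
  by move: hl; case: ifP => _; [move=> /andP[/linkedP[] //]|move=> /linkedP[]].
- move=> i j hi hj e.
  have /ball_ltP/(_ j hj)/implyP/(_ (introT eqP e))/eqP := ball_ltP _ _ finj i hi.
  exact.
- exact: covT_sound hcov.
- move=> i j hi hj; have /ball_ltP/(_ j hj)/orP[|/dgt_sound] := ball_ltP _ _ hclose i hi.
    by left.
  by right.
- by move=> c hc; have /eqP := ball_ltP _ _ he c hc.
Qed.

End Conditions.

Lemma eq_nat_metric n N N' : (forall i j, i < n -> j < n -> N i j = N' i j) ->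
  nat_metric n N -> nat_metric n N'.
Proof.
move=> e [h1 h2 h3 h4]; split=> [i hi|i j hi hj|i j hi hj|i j k hi hj hk];
  rewrite -!e //; by [exact: h1|exact: h2|exact: h3|exact: h4].
Qed.

(** The fuel is chosen last, large enough to certify the cover, so the code of the cover must not
    depend on it. *)
Lemma cover_code_fuel L w n k l f N g T m e :
  cover_code (mkstate L w n k l f N g T m e) = cover_code (mkstate L w n k l f N g 0 m e).
Proof.
by rewrite /cover_code /st_f /st_l /st_n /mkstate !(sget_npairS, sget_npair0).
Qed.

Section StepExists.
Variable R : realType.
Local Open Scope ring_scope.
Variables (d : omega_metric R) (rlt rgt rcov : nat -> bool) (E : set nat).
Hypothesis rltP : forall i j l,
  d i j < (2 ^+ l)^-1 <-> exists t, rlt (npair (npair i (npair j l)) t).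
Hypothesis rgtP : forall i j l,
  10 / 2 ^+ l < d i j <-> exists t, rgt (npair (npair i (npair j l)) t).
Hypothesis rcovP : forall n, cover_codes d n <-> exists t, rcov (npair n t).
Hypothesis dtb : totally_bounded d.
Hypothesis dperf : no_isolated_point d.

(** Of the 202 units, 200 are the margin, one pays for moving from [del] to [del'], and one makes
    the inequality strict. *)
Lemma asserts_close k (r del del' : R) : 0 < r -> `|del' - del| <= r ->
    202 * r <= 2 / 2 ^+ pos_p k - `|(pos_a k)%:R / 2 ^+ pos_p k - del| ->
  asserts k (200 * r) del'.
Proof.
move=> r_gt0; rewrite /asserts distrC.
have := ler_distD del ((pos_a k)%:R / 2 ^+ pos_p k) del'.
move: (pos_a k)%:R (2 ^+ pos_p k) => a p.
move: `|a / p - del'| `|a / p - del| `|del - del'| (2 / p) => *; lra.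
Qed.

(** Both answers are brought to one form: the target is the witness with [A = 32], or else the state
    itself with [A = 0]. Adding the 7 of a refinement gives 39 and 7, within 80 and 16. *)
Lemma forcing_target s x : good_state d E s x ->
  exists (L0 m kp A : nat) (w0 : nat -> bool) (g : nat -> nat) (Np : nat -> nat -> nat),
  [/\ [/\ (A + 7 <= (if forces s x then 80 else 16))%N, (st_len x <= L0)%N,
          forall k, (k < st_len x)%N -> w0 k = st_bit x k &
          forall k, (st_len x <= k < L0)%N -> (0 < pi1 k <= s)%N ->
            w0 k = st_e x (pi1 k).-1],
      [/\ (st_n x <= m)%N, forall i, (i < st_n x)%N -> g i = i &
          forall i, (i < m)%N -> (g i < st_n x)%N],
      [/\ nat_metric m Np & forall i j, (i < m)%N -> (j < m)%N ->
          `|(Np i j)%:R / 2 ^+ kp - st_M R x (g i) (g j)| <= A%:R / 2 ^+ st_k x],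
      forall k, (k < L0)%N -> w0 k -> pi1 k = 0%N -> [/\ (pos_i k < m)%N, (pos_j k < m)%N &
        asserts k 0 ((Np (pos_i k) (pos_j k))%:R / 2 ^+ kp : R)] &
      forces s x -> forall D : set nat, (forall k, (k < L0)%N -> (k \in D) = w0 k) ->
        exists v, prog_eval D (prog_of s) s v].
Proof.
move=> [[n_gt0 xm xbits] _ _ _ _]; case: ifP => [/asboolP[y]|_]; last first.
  exists (st_len x), (st_n x), (st_k x), 0%N, (st_bit x), id, (st_N x); split=> //.
  - by split=> // k /andP[h1]; rewrite ltnNge h1.
  - by split=> // i j _ _; rewrite subrr normr0 mul0r.
  move=> k hk hb hc; have [h1 h2 h3] := (bits_okP R _ _).1 xbits k hk hb hc.
  split=> //; move: h3; rewrite /asserts addr0; apply: le_lt_trans.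
  by rewrite lerDl divr_ge0 ?exprn_ge0 ?ler0n.
move=> /and5P[/andP[hlen /ball_ltP hext] /is_fin_metricP ym /(linkedP R)[hn hk hg hgid hlink]].
move=> /(bits_okP R) ybits yhalts.
exists (st_len y), (st_n y), (st_k y), 32%N, (st_bit y), (st_g y), (st_N y); split=> //.
- split=> // k.
    by move=> hkx; have := hext k (leq_trans hkx hlen); rewrite hkx => /eqP.
  move=> /andP[h1 h2] hp; have := hext k h2.
  by rewrite ltnNge h1 /= hp => /eqP.
- by move=> k hk' hb hc; have := ybits k hk' hb hc; rewrite mul0r.
- move=> _ D hD; move: yhalts; rewrite /st_halts -{1}(prog_ofK s) universalE.
  case e: fev => [|v] // _; exists v; apply: fev_sound e => k hk'.
  by rewrite hD.
Qed.

Lemma step_exists s x : good_state d E s x -> exists y, step rlt rgt rcov E s x y.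
Proof.
move=> gx; have [[n_gt0 xm xbits] finj net close he] := gx.
have [L0 [m [kp [A [w0 [g [Np [[hA le_L0 w0_x w0_lock] [le_nm g_id g_lt] [Npm gN] w0_bits
  w0_halt]]]]]]]] := forcing_target gx.
pose mar k : R := 2 / 2 ^+ pos_p k -
  `|(pos_a k)%:R / 2 ^+ pos_p k - (Np (pos_i k) (pos_j k))%:R / 2 ^+ kp|.
(* The next unit must be at most a 202nd of the slack of each assertion already made, as
   [asserts_close] demands; [1] is a default for the other positions. *)
have [|e1 e1_gt0 he1] := @exists_pos_lower_bound R L0
    (fun k => if w0 k && (pi1 k == 0%N) then mar k / 202 else 1).
  move=> k hk; case: ifP => [/andP[hw /eqP hc]|_]; last exact: ltr01.
  have [_ _] := w0_bits k hk hw hc; rewrite /asserts addr0 /mar.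
  by move: `|_| (2 / _) => a b; lra.
(* New assertions have precision [p < s] and an error below [1 / 2 ^ p] from the floor. With this
   bound the margin of 200 units is at most half of [2 ^- s], so the sum stays below [2 / 2 ^ p]. *)
have r0_gt0 : 0 < Num.min e1 ((2 ^+ s)^-1 / 400) :> R.
  by rewrite lt_min e1_gt0 /=; have := exp2V_gt0 R s; lra.
have A_ge0 : 0 <= A%:R / 2 ^+ st_k x :> R by rewrite divr_ge0 // exprn_ge0.
have [n' [k' [l' [f' [g' [N' [[le_mn le_sn le_k lt_l r'_le] [N'm f'_f f'_inj g'_id g'_lt]
  [f'_near N'_link N'_Np] [net' close' sep']]]]]]]] :=
  refine_approximation (odistP d) dtb dperf s n_gt0 xm finj net close le_nm g_id g_lt Npm
    A_ge0 gN r0_gt0.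
have r'_gt0 := exp2V_gt0 R k'.
move: r'_le; rewrite le_min => /andP[r'_e1 r'_s].
(* An infinite prolongation of the target string: past [L0], column [0] asserts the floors of the
   new distances among the first [s] points, locked columns copy the record, and the rest is false.
   The new string is a long enough prefix of it. *)
pose W k := if (k < L0)%N then w0 k else if pi1 k == 0%N then
  [&& (pos_i k < s)%N, (pos_j k < s)%N, (pos_p k < s)%N &
      pos_a k == ((N' (pos_i k) (pos_j k) * 2 ^ pos_p k) %/ 2 ^ k')%N]
  else if (pi1 k <= s)%N then st_e x (pi1 k).-1 else false.
pose D := [set k | W k].
have inD k : (k \in D) = W k by apply/idP/idP; rewrite in_setE.
have evH : eventually_nat (fun B => forces s x ->
    forall w, agree D w B -> universal w B s s != 0%N).
  case: (boolP (forces s x)) => [/w0_halt hD|_]; last by exists 0%N.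
  have [|v /fev_complete[B hB]] := hD D; first by move=> k hk; rewrite inD /W hk.
  exists B => B' /hB {}hB _ w Dw; rewrite -{1}(prog_ofK s) universalE hB //.
(* With [L0] as padding the position is at least [L0], where the bits are not yet fixed by the
   target. *)
pose pos i j p := npair 0 (npair i (npair j (npair p
  (npair ((N' i j * 2 ^ p) %/ 2 ^ k')%N L0)))).
have evP : eventually_nat (fun L => forall i, (i < s)%N -> forall j, (j < s)%N ->
    forall p, (p < s)%N -> (pos i j p < L)%N).
  apply: eventually_nat_forall => i _; apply: eventually_nat_forall => j _.
  by apply: eventually_nat_forall => p _; exists (pos i j p).+1.
have ev0 : eventually_nat (fun L => (L0 <= L)%N /\ (s <= L)%N).
  by apply: eventually_natI; [exists L0|exists s].
have [L /(_ _ (leqnn L))[[le_L0L le_sL] [hH hP]]] :=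
  eventually_natI ev0 (eventually_natI evH evP).
pose y T := mkstate L W n' k' l' f' N' g' T s.+1 (fun c => c \in E).
have cov : eventually_nat (fun T => covT rcov T (y T)).
  have /rcovP[t ht] : cover_codes d (cover_code (y 0%N)).
    have e2 : 0 < (2 ^+ l')^-1 / 2 :> R by rewrite divr_gt0 ?exp2V_gt0.
    apply: (cover_codes_of_margin e2) => i; have [j hj dj] := net' i.
    exists (f' j), (rat_decode (dyadic 1 l')); split.
      apply/cover_code_decode; rewrite st_nE st_lE; split=> //.
      by exists j => //; rewrite st_fE.
    by rewrite ratr_dyadic mul1r; lra.
  exists t.+1 => T lt_tT; apply/bex_ltP; exists t => //.
  by rewrite /y cover_code_fuel.
have ev1 : eventually_nat (fun T => forall i, (i < n')%N ->
    dlt rlt T (f' i) (st_f x (g' i)) (st_l x)).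
  by apply: eventually_nat_forall => i hi; apply: (dlt_complete rltP); exact: f'_near.
have ev2 : eventually_nat (fun T => forall i, (i < n')%N -> forall j, (j < n')%N ->
    (N' i j <= 2)%N || dgt rgt T (f' i) (f' j) l').
  apply: eventually_nat_forall => i hi; apply: eventually_nat_forall => j hj.
  have [->|/(dgt_complete rgtP)[T0 h]] := close' i j hi hj; first by exists 0%N.
  by exists T0 => T /h ->; rewrite orbT.
have ev3 : eventually_nat (fun T => forall i, (i < n')%N -> forall j, (j < n')%N ->
    dlt rlt T (f' i) (f' j) s || (200 < N' i j)%N).
  apply: eventually_nat_forall => i hi; apply: eventually_nat_forall => j hj.
  have [/(dlt_complete rltP)[T0 h]|->] := sep' i j hi hj; last by exists 0%N => T _; rewrite orbT.
  by exists T0 => T /h ->.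
have [T /(_ _ (leqnn T))[[hcov h1] [h2 h3]]] :=
  eventually_natI (eventually_natI cov ev1) (eventually_natI ev2 ev3).
have yn : st_n (y T) = n' by exact: st_nE.
have yk : st_k (y T) = k' by exact: st_kE.
have yl : st_l (y T) = l' by exact: st_lE.
have yL : st_len (y T) = L by exact: st_lenE.
have yT : st_T (y T) = T by exact: st_TE.
have yb k : (k < L)%N -> st_bit (y T) k = W k by exact: st_bitE.
have yf i : (i < n')%N -> st_f (y T) i = f' i by exact: st_fE.
have yg i : (i < n')%N -> st_g (y T) i = g' i by exact: st_gE.
have yN i j : (i < n')%N -> (j < n')%N -> st_N (y T) i j = N' i j by exact: st_NE.
have le_nn' : (st_n x <= n')%N := leq_trans le_nm le_mn.
have ylink a : (A + 7 <= a)%N -> linked a x (y T).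
  move=> le_a; apply/(linkedP R); rewrite yn yk; split=> //.
  - exact: leq_trans (leq_addr 4 _) le_k.
  - by move=> i hi; rewrite yg // g'_lt.
  - by move=> i hi; rewrite yg ?g'_id // (leq_trans hi).
  - move=> i j hi hj; rewrite /st_M yk !yg // yN //.
    apply: le_trans (N'_link i j hi hj) _.
    by rewrite -mulrDl ler_wpM2r ?(ltW (exp2V_gt0 R _)) // -natrD ler_nat.
exists (y T); apply/and5P; split.
- apply/andP; rewrite yL; split; first exact: leq_trans le_L0 le_L0L.
  apply/ball_ltP => k hk; rewrite yb // /W; case: ifP => hkx.
    by rewrite (leq_trans hkx le_L0) w0_x.
  apply/implyP => hp; case: ifP => hkL.
    by rewrite w0_lock // leqNgt hkx.
  by case/andP: hp; rewrite lt0n => /negPf -> ->.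
- apply/is_fin_metricP; rewrite yn; apply: eq_nat_metric N'm => i j hi hj.
  by rewrite yN.
- move: hA hH; case: ifP => _ hA hH; last exact: ylink.
  rewrite ylink //= /st_halts yL hH // => k hk.
  by rewrite inD -yb.
- apply/(bits_okP R); rewrite yL yn => k hk; rewrite yb // /W.
  case: ifP => hkL.
    move=> hw hc; have [hi hj hass] := w0_bits k hkL hw hc.
    have hi' := leq_trans hi le_mn; have hj' := leq_trans hj le_mn.
    split=> //; have := he1 k hkL; rewrite hw hc eqxx /= => hmar.
    rewrite /st_M yk yN //; apply: asserts_close (N'_Np _ _ hi hj) _ => //.
    by rewrite -/(mar k); move: (mar k) hmar r'_e1 => a; lra.
  move=> + hc; rewrite hc eqxx => /and4P[hi hj hp /eqP ea].
  have hi' := leq_trans hi le_sn; have hj' := leq_trans hj le_sn.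
  split=> //; rewrite /asserts /st_M yk yN // ea.
  set Nn := N' _ _; set p := pos_p k in hp *.
  set q := ((Nn * 2 ^ p) %/ 2 ^ k')%N.
  have pp : 0 < 2 ^+ p :> R by rewrite exprn_gt0.
  have kk : 0 < 2 ^+ k' :> R by rewrite exprn_gt0.
  have q1 : q%:R / 2 ^+ p <= Nn%:R / 2 ^+ k' :> R.
    rewrite ler_pdivrMr // mulrAC ler_pdivlMr // -!natrX -!natrM ler_nat.
    exact: leq_divM.
  have q2 : Nn%:R / 2 ^+ k' < q%:R / 2 ^+ p + 1 / 2 ^+ p :> R.
    rewrite -mulrDl natr1 ltr_pdivrMr // mulrAC ltr_pdivlMr // -!natrX -!natrM ltr_nat.
    by rewrite ltn_ceil // expn_gt0.
  have sp := exp2V_le R (ltnW hp).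
  have -> : `|q%:R / 2 ^+ p - Nn%:R / 2 ^+ k'| = Nn%:R / 2 ^+ k' - q%:R / 2 ^+ p :> R.
    by rewrite distrC ger0_norm // subr_ge0.
  by move: q1 q2 sp r'_s r'_gt0; lra.
- rewrite /refines yk yl yn yL yT.
  apply/and5P; split=> //; apply/and5P; split=> //.
  + by apply/ball_ltP => i hi; rewrite yf ?f'_f // (leq_trans hi).
  + apply/ball_ltP => i hi; apply/ball_ltP => j hj; rewrite !yf //.
    by apply/implyP => /eqP/f'_inj ->.
  + by apply/ball_ltP => i hi; rewrite yf // yg // h1.
  + apply/and4P; split.
    * by apply/ball_ltP => i hi; apply/ball_ltP => j hj; rewrite !yf // yN // h2.
    * by apply/ball_ltP => i hi; apply/ball_ltP => j hj; rewrite !yf // yN // h3.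
    * apply/ball_ltP => i hi; apply/ball_ltP => j hj; apply/ball_ltP => p hp.
      have hpos := hP i hi j hj p hp.
      apply/bex_ltP; exists (npair ((N' i j * 2 ^ p) %/ 2 ^ k')%N L0).
        apply: leq_ltn_trans hpos; rewrite /pos.
        do 4 (apply: leq_trans (leq_npairr _ _)); exact: leqnn.
      rewrite hpos /= yb // /W ltnNge.
      have -> /= : (L0 <= pos i j p)%N.
        rewrite /pos; do 5 (apply: leq_trans (leq_npairr _ _)); exact: leqnn.
      rewrite pi1K eqxx /pos_i /pos_j /pos_p /pos_a !(pi1K, pi2K) hi hj hp /=.
      by rewrite eqxx.
    * by apply/ball_ltP => c hc; rewrite st_eE.
Qed.

(** On a net of mesh 1 all distances are set to one unit: the closeness test then holds by its first
    alternative, and the empty string asserts nothing. *)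
Lemma good_state0 : exists x, good_state d E 0 x.
Proof.
have [n hn] := dtb ltr01.
have n_gt0 : (0 < n)%N by have [[|i] hi _] := hn 0%N; case: (n) hi.
pose N (i j : nat) : nat := (i != j).
pose x := mkstate 0 xpred0 n 0 0 id N id 0 0 xpred0.
have xn : st_n x = n by exact: st_nE.
exists x; rewrite /good_state xn; split=> //.
- split=> //; last by apply/(bits_okP R) => k; rewrite st_lenE.
  apply: (@eq_nat_metric _ N) => [i j hi hj|]; first by rewrite st_NE.
  split=> [i _|i j _ _|i j _ _|i j k _ _ _]; rewrite /N.
  + by rewrite eqxx.
  + by move=> ->.
  + by rewrite eq_sym.
  + by case: (eqVneq i j) => [->|_] //=; rewrite ?add0n //; case: (i != k).
- by move=> i j hi hj; rewrite !st_fE.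
- move=> z; have [i hi dz] := hn z; exists i => //.
  by rewrite st_fE // st_lE expr0 invr1.
- by move=> i j hi hj; left; rewrite st_NE // /N; case: (i != j).
Qed.

End StepExists.

(** * The generic presentation *)

Section Limit.
Variable R : realType.
Local Open Scope ring_scope.

(** The intervals of radius [b s] around [u s] meet pairwise, so the supremum of their left ends
    lies in all of them. [P] singles out the stages at which both points of an entry are present. *)
Lemma exists_limit (u b : nat -> R) (P : nat -> Prop) : (exists s, P s) ->
    (forall s t, P s -> (s <= t)%N -> `|u t - u s| <= b s) ->
    (forall s, P s -> 0 <= b s) ->
    (forall s t, P s -> (s <= t)%N -> P t) ->
  exists l, forall s, P s -> `|l - u s| <= b s.
Proof.
move=> [s0 Ps0] hu hb up; pose A := [set u s - b s | s in P].
have cross s t : P s -> P t -> u s - b s <= u t + b t.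
  move=> Ps Pt; have [le_st|/ltnW le_ts] := leqP s t.
    by have := hu s t Ps le_st; have := hb t Pt; rewrite ler_norml; lra.
  by have := hu t s Pt le_ts; have := hb s Ps; rewrite ler_norml; lra.
have A0 : A !=set0 by exists (u s0 - b s0), s0.
have ubA t : P t -> ubound A (u t + b t) by move=> Pt _ [s Ps <-]; exact: cross.
exists (sup A) => s Ps; rewrite ler_norml.
have h1 : sup A <= u s + b s by apply: ge_sup => //; exact: ubA.
have h2 : u s - b s <= sup A.
  by apply: ub_le_sup; [exists (u s + b s); exact: ubA|exists s].
lra.
Qed.

Variables (d : omega_metric R) (rlt rgt rcov : nat -> bool) (E : set nat).
Hypothesis rltP : forall i j l,
  d i j < (2 ^+ l)^-1 <-> exists t, rlt (npair (npair i (npair j l)) t).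
Hypothesis rgtP : forall i j l,
  10 / 2 ^+ l < d i j <-> exists t, rgt (npair (npair i (npair j l)) t).
Variable S : nat -> nat.
Hypothesis S_good : forall s, good_state d E s (S s).
Hypothesis S_step : forall s, step rlt rgt rcov E s (S s) (S s.+1).

Let dm := odistP d.
Let r s : R := (2 ^+ st_k (S s))^-1.
Let eps s : R := (2 ^+ st_l (S s))^-1.
Let n s := st_n (S s).
Let M s := st_M R (S s).

Let r_gt0 s : 0 < r s := exp2V_gt0 R _.
Let eps_gt0 s : 0 < eps s := exp2V_gt0 R _.

Let S_refines s : refines rlt rgt rcov E s (S s) (S s.+1).
Proof. by have /and5P[] := S_step s. Qed.

Let S_ext s : ext_string s (S s) (S s.+1).
Proof. by have /and5P[] := S_step s. Qed.

Let S_linked s : linked (if forces s (S s) then 80 else 16) (S s) (S s.+1).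
Proof. by have /and5P[_ _ + _ _] := S_step s; case: ifP => // _ /andP[]. Qed.

Let nS s : (n s <= n s.+1)%N.
Proof. by have /(linkedP R)[] := S_linked s. Qed.

Let n_mono s t : (s <= t)%N -> (n s <= n t)%N.
Proof. exact: (homo_leq (leqnn) leq_trans nS). Qed.

Let lt_n s : (s < n s.+2)%N.
Proof. by have /and5P[_ _ + _ _] := S_refines s.+1. Qed.

Let rS s : 16 * r s.+1 <= r s.
Proof.
have /and5P[+ _ _ _ _] := S_refines s => /(exp2V_le R).
rewrite exprD invfM -/(r s) -/(r s.+1) => h; move: h.
by rewrite -ler_pdivrMr ?invr_gt0 ?exprn_gt0 // invrK -natrX mulrC.
Qed.

Let epsS s : 2 * eps s.+1 <= eps s.
Proof.
have /and5P[_ + _ _ _] := S_refines s => /(exp2V_le R).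
by rewrite exprS invfM -/(eps s) -/(eps s.+1) -ler_pdivlMl // mulrC.
Qed.

Let r_mono s t : (s <= t)%N -> r t <= r s.
Proof.
move=> /subnK <-; elim: (t - s)%N => // j; rewrite addSn.
by apply: le_trans; have := rS (j + s); have := r_gt0 (j + s).+1; lra.
Qed.

Let small (e : R) : 0 < e -> exists s0, forall s, (s0 <= s)%N -> r s < e /\ eps s < e.
Proof.
move=> /exp2V_small[s0 h]; exists s0 => s /h hs.
have kl : (s <= st_k (S s))%N /\ (s <= st_l (S s))%N.
  elim: s {hs} => // s [h1 h2]; have /and5P[h3 h4 _ _ _] := S_refines s.
  split; last exact: leq_ltn_trans h4.
  by apply: leq_trans h3; rewrite -addn1 leq_add.
by split; apply: le_lt_trans hs; apply: exp2V_le; case: kl.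
Qed.

Let M_step s i j : (i < n s.+1)%N -> (j < n s.+1)%N ->
  `|M s.+1 i j - M s (st_g (S s.+1) i) (st_g (S s.+1) j)| <=
    (if forces s (S s) then 80 else 16) * r s.
Proof.
have /(linkedP R)[_ _ _ _ h] := S_linked s => hi hj.
by apply: le_trans (h i j hi hj) _; case: ifP.
Qed.

Let g_lt s i : (i < n s.+1)%N -> (st_g (S s.+1) i < n s)%N.
Proof. by have /(linkedP R)[_ _ h _ _] := S_linked s; exact: h. Qed.

Let g_id s i : (i < n s)%N -> st_g (S s.+1) i = i.
Proof. by have /(linkedP R)[_ _ _ h _] := S_linked s; exact: h. Qed.

Let g_near s i : (i < n s.+1)%N ->
  d (st_f (S s.+1) i) (st_f (S s) (st_g (S s.+1) i)) < eps s.
Proof.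
have /and5P[_ _ _ _ /and5P[_ _ h _ _]] := S_refines s => hi.
exact: (dlt_sound rltP (ball_ltP _ _ h i hi)).
Qed.

Fixpoint iter_g (s j i : nat) : nat :=
  if j is j'.+1 then iter_g s j' (st_g (S (s + j')%N.+1) i) else i.

(** The telescoping bound absorbs each new step: [eps t] is at most [2 * (eps t - eps t.+1)],
    because the mesh at least halves. *)
Let iter_gP s j i : (i < n (s + j))%N ->
  [/\ (iter_g s j i < n s)%N, (i < n s)%N -> iter_g s j i = i &
      d (st_f (S (s + j)) i) (st_f (S s) (iter_g s j i)) <= 2 * (eps s - eps (s + j))].
Proof.
elim: j i => [|j IHj] i; first by rewrite addn0 subrr mulr0 (is_metric_xx dm).
rewrite addnS => hi; have hg := g_lt hi; have [h1 h2 h3] := IHj _ hg.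
split=> //= [his|].
  have e : st_g (S (s + j).+1) i = i by apply/g_id/(leq_trans his)/n_mono/leq_addr.
  by rewrite e in h2 *; exact: h2.
have := is_metric_triangle dm (st_f (S (s + j)) (st_g (S (s + j).+1) i))
  (st_f (S (s + j).+1) i) (st_f (S s) (iter_g s j (st_g (S (s + j).+1) i))).
have := g_near hi; have := epsS (s + j); lra.
Qed.

(** Again telescoping: a step moves distances by at most [80 * r t], which is below
    [160 * (r t - r t.+1)] as the unit shrinks by 16. *)
Let M_iter s j i i' : (i < n (s + j))%N -> (i' < n (s + j))%N ->
  `|M (s + j) i i' - M s (iter_g s j i) (iter_g s j i')| <= 160 * (r s - r (s + j)).
Proof.
elim: j i i' => [|j IHj] i i'; first by rewrite addn0 !subrr normr0 mulr0.
rewrite addnS => hi hi' /=; have := IHj _ _ (g_lt hi) (g_lt hi').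
have := M_step hi hi'; rewrite !ler_norml.
have := rS (s + j); have := r_gt0 (s + j); case: ifP => _; lra.
Qed.

Let M_iter_not_forced s j i i' : ~~ forces s (S s) ->
    (i < n (s + j.+1))%N -> (i' < n (s + j.+1))%N ->
  `|M (s + j.+1) i i' - M s (iter_g s j.+1 i) (iter_g s j.+1 i')| <=
    16 * r s + 160 * (r s.+1 - r (s + j.+1)).
Proof.
move=> /negbTE nf; elim: j i i' => [|j IHj] i i'.
  rewrite addn1 => hi hi' /=; rewrite addn0 subrr mulr0 addr0.
  by have := M_step hi hi'; rewrite nf.
rewrite addnS => hi hi'; have := IHj _ _ (g_lt hi) (g_lt hi').
have := M_step hi hi'; rewrite !ler_norml [iter_g s j.+2 i]/= [iter_g s j.+2 i']/=.
rewrite addnS in hi hi' *.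
have := rS (s + j).+1; have := r_gt0 (s + j).+1; case: ifP => _ /=; lra.
Qed.

Let len_mono s t : (s <= t)%N -> (st_len (S s) <= st_len (S t))%N.
Proof.
have h u : (st_len (S u) <= st_len (S u.+1))%N by have /andP[] := S_ext u.
exact: (homo_leq (f := fun u => st_len (S u)) leqnn leq_trans h).
Qed.

Let lt_len s : (s < st_len (S s.+2))%N.
Proof. by have /and5P[_ _ _ + _] := S_refines s.+1. Qed.

Let bit_mono s t k : (s <= t)%N -> (k < st_len (S s))%N -> st_bit (S t) k = st_bit (S s) k.
Proof.
move=> /subnK <-; elim: (t - s)%N => // j IHj hk; rewrite addSn -IHj //.
have hk' : (k < st_len (S (j + s)))%N by apply: leq_trans hk (len_mono (leq_addl _ _)).
have /andP[le_len /ball_ltP/(_ k (leq_trans hk' _))] := S_ext (j + s).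
by rewrite hk' => /(_ le_len)/eqP.
Qed.

Definition generic : set nat := [set k | st_bit (S k.+2) k].

Let in_generic s k : (k < st_len (S s))%N -> (k \in generic) = st_bit (S s) k.
Proof.
move=> hk; have -> : (k \in generic) = st_bit (S k.+2) k.
  by apply/idP/idP; rewrite in_setE.
have [le|/ltnW le] := leqP s k.+2; first exact: bit_mono.
by rewrite (bit_mono le) // lt_len.
Qed.

Let agree_generic s : agree generic (st_bits (S s)) (st_len (S s)).
Proof. by move=> k /in_generic ->. Qed.

Let lock s t k : (s <= t)%N -> (st_len (S s) <= k < st_len (S t))%N ->
  (0 < pi1 k <= s)%N -> st_bit (S t) k = ((pi1 k).-1 \in E).
Proof.
move=> /subnK <-; elim: (t - s)%N => [|j IHj].
  by rewrite add0n => /andP[h1]; rewrite ltnNge h1.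
rewrite addSn => /andP[h1 h2] hp.
have /andP[_ /ball_ltP/(_ k h2)] := S_ext (j + s).
case: ifP => hk; first by move=> /eqP ->; apply: IHj => //; rewrite h1.
have /andP[p0 ps] := hp.
rewrite p0 (leq_trans ps (leq_addl _ _)) /= => /eqP ->.
have [_ _ _ _ ->] // := S_good (j + s).
by rewrite (leq_trans _ (leq_addl _ _)) // prednK.
Qed.

(** For the direction from left to right, suppose that stage [e] does not force: a state late enough
    to contain the halting computation, projected to stage [e], would be a witness. *)
Lemma jump_generic e : turing_jump generic e <-> forces e (S e).
Proof.
split=> [[c [ce [v hv]]]|fe]; last first.
  have /and5P[_ _ + _ _] := S_step e; rewrite fe => /andP[_].
  rewrite /st_halts -[X in universal _ _ X _](prog_ofK e) universalE; case ev: fev => [|v] // _.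
  exists (prog_of e); split; first exact: prog_ofK.
  by exists v; apply: fev_sound ev; exact: agree_generic.
apply: contraT => nf.
have [B hB] := fev_complete hv.
(* From stage [B.+2] on the string is longer than the fuel [B], and [t] lies past [e], as
   [M_iter_not_forced] requires. *)
pose t := (e + B.+2)%N; have le_et : (e <= t)%N := leq_addr _ _.
have hlen : (B <= st_len (S t))%N.
  by apply: leq_trans (ltnW (lt_len B)) (len_mono _); rewrite leq_addl.
(* [S t] projects to its predecessor while a witness must project to [S e], so the state is
   repackaged with the composed projection; the fields tied to the space get default values. *)
pose y := mkstate (st_len (S t)) (st_bit (S t)) (n t) (st_k (S t)) 0 id
  (st_N (S t)) (iter_g e B.+2) 0 0 xpred0.
have yL : st_len y = st_len (S t) by exact: st_lenE.
have yn : st_n y = n t by exact: st_nE.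
have yk : st_k y = st_k (S t) by exact: st_kE.
have yb k : (k < st_len (S t))%N -> st_bit y k = st_bit (S t) k by exact: st_bitE.
have yg i : (i < n t)%N -> st_g y i = iter_g e B.+2 i by exact: st_gE.
have yN i j : (i < n t)%N -> (j < n t)%N -> st_N y i j = st_N (S t) i j by exact: st_NE.
have [[_ tm tbits] _ _ _ _] := S_good t.
case/negP: (nf); apply/asboolP; exists y; apply/and5P; split.
- apply/andP; rewrite yL; split; first exact: len_mono.
  apply/ball_ltP => k hk; rewrite yb //; case: ifP => hke.
    by rewrite (bit_mono le_et).
  apply/implyP => /andP[p0 pe]; rewrite (lock le_et) ?p0 ?pe //; last first.
    by rewrite leqNgt hke.
  have [_ _ _ _ ->] // := S_good e; by rewrite prednK.
- by apply/is_fin_metricP; rewrite yn; apply: eq_nat_metric tm => i j hi hj; rewrite yN.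
- apply/(linkedP R); rewrite yn yk; split.
  + exact: n_mono.
  + rewrite -(ler_nat R); move: (r_mono le_et); rewrite lef_pV2 ?posrE ?exprn_gt0 //.
    by rewrite ler_eXn2l ?ltr1n // ler_nat.
  + by move=> i hi; rewrite yg //; have [] := iter_gP hi.
  + by move=> i hi; have hit := leq_trans hi (n_mono le_et); rewrite yg //;
      have [_ ->] := iter_gP hit.
  + move=> i j hi hj; rewrite /st_M yk !yg // yN //.
    apply: le_trans (M_iter_not_forced nf hi hj) _.
    have := rS e; have := r_gt0 e; have := r_gt0 (e + B.+2); rewrite -/(r e); lra.
- apply/(bits_okP R); rewrite yL yn => k hk; rewrite yb // => hb hc.
  have [h1 h2 h3] := (bits_okP R _ _).1 tbits k hk hb hc.
  split=> //; rewrite /st_M yk yN // mul0r; move: h3; rewrite /asserts /st_M addr0.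
  by apply: le_lt_trans; rewrite lerDl divr_ge0 ?exprn_ge0 ?ler0n.
- rewrite /st_halts yL -[X in universal _ _ X _]ce universalE (hB _ hlen) // => k hk.
  by rewrite (in_generic hk) -yb.
Qed.

Lemma turing_jump_generic_le A : turing_le (turing_jump set0) A -> computable A S ->
  turing_le (turing_jump generic) A.
Proof.
move=> leA cS.
have := computable_forces leA (computable_id A) cS.
apply: computable_ext => e; congr nat_of_bool.
by apply/idP/idP; rewrite in_setE => /jump_generic.
Qed.

(** A limit argument: the jump decides whether a guess, made of a threshold and a value, is refuted
    further down column [c.+1]. The column is eventually constant, so a search finds an unrefuted
    guess. *)
Lemma turing_le_jump_generic : turing_le E (turing_jump generic).
Proof.
have := @computable_jump generic (fun z t =>
  (pi1 (pi2 z) <= t)%N && ((npair (pi1 z).+1 t \in generic) != (pi2 (pi2 z) == 1%N)))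
  ltac:(by computability).
move=> /computable_neg cJ.
have [|h ch hh] := @computable_choice (turing_jump generic) (fun c y =>
    ~~ `[< exists t, (pi1 y <= t)%N && ((npair c.+1 t \in generic) != (pi2 y == 1%N)) >]) cJ.
  move=> c; exists (npair (st_len (S c.+1)) (c \in E)); apply/asboolPn => -[t].
  rewrite pi1K pi2K => /andP[le_t /negP]; apply; apply/eqP.
  pose k := npair c.+1 t; have le_k : (st_len (S c.+1) <= k)%N.
    exact: leq_trans le_t (leq_npairr _ _).
  have [s hs1 hs2] : exists2 s, (c.+1 <= s)%N & (k < st_len (S s))%N.
    exists (maxn c.+1 k.+2); first by rewrite leq_maxl.
    by apply: leq_trans (lt_len k) (len_mono (leq_maxr _ _)).
  have pk : pi1 k = c.+1 := pi1K _ _.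
  by rewrite -/k (in_generic hs2) (lock hs1) ?pk ?le_k ?hs2 ?leqnn //; case: (c \in E).
have := computable_eqn (computable_pi2 ch) (computable_cst _ 1).
apply: computable_ext => c; congr nat_of_bool.
have /asboolPn nh := hh c.
(* Past both the guessed threshold and the locking of the column, the bit equals the guess and also
   the coded value. *)
pose k := npair c.+1 (maxn (pi1 (h c)) (st_len (S c.+1))).
have : (k \in generic) = (pi2 (h c) == 1%N).
  apply/eqP/negPn/negP => ne; apply: nh; exists (maxn (pi1 (h c)) (st_len (S c.+1))).
  by rewrite leq_maxl.
move=> <-; have le_k : (st_len (S c.+1) <= k)%N.
  exact: leq_trans (leq_maxr _ _) (leq_npairr _ _).
have [s hs1 hs2] : exists2 s, (c.+1 <= s)%N & (k < st_len (S s))%N.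
  exists (maxn c.+1 k.+2); first by rewrite leq_maxl.
  by apply: leq_trans (lt_len k) (len_mono (leq_maxr _ _)).
have pk : pi1 k = c.+1 := pi1K _ _.
by rewrite (in_generic hs2) (lock hs1) ?pk ?le_k ?hs2 ?leqnn.
Qed.

Let ex_large i j : exists s, (i < n s)%N /\ (j < n s)%N.
Proof.
exists (maxn i j).+2; have h := lt_n (maxn i j).
by split; apply: leq_ltn_trans h; rewrite ?leq_maxl ?leq_maxr.
Qed.

Let M_stable s t i j : (i < n s)%N -> (j < n s)%N -> (s <= t)%N ->
  `|M t i j - M s i j| <= 160 * r s.
Proof.
move=> hi hj le_st; have hi' := leq_trans hi (n_mono le_st).
have hj' := leq_trans hj (n_mono le_st).
rewrite -(subnKC le_st) in hi' hj' *; have := M_iter hi' hj'.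
have [_ -> // _] := iter_gP hi'; have [_ -> // _] := iter_gP hj'.
by move=> /le_trans; apply; have := r_gt0 (s + (t - s)); lra.
Qed.

Lemma generic_dist_exists : exists D : nat -> nat -> R, forall i j s,
  (i < st_n (S s))%N -> (j < st_n (S s))%N ->
  `|D i j - st_M R (S s) i j| <= 160 / 2 ^+ st_k (S s).
Proof.
have /choice[D hD] : forall ij : nat * nat, exists l : R, forall s,
    (ij.1 < n s)%N /\ (ij.2 < n s)%N -> `|l - M s ij.1 ij.2| <= 160 * r s.
  move=> [i j] /=; apply: exists_limit.
  - exact: ex_large.
  - by move=> s t [hi hj]; exact: M_stable.
  - by move=> s _; rewrite mulr_ge0 // ltW.
  - by move=> s t [hi hj] /n_mono le_n; split; exact: leq_trans le_n.
by exists (fun i j => D (i, j)) => i j s hi hj; exact: (hD (i, j)).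
Qed.

Variable D : nat -> nat -> R.
Hypothesis D_lim : forall i j s, (i < st_n (S s))%N -> (j < st_n (S s))%N ->
  `|D i j - st_M R (S s) i j| <= 160 / 2 ^+ st_k (S s).

Definition generic_point i := st_f (S i.+2) i.

Let f_stable s i : (i < n s)%N -> st_f (S s) i = generic_point i.
Proof.
have h u t : (u <= t)%N -> (i < n u)%N -> st_f (S t) i = st_f (S u) i.
  move=> /subnK <- hi; elim: (t - u)%N => // k IHk; rewrite addSn -IHk.
  have /and5P[_ _ _ _ /and5P[/ball_ltP hf _ _ _ _]] := S_refines (k + u).
  by apply/eqP/hf/(leq_trans hi)/n_mono/leq_addl.
move=> hi; have [le|/ltnW le] := leqP s i.+2; first by rewrite /generic_point (h s).
by rewrite (h i.+2) // lt_n.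
Qed.

Let ex_small (e : R) i j k : 0 < e ->
  exists s, [/\ (i < n s)%N, (j < n s)%N, (k < n s)%N & r s < e].
Proof.
move=> /small[s0 h]; exists (maxn s0 (maxn i (maxn j k)).+2).
have [-> _] := h _ (leq_maxl s0 (maxn i (maxn j k)).+2).
have h' := leq_trans (lt_n (maxn i (maxn j k))) (n_mono (leq_maxr s0 _)).
by split=> //; apply: leq_ltn_trans h'; rewrite !leq_max leqnn ?orbT.
Qed.

(** Points that appear only after stage [s] are represented at stage [s] by their images under the
    composed projection, so estimates at one stage control all pairs uniformly. *)
Let rep s i j : exists a b, [/\ (a < n s)%N, (b < n s)%N, `|D i j - M s a b| <= 160 * r s,
  d (generic_point i) (st_f (S s) a) <= 2 * eps s &
  d (generic_point j) (st_f (S s) b) <= 2 * eps s].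
Proof.
have [k [hi0 hj0]] := ex_large i j.
have hi : (i < n (s + k))%N := leq_trans hi0 (n_mono (leq_addl _ _)).
have hj : (j < n (s + k))%N := leq_trans hj0 (n_mono (leq_addl _ _)).
have DM := D_lim hi hj; have fi := f_stable hi; have fj := f_stable hj.
exists (iter_g s k i), (iter_g s k j).
have [a1 _ a2] := iter_gP hi; have [b1 _ b2] := iter_gP hj.
have := M_iter hi hj; rewrite -fi -fj.
move: DM; rewrite -/(r (s + k)) -/(M (s + k) i j) => DM MM.
split=> //.
- by move: DM MM; rewrite !ler_norml; lra.
- by have := eps_gt0 (s + k); lra.
- by have := eps_gt0 (s + k); lra.
Qed.

Lemma generic_unif (e : R) : 0 < e -> exists2 del : R, 0 < del &
  forall i j, D i j < del -> d (generic_point i) (generic_point j) < e.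
Proof.
(* Two meshes at either end for the representatives, plus [2 ^- s] between them. *)
move=> e_gt0; have e5 : 0 < e / 5 by lra.
have [s0 h0] := small e5; have [s1 h1] := exp2V_small e5.
pose s := maxn s0 s1; have hs := h1 s (leq_maxr _ _).
have [_ heps] := h0 s.+1 (leq_trans (leq_maxl _ _) (leqnSn _)).
(* [40 + 160 = 200]: the representatives are then less than 200 units apart, which excludes the
   second alternative of the separation test. *)
exists (40 * r s.+1) => [|i j lt_D]; first by rewrite mulr_gt0.
have [a [b [ha hb DM da db]]] := rep s.+1 i j.
have dab : d (st_f (S s.+1) a) (st_f (S s.+1) b) < (2 ^+ s)^-1.
  have /and5P[_ _ _ _ /and5P[_ _ _ _ /and4P[_ /ball_ltP/(_ a ha)/ball_ltP/(_ b hb) + _ _]]]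
    := S_refines s.
  case/orP => [/(dlt_sound rltP)//|N200].
  have : 200 * r s.+1 < M s.+1 a b by rewrite ltr_pM2r // ltr_nat.
  by move: DM; rewrite ler_norml; lra.
have := is_metric_triangle dm (st_f (S s.+1) a) (generic_point i) (generic_point j).
have := is_metric_triangle dm (st_f (S s.+1) b) (st_f (S s.+1) a) (generic_point j).
by rewrite (is_metric_sym dm (st_f (S s.+1) b)); lra.
Qed.

Lemma generic_unifV (e : R) : 0 < e -> exists2 del : R, 0 < del &
  forall i j, d (generic_point i) (generic_point j) < del -> D i j < e.
Proof.
(* The representatives end up within five meshes, so the closeness test yields at most 2 units, and
   the drift adds 160. *)
move=> e_gt0; have e2 : 0 < e / 162 by lra.
have [s /(_ s (leqnn _))[hr _]] := small e2.
exists (eps s) => // i j lt_d; have [a [b [ha hb DM da db]]] := rep s i j.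
have [_ _ _ close _] := S_good s.
have : M s a b <= 2 * r s.
  have [N2|] := close a b ha hb; first by rewrite ler_pM2r // ler_nat.
  have := is_metric_triangle dm (generic_point i) (st_f (S s) a) (st_f (S s) b).
  have := is_metric_triangle dm (generic_point j) (generic_point i) (st_f (S s) b).
  rewrite (is_metric_sym dm (st_f (S s) a) (generic_point i)) -/(eps s).
  by have := eps_gt0 s; lra.
by move: DM; rewrite ler_norml; lra.
Qed.

Lemma generic_point_dense x (e : R) : 0 < e -> exists i, d (generic_point i) x < e.
Proof.
move=> /small[s /(_ s (leqnn _))[_ he]]; have [_ _ net _ _] := S_good s.
have [i hi dx] := net x; exists i.
by rewrite -(f_stable hi) (is_metric_sym dm) (lt_trans dx).
Qed.

(** All axioms but separation pass to the limit. Separation could be lost there; it is recovered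
    from [generic_unif] and the injectivity of the point map. *)
Lemma generic_is_metric : is_metric D.
Proof.
split.
- move=> i; apply/eqP; rewrite -normr_le0; apply/ler_addgt0Pl => e e_gt0.
  have e2 : 0 < e / 160 by lra.
  have [s [hi _ _ hr]] := ex_small i i i e2; have := D_lim hi hi.
  have [[_ [N0 _ _ _] _] _ _ _ _] := S_good s.
  by rewrite /st_M N0 // mul0r subr0 -/(r s); lra.
- move=> i j D0; have dij : d (generic_point i) (generic_point j) = 0.
    apply/eqP; rewrite eq_le (is_metric_ge0 dm) andbT; apply/ler_addgt0Pl => e.
    by move=> /generic_unif[del del_gt0 h]; rewrite addr0 ltW // h // D0.
  have [s [hi hj]] := ex_large i j; have [_ finj _ _ _] := S_good s.
  by apply: finj => //; rewrite !f_stable //; exact: (is_metric_eq dm).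
- move=> i j; apply/eqP; rewrite -subr_eq0 -normr_le0; apply/ler_addgt0Pl => e e_gt0.
  have e2 : 0 < e / 320 by lra.
  have [s [hi hj _ hr]] := ex_small i j i e2.
  have := D_lim hi hj; have := D_lim hj hi.
  have [[_ [_ _ Ns _] _] _ _ _ _] := S_good s.
  by rewrite /st_M (Ns j i) // -/(r s) !ler_norml; lra.
- move=> j i k; apply/ler_addgt0Pl => e e_gt0.
  have e2 : 0 < e / 480 by lra.
  have [s [hi hj hk hr]] := ex_small i j k e2.
  have [[_ Nm _] _ _ _ _] := S_good s.
  have [_ _ _ /(_ i j k hi hj hk)] := fin_metric_scale R (st_k (S s)) Nm.
  have := D_lim hi hj; have := D_lim hj hk; have := D_lim hi hk.
  by rewrite /st_M -/(r s) !ler_norml; lra.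
Qed.

Lemma generic_asserts k : k \in generic -> pi1 k = 0%N ->
  `|(pos_a k)%:R / 2 ^+ pos_p k - D (pos_i k) (pos_j k)| <= 2 / 2 ^+ pos_p k.
Proof.
rewrite (in_generic (lt_len k)) => hb hc.
have [[_ _ hbits] _ _ _ _] := S_good k.+2.
have [hi hj hM] := (bits_okP R _ _).1 hbits k (lt_len k) hb hc.
have := D_lim hi hj; move: hM; rewrite /asserts -/(r k.+2).
move: (pos_a k)%:R (2 ^+ pos_p k) (D _ _) (st_M _ _ _ _) => a p D' M' h1 h2.
have := ler_distD M' (a / p) D'; rewrite [`|M' - D'|]distrC.
have := r_gt0 k.+2; move: h1 h2.
move: `|D' - M'| `|a / p - M'| `|a / p - D'| (2 / p) (r k.+2) => *; lra.
Qed.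

Lemma generic_total i j p : exists v, npair 0 (npair i (npair j (npair p v))) \in generic.
Proof.
pose s := (maxn i (maxn j p)).+1.
have /and5P[_ _ _ _ /and5P[_ _ _ _ /and4P[_ _ /ball_ltP h _]]] := S_refines s.
have hi : (i < s)%N by rewrite ltnS !leq_max leqnn.
have hj : (j < s)%N by rewrite ltnS !leq_max leqnn orbT.
have hp : (p < s)%N by rewrite ltnS !leq_max leqnn !orbT.
have /ball_ltP/(_ j hj)/ball_ltP/(_ p hp)/bex_ltP[v _ /andP[h1 h2]] := h i hi.
by exists v; rewrite (in_generic h1).
Qed.

Lemma generic_computable_metric : computable_metric generic (OmegaMetric generic_is_metric).
Proof.
(* Assertions of precision [p.+1] are consulted, since their tolerance [2 / 2 ^ p.+1] is
   [2 ^- p]. *)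
have [||h ch hh] := @computable_choice generic (fun x v =>
    npair 0 (npair (pi1 x) (npair (pi1 (pi2 x)) (npair (pi2 (pi2 x)).+1 v))) \in generic).
- by computability.
- by move=> x; exact: generic_total.
have [c hc] : computable generic (fun x => dyadic (pi1 (h x)) (pi2 (pi2 x)).+1).
  by rewrite /dyadic; computability.
exists c => i j p; eexists; first exact: hc.
rewrite ratr_dyadic !(pi1K, pi2K) /=.
have := hh (npair i (npair j p)); rewrite !(pi1K, pi2K) => /generic_asserts.
rewrite pi1K => /(_ erefl); rewrite /pos_a /pos_p /pos_i /pos_j !(pi1K, pi2K).
suff -> : 2 / 2 ^+ p.+1 = (2 ^+ p)^-1 :> R by [].
by rewrite exprS invfM mulrA divff ?pnatr_eq0 // mul1r.
Qed.

End Limit.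

(** * Jump inversion and the equality of degree sets *)

Section JumpInversion.
Variable R : realType.
Local Open Scope ring_scope.

Lemma computable_metric_comparisons (E : set nat) (d : omega_metric R) :
    computable_metric E d ->
  exists rlt rgt : nat -> bool, [/\ computable E rlt, computable E rgt,
    forall i j l, d i j < (2 ^+ l)^-1 <-> exists t, rlt (npair (npair i (npair j l)) t) &
    forall i j l, 10 / 2 ^+ l < d i j <-> exists t, rgt (npair (npair i (npair j l)) t)].
Proof.
move=> /computable_metric_approx[q cq hq].
pose ap z := q (npair (pi1 (pi1 z)) (npair (pi1 (pi2 (pi1 z))) (pi2 z))).
have cap : computable E ap by apply: (computable_comp cq); computability.
exists (fun z => rat_add_lt (ap z) 1 (pi2 z) (dyadic 1 (pi2 (pi2 (pi1 z))))).
exists (fun z => rat_add_lt (dyadic 10 (pi2 (pi2 (pi1 z)))) 1 (pi2 z) (ap z)).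
split.
- by apply: computable_rat_add_lt => //; try apply: computable_dyadic; computability.
- by apply: computable_rat_add_lt => //; try apply: computable_dyadic; computability.
- move=> i j l; split=> [h|[t]].
    have h2 : 0 < ((2 ^+ l)^-1 - d i j) / 2 by rewrite divr_gt0 // subr_gt0.
    have [t /(_ t (leqnn _)) ht] := exp2V_small h2; exists t.
    rewrite (rat_add_ltP R) ratr_dyadic /ap !(pi1K, pi2K).
    by have := hq i j t; rewrite ler_norml; lra.
  rewrite (rat_add_ltP R) ratr_dyadic /ap !(pi1K, pi2K).
  by have := hq i j t; rewrite ler_norml; lra.
- move=> i j l; split=> [h|[t]].
    have h2 : 0 < (d i j - 10 / 2 ^+ l) / 2 by rewrite divr_gt0 // subr_gt0.
    have [t /(_ t (leqnn _)) ht] := exp2V_small h2; exists t.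
    rewrite (rat_add_ltP R) ratr_dyadic /ap !(pi1K, pi2K).
    by have := hq i j t; rewrite ler_norml; lra.
  rewrite (rat_add_ltP R) ratr_dyadic /ap !(pi1K, pi2K).
  by have := hq i j t; rewrite ler_norml; lra.
Qed.

Lemma jump_inversion_presentation (X : topologicalType) (E : set nat)
    (P : compact_presentation R X) : compact [set: X] -> perfect_set [set: X] ->
    computable_compact E P ->
  exists (D : set nat) (Q : polish_presentation R X), computable_polish D Q /\
    turing_equiv (turing_join E (turing_jump set0)) (turing_jump D).
Proof.
move=> cX pX [cm ccov]; have hP := pp_homeo P.
set d : omega_metric R := P in cm ccov hP.
have cd := homeomorphic_compact hP cX.
have dtb := compact_totally_bounded cd.
have dperf := perfect_no_isolated_point hP pX.
have [rlt [rgt [clt cgt rltP rgtP]]] := computable_metric_comparisons cm.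
have [Rc [cRc hRc]] := ce_in_normal ccov.
pose rcov z := Rc (pi1 z) (pi2 z).
have rcovP n : cover_codes d n <-> exists t, rcov (npair n t).
  by rewrite hRc; split=> -[t ht]; exists t; move: ht; rewrite /rcov pi1K pi2K.
pose A := turing_join E (turing_jump set0).
have leE : turing_le E A := turing_le_joinl _ _.
have leJ : turing_le (turing_jump set0) A := turing_le_joinr _ _.
have [x0 gx0] := good_state0 E dtb.
have [S [cS S_good S_step]] := computable_choice_seq
  (computable_step leE leJ clt cgt cRc) gx0
  (fun s x => @step_exists R d rlt rgt rcov E rltP rgtP rcovP dtb dperf s x)
  (fun s x y => @step_good R d rlt rgt rcov E rgtP rcovP s x y).
have [D hD] := generic_dist_exists rltP S_step.
pose dD := OmegaMetric (generic_is_metric rltP S_good S_step hD).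
have homeo : homeomorphic (completion dD) X.
  apply: homeomorphic_trans hP; apply: (@uniform_equivalence_homeomorphic _ dD d).
  - by eapply generic_unif; eassumption.
  - by eapply generic_unifV; eassumption.
  - by eapply generic_point_dense; eassumption.
exists (generic S), (PolishPresentation homeo); split.
  exact: generic_computable_metric.
split; last by eapply turing_jump_generic_le; eassumption.
apply: turing_le_join; first by eapply turing_le_jump_generic; eassumption.
exact: turing_jump_mono (turing_le0 _).
Qed.

End JumpInversion.

Theorem theorem5p1 (R : realType) (X : topologicalType)
    (X_polish : polish_space R X) (X_compact : compact [set: X])
    (X_perfect : perfect_set [set: X]) :
  [set turing_degree (turing_jump D) | D in
     [set D | exists P : polish_presentation R X, computable_polish D P]] =
  [set turing_degree (turing_join D (turing_jump set0)) | D in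
     [set D | exists P : compact_presentation R X, computable_compact D P]].
Proof.
apply/seteqP; split=> _ [D [P hP] <-].
  exists (turing_jump D); first exact: computable_compact_jump hP.
  apply: turing_degree_eq; split; last exact: turing_le_joinl.
  apply: turing_le_join; first exact: turing_le_refl.
  exact: turing_jump_mono (turing_le0 D).
have [D' [Q [cQ eq]]] := jump_inversion_presentation X_compact X_perfect hP.
by exists D'; [exists Q|apply/esym/turing_degree_eq].
Qed.
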